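(* Let $n\ge 2$, let $\Omega\subseteq\mathbb{R}^n$ be a bounded open set with $|\partial\Omega|<+\infty$, let $x_0\in\Omega$, and let $\partial\Omega$ be a harmonic pseudosphere centered at $x_0$. If $\partial\Omega$ is Lipschitz flat at a point $z\in T(\partial\Omega,x_0)$, then $\partial\Omega$ is a Euclidean sphere centered at $x_0$. Precisely, $$\partial\Omega=\partial B(x_0,|x_0-z|).$$
   Context: Notation: $\sigma$ is the $(n-1)$-dimensional Hausdorff measure in $\mathbb{R}^n$, $|\partial\Omega|$ denotes the $(n-1)$-Hausdorff measure of the topological boundary, $\fint_{\partial\Omega}u\,d\sigma=\frac1{|\partial\Omega|}\int_{\partial\Omega}u\,d\sigma$, $B(x,\rho)$ is the open Euclidean ball. Harmonic pseudosphere: for $\Omega\subseteq\mathbb{R}^n$ bounded open with $|\partial\Omega|<+\infty$ and $x_0\in\Omega$, $\partial\Omega$ is called a harmonic pseudosphere centered at $x_0$ if $u(x_0)=\fint_{\partial\Omega}u\,d\sigma$ for every function $u$ harmonic in $\Omega$ and continuous up to $\partial\Omega$ (i.e. continuous on $\overline\Omega$). Touching set: $T(\partial\Omega,x_0):=\{z\in\partial\Omega: |x_0-z|=\mathrm{dist}(\partial\Omega,x_0)\}$. Lipschitz flatness: split $\mathbb{R}^n=\mathbb{R}^{n-1}\times\mathbb{R}$ and write $z=(z',z_n)$ with $z'=(z_1,\dots,z_{n-1})$. For $R>0$ and $-\infty<a<z_n<b<+\infty$ put $\widehat B_R(z'):=\{y\in\mathbb{R}^{n-1}: |y-z'|<R\}$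 and $U_R(a,b):=\widehat B_R(z')\times(a,b)$. Let $\Omega\subseteq\mathbb{R}^n$ be open and $z\in\partial\Omega$. $\partial\Omega$ is Lipschitz flat at $z$ if there exists a function $\psi:\widehat B_R(z')\to(a,b)$, with $R>0$ and $-\infty<a<z_n<b<+\infty$, such that: (i) $\psi$ is Lipschitz, differentiable, and $\nabla\psi(z'+t\xi)\to\nabla\psi(z')$ as $t\to0$ for almost every $\xi\in\mathbb{R}^{n-1}$; (ii) $\partial\Omega\cap U_R(a,b)=\{(y,\psi(y)): y\in\widehat B_R(z')\}$; (iii) $\Omega\cap U_R(a,b)=\{(y,t): y\in\widehat B_R(z'),\ a<t<\psi(y)<b\}$. *)

(* Defs.v *)
From HB Require Import structures.
From mathcomp Require Import all_boot all_order all_algebra.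
From mathcomp Require Import all_classical all_reals all_analysis.

Set Implicit Arguments.
Unset Strict Implicit.
Unset Printing Implicit Defensive.
Import Order.TTheory GRing.Theory Num.Theory.
Import numFieldNormedType.Exports.

Local Open Scope classical_set_scope.
Local Open Scope ring_scope.

(** R^n is ['rV[R]_n]. The library norm on ['rV[R]_n] is the sup norm: it is used
    only for topological notions (open sets, closure, limits, boundedness,
    differentiability, the Lipschitz property). Distances, balls and diameters
    are Euclidean and use [norm2]. *)

Section Euclidean.
Context {R : realType}.

Definition norm2 {n : nat} (x : 'rV[R]_n) : R :=
  Num.sqrt (\sum_(i < n) x 0 i ^+ 2).

Definition ball2 {n : nat} (x : 'rV[R]_n) (r : R) : set 'rV[R]_n :=
  [set y | norm2 (y - x) < r].

Definition boundary {n : nat} (A : set 'rV[R]_n) : set 'rV[R]_n :=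
  closure A `\` interior A.

Definition dist2 {n : nat} (A : set 'rV[R]_n) (x : 'rV[R]_n) : R :=
  inf [set norm2 (x - y) | y in A].

Definition basis_vec {n : nat} (i : 'I_n) : 'rV[R]_n := delta_mx 0 i.

Definition grad {n : nat} (f : 'rV[R]_n -> R) (x : 'rV[R]_n) : 'rV[R]_n :=
  \row_(i < n) 'D_(basis_vec i) f x.

(** [diam2 set0 = -oo]; for nonempty [A] it is the usual diameter, in [0, +oo]. *)
Definition diam2 {n : nat} (A : set 'rV[R]_n) : \bar R :=
  ereal_sup [set (norm2 (p.1 - p.2))%:E | p in A `*` A].

(** Lebesgue-null sets of R^k: coverable by countably many boxes of
    arbitrarily small total volume. *)
Definition lebesgue_null {k : nat} (N : set 'rV[R]_k) : Prop :=
  forall e : R, 0 < e -> exists a b : nat -> 'rV[R]_k,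
    [/\ forall j i, a j 0 i <= b j 0 i,
        N `<=` \bigcup_j [set x | forall i, a j 0 i <= x 0 i <= b j 0 i] &
        (\sum_(j <oo) (\prod_(i < k) (b j 0 i - a j 0 i))%:E <= e%:E)%E].

End Euclidean.

(** The outer measure generated by the gauge [g] on the covering class [P]. *)
Section CoverOuter.
Local Open Scope ereal_scope.
Context {R : realType} {T : Type}.
Variables (P : set (set T)) (g : set T -> \bar R).

Definition is_cover (X : set T) : set ((set T)^nat) :=
  [set F | (forall i, P (F i)) /\ X `<=` \bigcup_k (F k)].

Definition cover_outer (X : set T) : \bar R :=
  ereal_inf [set \sum_(k <oo) g (F k) | F in is_cover X].

Hypotheses (P0 : P set0) (g0 : g set0 = 0) (g_ge0 : forall X, 0 <= g X).

Lemma le_cover_outer : {homo cover_outer : A B / A `<=` B >-> A <= B}.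
Proof.
move=> A B AB; apply/ereal_inf_le_tmp => x [B' [mB' BB']].
by move=> <-{x}; exists B' => //; split => //; apply: subset_trans AB BB'.
Qed.

Lemma cover_outer_ge0 A : 0 <= cover_outer A.
Proof.
by apply: le_ereal_inf_tmp => x [B [mB AB] <-{x}]; apply: nneseries_ge0.
Qed.

Lemma cover_outer0 : cover_outer set0 = 0.
Proof.
apply/eqP; rewrite eq_le cover_outer_ge0 andbT.
apply: ereal_inf_lbound; exists (fun=> set0); first by split.
by apply: eseries0 => *.
Qed.

Lemma cover_outer_sigma_subadditive : sigma_subadditive cover_outer.
Proof.
move=> A; have [[i ioo]|] := pselect (exists i, cover_outer (A i) = +oo).
  rewrite (eseries_pinfty _ _ ioo) ?leey// => n _.
  by rewrite -ltNye (lt_le_trans _ (cover_outer_ge0 _)).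
rewrite -forallNE => Aoo.
suff add2e (e : {posnum R}) : cover_outer (\bigcup_n A n) <=
    \sum_(i <oo) cover_outer (A i) + e%:num%:E.
  by apply/lee_addgt0Pr => _/posnumP[].
rewrite (le_trans _ (epsilon_trick _ _ _))//; last first.
  by move=> n; exact: cover_outer_ge0.
pose Q n (B : (set T)^nat) := is_cover (A n) B /\
  \sum_(k <oo) g (B k) <= cover_outer (A n) + (e%:num / (2 ^ n.+1)%:R)%:E.
have [G QG] : {G : ((set T)^nat)^nat & forall n, Q n (G n)}.
  apply: (@choice _ _ Q) => n; rewrite /Q /cover_outer.
  set S := (X in ereal_inf X); move infS : (ereal_inf S) => iS.
  case: iS infS => [r Sr|Soo|Soo].
  - have en1 : (0 < e%:num / (2 ^ n.+1)%:R)%R by [].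
    have /(lb_ereal_inf_adherent en1) : ereal_inf S \is a fin_num by rewrite Sr.
    move=> [x [B [mB AnB muBx] xS]].
    by exists B; split => //; rewrite muBx -Sr; exact/ltW.
  - by have := Aoo n; rewrite /cover_outer Soo.
  - suff : lbound S 0 by move/le_ereal_inf_tmp; rewrite Soo.
    by move=> /= _ [B [mB AnB] <-]; exact: nneseries_ge0.
have gG_ge0 x : 0 <= (g \o uncurry G) x by exact: g_ge0.
apply: (@le_trans _ _ (\esum_(i in setT) (g \o uncurry G) i)).
  apply: ereal_inf_lbound => /=.
  have /card_esym/ppcard_eqP[f] := card_nat2.
  exists (uncurry G \o f).
    split => [i|]; first by rewrite /= /uncurry; case: (f i) => a b; exact: (QG a).1.1.
    apply: (@subset_trans _  (\bigcup_n \bigcup_k G n k)) => [t [i _]|].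
      by move=> /((QG i).1.2) -[j _ ?]; exists i => //; exists j.
    move=> t [i _ [j _ Bijt]]; exists (f^-1%FUN (i, j)) => //=.
    by rewrite invK ?inE.
  rewrite -(esum_pred_image (g \o uncurry G) _ xpredT) ?[fun=> _]set_true//.
  by rewrite image_eq.
rewrite (_ : esum _ _ = \sum_(i <oo) \sum_(j <oo ) g (G i j)); last first.
  pose J : nat -> set (nat * nat) := fun i => [set (i, j) | j in setT].
  rewrite (_ : setT = \bigcup_k J k); last first.
    by rewrite predeqE => -[a b]; split => // _; exists a => //; exists b.
  rewrite esum_bigcupT /=; last 2 first.
    - apply/trivIsetP => i j _ _ ij.
      rewrite predeqE => -[n m] /=; split => //= -[] [_] _ [<-{n} _].
      by move=> [m' _] [] /esym/eqP; rewrite (negbTE ij).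
    - by move=> /= [n m]; apply: g_ge0.
  rewrite -(image_id [set: nat]) -fun_true esum_pred_image//; last first.
    by move=> n _; exact: esum_ge0.
  apply: eq_eseriesr => /= j _.
  rewrite -(esum_pred_image (g \o uncurry G) (pair j) predT)//=; last first.
    by move=> ? ? _ _; exact: (@can_inj _ _ _ snd).
  by congr esum; rewrite predeqE => -[a b]; split; move=> [i _ <-]; exists i.
apply: lee_nneseries => [n _ _|n _]; first exact: nneseries_ge0.
exact: (QG n).2.
Qed.

End CoverOuter.

Section Hausdorff.
Context {R : realType}.

(** Volume of the unit ball of R^s, by the classical two-step recursion
    omega_(s+2) = 2 pi omega_s / (s + 2). *)
Fixpoint unit_ball_volume (s : nat) : R :=
  match s with
  | 0 => 1
  | 1 => 2
  | s'.+2 => 2 * pi / s'.+2%:R * unit_ball_volume s'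
  end.

Lemma unit_ball_volume_gt0 s : 0 < unit_ball_volume s.
Proof.
suff [] : 0 < unit_ball_volume s /\ 0 < unit_ball_volume s.+1 by [].
elim: s => [|s [h0 h1]]; first by split => /=.
by split => //=; rewrite !mulr_gt0 ?invr_gt0 ?pi_gt0.
Qed.

Variables (n s : nat).
Implicit Types A : set 'rV[R]_n.
Local Open Scope ereal_scope.

(** The empty set has gauge [0], also when [s = 0]. *)
Definition hausdorff_gauge A : \bar R :=
  if A == set0 then 0
  else (unit_ball_volume s / 2 ^+ s)%:E * diam2 A ^+ s.

Lemma hausdorff_gauge0 : hausdorff_gauge set0 = 0.
Proof. by rewrite /hausdorff_gauge eqxx. Qed.

Lemma hausdorff_gauge_ge0 A : 0 <= hausdorff_gauge A.
Proof.
rewrite /hausdorff_gauge; case: eqVneq => // /set0P[x Ax].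
apply: mule_ge0.
  by rewrite lee_fin divr_ge0 ?exprn_ge0// ltW// unit_ball_volume_gt0.
apply: expe_ge0; apply: ereal_sup_ubound; exists (x, x) => //=.
rewrite subrr /norm2 big1 ?sqrtr0// => i _.
by rewrite mxE expr0n.
Qed.

Definition hausdorff_pre (d : R) : set 'rV[R]_n -> \bar R :=
  cover_outer [set U | diam2 U <= d%:E] hausdorff_gauge.

(** The [s]-dimensional Hausdorff outer measure on R^n, normalized so that it
    agrees with Lebesgue measure when [s = n]. *)
Definition hausdorff A : \bar R :=
  ereal_sup [set hausdorff_pre d A | d in [set d : R | (0 < d)%R]].

Lemma diam2_set0 (d : R) : [set U : set 'rV[R]_n | diam2 U <= d%:E] set0.
Proof.
rewrite /= /diam2 (_ : _ @` _ = set0) ?ereal_sup0 ?leNye//.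
by rewrite -subset0 => y [] [a b] [].
Qed.

Lemma hausdorff_pre_ge0 d A : 0 <= hausdorff_pre d A.
Proof. exact/cover_outer_ge0/hausdorff_gauge_ge0. Qed.

Lemma hausdorff0 : hausdorff set0 = 0.
Proof.
rewrite /hausdorff (_ : _ @` _ = [set 0]) ?ereal_sup1//.
have pre0 d : hausdorff_pre d set0 = 0.
  exact: (cover_outer0 (diam2_set0 d) hausdorff_gauge0 hausdorff_gauge_ge0).
by apply/seteqP; split=> [y [d _ <-]//|_ ->]; exists 1%R; rewrite /= ?pre0.
Qed.

Lemma hausdorff_ge0 A : 0 <= hausdorff A.
Proof.
apply: le_trans (hausdorff_pre_ge0 1 A) _.
by apply: ereal_sup_ubound; exists 1%R => /=.
Qed.

Lemma le_hausdorff : {homo hausdorff : A B / A `<=` B >-> A <= B}.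
Proof.
move=> A B AB; apply: ge_ereal_sup => _ [d d0 <-].
apply: le_trans (le_cover_outer _ _ AB) _.
by apply: ereal_sup_ubound; exists d.
Qed.

Lemma hausdorff_sigma_subadditive : sigma_subadditive hausdorff.
Proof.
move=> F; apply: ge_ereal_sup => _ [d d0 <-].
apply: le_trans (cover_outer_sigma_subadditive _ hausdorff_gauge_ge0 _) _.
apply: lee_nneseries => [i _ _|i _]; first exact: hausdorff_pre_ge0.
by apply: ereal_sup_ubound; exists d.
Qed.

HB.instance Definition _ := isOuterMeasure.Build R 'rV[R]_n hausdorff
  hausdorff0 hausdorff_ge0 le_hausdorff hausdorff_sigma_subadditive.

(** The Hausdorff measure: [hausdorff] on its Caratheodory sigma-algebra. *)
Definition hausdorff_measure :
    {measure set (caratheodory_type hausdorff) -> \bar R} :=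
  let mu : {outer_measure set 'rV[R]_n -> \bar R} := hausdorff in
  (mu : set (caratheodory_type mu) -> \bar R).

End Hausdorff.

Arguments hausdorff {R} n s A.
Arguments hausdorff_measure {R} n s.

Section Pseudosphere.
Context {R : realType}.

(** Continuity of all second partial derivatives on the open set [W] is
    equivalent to [u] being C^2 there; functions on [W] are represented by total
    functions, whose values off [W] do not matter. *)
Definition harmonic_on {n : nat} (W : set 'rV[R]_n) (u : 'rV[R]_n -> R) : Prop :=
  (forall x, W x -> forall i j : 'I_n,
    [/\ derivable u x (basis_vec i),
        derivable ('D_(basis_vec i) u) x (basis_vec j) &
        {for x, continuous ('D_(basis_vec j) ('D_(basis_vec i) u))}]) /\
  (forall x, W x -> \sum_(i < n) 'D_(basis_vec i) ('D_(basis_vec i) u) x = 0).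

Definition surface {m : nat} := @hausdorff_measure R m.+1 m.

Definition average_boundary {m : nat} (W : set 'rV[R]_m.+1)
    (u : 'rV[R]_m.+1 -> R) : R :=
  (fine (surface (boundary W)))^-1 * \int[surface]_(x in boundary W) u x.

Definition harmonic_pseudosphere {m : nat} (W : set 'rV[R]_m.+1)
    (x0 : 'rV[R]_m.+1) : Prop :=
  forall u : 'rV[R]_m.+1 -> R,
    harmonic_on W u -> {within closure W, continuous u} ->
    u x0 = average_boundary W u.

Definition touching_set {n : nat} (W : set 'rV[R]_n) (x0 : 'rV[R]_n) :
    set 'rV[R]_n :=
  [set z | boundary W z /\ norm2 (x0 - z) = dist2 (boundary W) x0].

(** The splitting R^(m+1) = R^m x R, [z = (head_coords z, last_coord z)]. *)
Definition head_coords {m : nat} (z : 'rV[R]_m.+1) : 'rV[R]_m :=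
  \row_(i < m) z 0 (widen_ord (leqnSn m) i).

Definition last_coord {m : nat} (z : 'rV[R]_m.+1) : R := z 0 ord_max.

Definition cylinder {m : nat} (B : set 'rV[R]_m) (a b : R) :
    set 'rV[R]_m.+1 :=
  [set x | B (head_coords x) /\ a < last_coord x < b].

Definition lipschitz_flat {m : nat} (W : set 'rV[R]_m.+1)
    (z : 'rV[R]_m.+1) : Prop :=
  exists (r a b : R) (psi : 'rV[R]_m -> R),
    let z' := head_coords z in
    let B := ball2 z' r in
    let U := cylinder B a b in
    [/\ 0 < r, a < last_coord z < b & forall y, B y -> a < psi y < b] /\
    [/\ [lipschitz psi y | y in B],
        forall y, B y -> differentiable psi y &
        lebesgue_null [set xi : 'rV[R]_m |
          ~ (grad psi (z' + t *: xi) @[t --> 0^'] --> grad psi z')]] /\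
    boundary W `&` U =
      [set x | B (head_coords x) /\ last_coord x = psi (head_coords x)] /\
    W `&` U =
      [set x | B (head_coords x) /\
               a < last_coord x < psi (head_coords x)].

End Pseudosphere.

(* Main.v *)
Require Import Defs.
From mathcomp Require Import all_boot all_order all_algebra.
From mathcomp Require Import all_classical all_reals all_analysis.
From mathcomp Require Import measurable_realfun ring lra.
Import Order.TTheory GRing.Theory Num.Theory.
Import numFieldNormedType.Exports.
Local Open Scope classical_set_scope.
Local Open Scope ring_scope.
Set Implicit Arguments.
Unset Strict Implicit.
Unset Printing Implicit Defensive.

(** Let [c] be the centre, [D] the boundary of the domain [W], [r = |z - c|] the
    distance from [c] to [D], [S] the sphere of radius [r] about [c], and [n = m + 1].
    The ball of radius [r] lies in [W] and touches [D] at [z]. The mean value property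
    is tested with the Poisson kernels
      [h_b x = (b^2 - |x - c|^2) / |x - p|^n],  [p = c + (b / r) (z - c)],  [b > r],
    whose pole lies outside of the closure of [W] for [b] close to [r], because the
    flatness of [D] at [z] forces [z - c] to be normal to [D] and to point outwards.
    As [h_b c = b^(2 - n)], the integral of [h_b] over [D] is [b^(2 - n) |D|]
    ([pseudosphere_poisson]), and likewise its integral over [S] is [b^(2 - n) |S|]
    ([sphere_poisson_mean]).

    Now let [b] tend to [r]. On [D] one has [|x - c| >= r]. Away from [z] the positive
    part of [h_b] tends to zero, and where [|x - c| >= r + eta] the kernel stays
    below a negative constant. Near [z], [h_b] is at most the kernel
    [(b^2 - r^2) / |x - p|^n] of the sphere, and [near_estimate] shows that the
    integral of the latter over the piece of [D] near [z] exceeds its integral over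
    [S] by an arbitrarily small amount. Hence [excess_estimate]: up to a positive
    factor, [|D| + A |D outside radius r + eta| <= |S|] with [A > 0]. On the other
    hand the radial projection of [D] onto [S] is onto and contracting, so
    [|S| <= |D|] ([sphere_le_boundary]). Therefore [D] lies on [S] up to null sets. A
    point of [W] outside of the closed ball would make a part of [D] of distance at
    least [r + eta] from [c] project onto a cap of [S], which has positive area
    ([sphere_cap_not_null]). So [W] is the ball ([domain_is_ball]).

    The estimate near [z] is where the regularity of [D] is used. Above the points
    where the graph [psi] is almost parallel to its tangent plane at [z], the vertical
    projection of the sphere onto the graph is locally Lipschitz with a constant close
    to one, and it almost preserves the distance to the pole; comparing the measures
    of superlevel sets gives [smooth_part]. The gradient of [psi] is continuous at [z]
    only along almost every ray, so the other points need not be far from [z]; but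
    they occupy a vanishing proportion of each small dyadic shell, and the
    contributions of the shells form a telescoping series ([rough_part]).

    The spherical mean of the Poisson kernel is computed without a surface
    parametrization: as a function of the variable exchanged with the pole it is
    radial, since reflections preserve Hausdorff measure, and harmonic, in the sense
    that its discrete Laplacians tend to zero; the maximum principle does the rest
    ([radial_mean_value]). *)

(** * The Euclidean norm and inner product *)

Section Dot.
Context {R : realType} {n : nat}.
Implicit Types x y z v : 'rV[R]_n.

Definition dot x y : R := \sum_(i < n) x 0 i * y 0 i.

Lemma dotC x y : dot x y = dot y x.
Proof. by apply: eq_bigr => i _; rewrite mulrC. Qed.

Lemma dotDl x y z : dot (x + y) z = dot x z + dot y z.
Proof. by rewrite -big_split; apply: eq_bigr => i _; rewrite mxE mulrDl. Qed.

Lemma dotZl k x z : dot (k *: x) z = k * dot x z.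
Proof. by rewrite mulr_sumr; apply: eq_bigr => i _; rewrite mxE mulrA. Qed.

Lemma dotNl x z : dot (- x) z = - dot x z.
Proof. by rewrite -scaleN1r dotZl mulN1r. Qed.

Lemma dotBl x y z : dot (x - y) z = dot x z - dot y z.
Proof. by rewrite dotDl dotNl. Qed.

Lemma dotDr x y z : dot z (x + y) = dot z x + dot z y.
Proof. by rewrite dotC dotDl !(dotC z). Qed.

Lemma dotZr k x z : dot z (k *: x) = k * dot z x.
Proof. by rewrite dotC dotZl dotC. Qed.

Lemma dotNr x z : dot z (- x) = - dot z x.
Proof. by rewrite dotC dotNl dotC. Qed.

Lemma dotBr x y z : dot z (x - y) = dot z x - dot z y.
Proof. by rewrite dotC dotBl !(dotC z). Qed.

Lemma dot0l z : dot 0 z = 0.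
Proof. by rewrite -(scale0r 0) dotZl mul0r. Qed.

Lemma dot0r z : dot z 0 = 0.
Proof. by rewrite dotC dot0l. Qed.

Lemma dot_ge0 x : 0 <= dot x x.
Proof. by apply: sumr_ge0 => i _; rewrite -expr2 sqr_ge0. Qed.

Lemma norm2E x : norm2 x = Num.sqrt (dot x x).
Proof. by congr Num.sqrt; apply: eq_bigr => i _; rewrite expr2. Qed.

Lemma norm2_sq x : norm2 x ^+ 2 = dot x x.
Proof. by rewrite norm2E sqr_sqrtr// dot_ge0. Qed.

Lemma norm2_ge0 x : 0 <= norm2 x.
Proof. by rewrite sqrtr_ge0. Qed.

Lemma dot_eq0 x : dot x x = 0 -> x = 0.
Proof.
move=> /eqP; rewrite psumr_eq0 => [/allP h|i _]; last by rewrite -expr2 sqr_ge0.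
apply/rowP => i; rewrite mxE; apply/eqP.
by have := h i (mem_index_enum _); rewrite /= -expr2 sqrf_eq0.
Qed.

Lemma norm2_eq0 x : norm2 x = 0 -> x = 0.
Proof. by move=> h; apply: dot_eq0; rewrite -norm2_sq h expr0n. Qed.

Lemma norm20 : norm2 (0 : 'rV[R]_n) = 0.
Proof. by rewrite norm2E dot0l sqrtr0. Qed.

Lemma norm2_gt0 x : (0 < norm2 x) = (x != 0).
Proof.
rewrite lt_neqAle norm2_ge0 andbT eq_sym; congr (~~ _).
by apply/eqP/eqP => [/norm2_eq0//|->]; rewrite norm20.
Qed.

Lemma norm2Z k x : norm2 (k *: x) = `|k| * norm2 x.
Proof.
by rewrite !norm2E dotZl dotZr mulrA -expr2 sqrtrM ?sqr_ge0// sqrtr_sqr.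
Qed.

Lemma norm2N x : norm2 (- x) = norm2 x.
Proof. by rewrite -scaleN1r norm2Z normrN1 mul1r. Qed.

Lemma norm2_distC x y : norm2 (x - y) = norm2 (y - x).
Proof. by rewrite -norm2N opprB. Qed.

Lemma cauchy_schwarz x y : dot x y <= norm2 x * norm2 y.
Proof.
have [->|x0] := eqVneq x 0; first by rewrite dot0l norm20 mul0r.
have [->|y0] := eqVneq y 0; first by rewrite dot0r norm20 mulr0.
have nx : 0 < norm2 x by rewrite norm2_gt0.
have ny : 0 < norm2 y by rewrite norm2_gt0.
have := dot_ge0 (norm2 y *: x - norm2 x *: y).
rewrite dotBl !dotBr !dotZl !dotZr -!norm2_sq (dotC y x).
set a := norm2 x in nx *; set b := norm2 y in ny *; set d := dot x y => h.
have : 0 <= (a * b) * (a * b - d) by nra.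
by rewrite pmulr_rge0 ?mulr_gt0// subr_ge0.
Qed.

Lemma cauchy_schwarz_abs x y : `|dot x y| <= norm2 x * norm2 y.
Proof.
rewrite ler_norml cauchy_schwarz andbT lerNl -dotNl.
by rewrite (le_trans (cauchy_schwarz _ _))// norm2N.
Qed.

Lemma ler_sqr_norm (a b : R) : 0 <= b -> a ^+ 2 <= b ^+ 2 -> a <= b.
Proof.
move=> b0 ab; have [a0|a0] := leP 0 a; last exact: le_trans (ltW a0) b0.
by rewrite -(ler_pXn2r (n:=2))// nnegrE.
Qed.

Lemma norm2D x y : norm2 (x + y) <= norm2 x + norm2 y.
Proof.
apply: ler_sqr_norm; first by rewrite addr_ge0 ?norm2_ge0.
rewrite norm2_sq dotDl !dotDr -!norm2_sq (dotC y x).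
by have := cauchy_schwarz x y; nra.
Qed.

Lemma norm2_triangle x y z : norm2 (x - z) <= norm2 (x - y) + norm2 (y - z).
Proof. by rewrite (le_trans _ (norm2D _ _))// addrA subrK. Qed.

Lemma norm2_lipschitz x y : `|norm2 x - norm2 y| <= norm2 (x - y).
Proof.
rewrite ler_norml; apply/andP; split.
  have := norm2D (y - x) x; rewrite subrK norm2_distC; lra.
have := norm2D (x - y) y; rewrite subrK; lra.
Qed.

Lemma norm2_sqD x y : norm2 (x + y) ^+ 2 = norm2 x ^+ 2 + 2 * dot x y + norm2 y ^+ 2.
Proof. by rewrite !norm2_sq dotDl !dotDr (dotC y x); ring. Qed.

Lemma norm2_sqB x y : norm2 (x - y) ^+ 2 = norm2 x ^+ 2 - 2 * dot x y + norm2 y ^+ 2.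
Proof. by rewrite norm2_sqD norm2N dotNr; ring. Qed.

Lemma coord_le_norm2 x i : `|x 0 i| <= norm2 x.
Proof.
apply: ler_sqr_norm; first exact: norm2_ge0.
rewrite norm2_sq real_normK ?num_real// /dot (bigD1 i)//= -expr2 lerDl.
by apply: sumr_ge0 => j _; rewrite -expr2 sqr_ge0.
Qed.

Lemma norm2_basis i : norm2 (basis_vec i : 'rV[R]_n) = 1.
Proof.
rewrite norm2E /dot (bigD1 i)//= big1 ?addr0; last first.
  by move=> j ji; rewrite mxE (negbTE ji) andbF mul0r.
by rewrite mxE !eqxx mulr1 sqrtr1.
Qed.

Lemma dot_basis x i : dot x (basis_vec i) = x 0 i.
Proof.
rewrite /dot (bigD1 i)//= big1 ?addr0; last first.
  by move=> j ji; rewrite mxE (negbTE ji) andbF mulr0.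
by rewrite mxE !eqxx mulr1.
Qed.

Lemma row_sum_basis x : x = \sum_(i < n) x 0 i *: basis_vec i.
Proof. exact: row_sum_delta. Qed.

Lemma norm_le_coord x (e : R) : 0 <= e -> (forall i, `|x 0 i| <= e) -> `|x| <= e.
Proof.
move=> e0 xe; rewrite -[`|x|]/(mx_norm x).
have [->//|/mx_norm_neq0[[j i] /= ->]] := eqVneq (mx_norm x) 0.
by rewrite ord1.
Qed.

Lemma norm_le_norm2 x : `|x| <= norm2 x.
Proof. by apply: norm_le_coord => [|i]; rewrite ?norm2_ge0 ?coord_le_norm2. Qed.

Lemma coord_le_norm x i : `|x 0 i| <= `|x|.
Proof.
rewrite /Num.norm/= mx_normE.
have /= := @le_bigmax _ _ _ _ (fun i : 'I_1 * 'I_n => `|x i.1 i.2|%:nng) (0, i).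
by apply.
Qed.

Lemma norm2_le_norm x : norm2 x <= n%:R * `|x|.
Proof.
rewrite [X in norm2 X]row_sum_basis.
apply: (@le_trans _ _ (\sum_(i < n) norm2 (x 0 i *: basis_vec i : 'rV[R]_n))).
  elim/big_ind2 : _ => [|u a v b ua vb|//]; first by rewrite norm20.
  by rewrite (le_trans (norm2D _ _))// lerD.
rewrite (le_trans (ler_sum _ (fun i _ => _ : _ <= `|x|)))//.
  by move=> i _; rewrite norm2Z norm2_basis mulr1 coord_le_norm.
by rewrite sumr_const card_ord mulr_natl.
Qed.

(** The topology comes from the sup norm, which is equivalent to [norm2]. *)
Lemma nbhs_norm2 x (A : set 'rV[R]_n) :
  nbhs x A <-> exists2 e : R, 0 < e & forall y, norm2 (y - x) < e -> A y.
Proof.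
split=> [/nbhs_ballP[e /= e0 eA]|[e e0 eA]].
  exists e => // y yx; apply: eA; rewrite -ball_normE /=.
  by rewrite -normrN opprB (le_lt_trans (norm_le_norm2 _)).
apply/nbhs_ballP; exists (e / n.+1%:R) => /=; first by rewrite divr_gt0.
move=> y; rewrite -ball_normE /= => xy; apply: eA; rewrite (le_lt_trans (norm2_le_norm _))//.
rewrite -normrN opprB; move: xy; rewrite ltr_pdivlMr// mulrC; apply: le_lt_trans.
by rewrite ler_wpM2r// ler_nat.
Qed.

Lemma continuous_norm2 : continuous (@norm2 R n).
Proof.
move=> x; apply/(cvgrPdist_lt (FF := nbhs_filter x)) => e e0; apply/nbhs_norm2; exists e => // y yx.
by rewrite (le_lt_trans (norm2_lipschitz _ _))// norm2_distC.
Qed.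

Lemma continuous_norm2B y : continuous (fun x => norm2 (x - y)).
Proof.
move=> x; apply/(cvgrPdist_lt (FF := nbhs_filter x)) => e e0; apply/nbhs_norm2; exists e => // u ux.
by rewrite (le_lt_trans (norm2_lipschitz _ _))// opprB addrA subrK norm2_distC.
Qed.

Lemma open_ball2 x e : open (ball2 x e).
Proof.
rewrite openE => y yx; apply/nbhs_norm2; exists (e - norm2 (y - x)).
  by rewrite subr_gt0.
by move=> u uy; rewrite /ball2/= (le_lt_trans (norm2_triangle _ y _))// -ltrBrDr.
Qed.

Lemma continuous_dotl y : continuous (fun x => dot x y).
Proof.
move=> x; apply/(cvgrPdist_lt (FF := nbhs_filter x)) => e e0; apply/nbhs_norm2.
have y0 : 0 < norm2 y + 1 by rewrite ltr_wpDl// norm2_ge0.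
exists (e / (norm2 y + 1)); first by rewrite divr_gt0.
move=> u ux; rewrite -dotBl (le_lt_trans (cauchy_schwarz_abs _ _))//.
move: ux; rewrite ltr_pdivlMr// norm2_distC; apply: le_lt_trans.
by rewrite ler_wpM2l ?norm2_ge0// lerDl.
Qed.

End Dot.

(** * The splitting of space into horizontal and vertical coordinates *)

Section Split.
Context {R : realType} {m : nat}.
Implicit Types (x y : 'rV[R]_m.+1) (u v : 'rV[R]_m).

Definition graph_point u (t : R) : 'rV[R]_m.+1 :=
  \row_(i < m.+1) if unlift ord_max i is Some j then u 0 j else t.

Lemma widen_lift (i : 'I_m) : widen_ord (leqnSn m) i = lift ord_max i.
Proof. by apply/val_inj; rewrite /= /bump leqNgt ltn_ord. Qed.

Lemma head_graph_point u t : head_coords (graph_point u t) = u.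
Proof. by apply/rowP => i; rewrite !mxE widen_lift liftK. Qed.

Lemma last_graph_point u t : last_coord (graph_point u t) = t.
Proof. by rewrite /last_coord mxE unlift_none. Qed.

Lemma graph_pointK x : graph_point (head_coords x) (last_coord x) = x.
Proof.
apply/rowP => i; rewrite !mxE; case: unliftP => [j ->|->]//.
by rewrite mxE widen_lift.
Qed.

Lemma eq_split x y :
  head_coords x = head_coords y -> last_coord x = last_coord y -> x = y.
Proof. by move=> h l; rewrite -(graph_pointK x) h l graph_pointK. Qed.

Lemma head_coordsB x y : head_coords (x - y) = head_coords x - head_coords y.
Proof. by apply/rowP => i; rewrite !mxE. Qed.

Lemma last_coordB x y : last_coord (x - y) = last_coord x - last_coord y.
Proof. by rewrite /last_coord !mxE. Qed.

Lemma head_coordsD x y : head_coords (x + y) = head_coords x + head_coords y.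
Proof. by apply/rowP => i; rewrite !mxE. Qed.

Lemma last_coordD x y : last_coord (x + y) = last_coord x + last_coord y.
Proof. by rewrite /last_coord !mxE. Qed.

Lemma head_coordsZ k x : head_coords (k *: x) = k *: head_coords x.
Proof. by apply/rowP => i; rewrite !mxE. Qed.

Lemma last_coordZ k x : last_coord (k *: x) = k * last_coord x.
Proof. by rewrite /last_coord !mxE. Qed.

Lemma dot_split x y :
  dot x y = dot (head_coords x) (head_coords y) + last_coord x * last_coord y.
Proof.
rewrite /dot big_ord_recr/=; congr (_ + _); apply: eq_bigr => i _.
by rewrite !mxE.
Qed.

Lemma norm2_split x :
  norm2 x ^+ 2 = norm2 (head_coords x) ^+ 2 + last_coord x ^+ 2.
Proof. by rewrite !norm2_sq dot_split -expr2. Qed.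

Lemma norm2_head_le x : norm2 (head_coords x) <= norm2 x.
Proof.
by apply: ler_sqr_norm; rewrite ?norm2_ge0// norm2_split lerDl sqr_ge0.
Qed.

Lemma norm2_last_le x : `|last_coord x| <= norm2 x.
Proof. exact: coord_le_norm2. Qed.

Lemma norm2_split_le x : norm2 x <= norm2 (head_coords x) + `|last_coord x|.
Proof.
apply: ler_sqr_norm; first by rewrite addr_ge0 ?norm2_ge0.
rewrite norm2_split -(real_normK (num_real (last_coord x))).
by have := norm2_ge0 (head_coords x); have := normr_ge0 (last_coord x); nra.
Qed.

Lemma continuous_head : continuous (@head_coords R m).
Proof.
move=> x; apply/(cvg_ballP (FF := nbhs_filter x)) => e e0; apply/nbhs_norm2; exists e => // y yx.
rewrite -ball_normE/= -head_coordsB.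
by rewrite (le_lt_trans (norm_le_norm2 _))// (le_lt_trans (norm2_head_le _))// norm2_distC.
Qed.

Lemma continuous_last : continuous (@last_coord R m).
Proof.
move=> x; apply/(cvgrPdist_lt (FF := nbhs_filter x)) => e e0; apply/nbhs_norm2; exists e => // y yx.
by rewrite -last_coordB (le_lt_trans (norm2_last_le _))// norm2_distC.
Qed.

End Split.

(** * Borel sets are Caratheodory measurable for Hausdorff measures *)

Section MetricOuter.
Context {R : realType} {n s : nat}.
Implicit Types (X Y A : set 'rV[R]_n) (x y : 'rV[R]_n).
Local Open Scope ereal_scope.

Lemma diam2_leP X (d : R) :
  diam2 X <= d%:E <-> forall x y, X x -> X y -> (norm2 (x - y) <= d)%R.
Proof.
split=> [h x y Xx Xy|h].
  rewrite -lee_fin; apply: le_trans h; apply: ereal_sup_ubound.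
  by exists (x, y).
by apply: ge_ereal_sup => _ [[x y] [/= Xx Xy] <-]; rewrite lee_fin h.
Qed.

Lemma diam2_ge0 X : X !=set0 -> 0 <= diam2 X.
Proof.
move=> [x Xx]; apply: ereal_sup_ubound; exists (x, x) => //=.
by rewrite subrr norm20.
Qed.

Lemma le_hausdorff_pre (d d' : R) X : (d <= d')%R ->
  hausdorff_pre s d' X <= hausdorff_pre s d X.
Proof.
move=> dd'; apply: le_ereal_inf_tmp => _ [F [Fd XF] <-].
apply: ereal_inf_lbound; exists F => //; split=> // i.
by apply: le_trans (Fd i) _; rewrite lee_fin.
Qed.

Lemma hausdorff_pre_le (d : R) X : (0 < d)%R ->
  hausdorff_pre s d X <= hausdorff n s X.
Proof. by move=> d0; apply: ereal_sup_ubound; exists d. Qed.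

(** A covering set of diameter at most [d] cannot meet both [X] and [Y], so a
    covering of the union splits into a covering of [X] and one of [Y]. *)
Lemma hausdorff_preD (d : R) X Y :
    (0 < d)%R -> (forall x y, X x -> Y y -> (d < norm2 (x - y))%R) ->
  hausdorff_pre s d X + hausdorff_pre s d Y <= hausdorff_pre s d (X `|` Y).
Proof.
move=> d0 XY; apply: le_ereal_inf_tmp => _ [F [Fd XYF] <-].
pose sel Z k := if `[< F k `&` Z !=set0 >] then F k else set0.
have selP Z : Z `<=` X `|` Y -> is_cover [set U | diam2 U <= d%:E] Z (sel Z).
  move=> ZXY; split=> [i|z Zz].
    by rewrite /sel; case: ifP => _; [exact: Fd|exact: diam2_set0].
  have [i _ Fiz] := XYF _ (ZXY _ Zz); exists i => //.
  by rewrite /sel asboolT//; exists z.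
have pre_le Z : Z `<=` X `|` Y ->
    hausdorff_pre s d Z <= \sum_(k <oo) hausdorff_gauge s (sel Z k).
  by move=> ZXY; apply: ereal_inf_lbound; exists (sel Z) => //; exact: selP.
apply: le_trans (leeD (pre_le X _) (pre_le Y _)) _ => //.
rewrite -nneseriesD; [|by move=> *; exact: hausdorff_gauge_ge0..].
apply: lee_nneseries => [k _ _|k _].
  by rewrite adde_ge0// hausdorff_gauge_ge0.
rewrite /sel; case: asboolP => [[x [Fx Xx]]|_]; last first.
  by rewrite hausdorff_gauge0 add0e; case: ifP => _ //; rewrite hausdorff_gauge0 hausdorff_gauge_ge0.
case: asboolP => [[y [Fy Yy]]|_]; last by rewrite hausdorff_gauge0 adde0.
have /diam2_leP/(_ _ _ Fx Fy) := Fd k.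
by rewrite leNgt XY.
Qed.

Lemma hausdorffD_separated (d : R) X Y :
    (0 < d)%R -> (forall x y, X x -> Y y -> (d < norm2 (x - y))%R) ->
  hausdorff n s X + hausdorff n s Y <= hausdorff n s (X `|` Y).
Proof.
move=> d0 XY.
have [->|] := eqVneq (hausdorff n s (X `|` Y)) +oo; first by rewrite leey.
rewrite -ltey => fin.
have pre_fin e Z : (0 < e)%R -> Z `<=` X `|` Y -> hausdorff_pre s e Z \is a fin_num.
  move=> e0 ZXY; rewrite ge0_fin_numE ?hausdorff_pre_ge0//.
  by apply: le_lt_trans fin; apply: le_trans (hausdorff_pre_le _ e0) _; exact: le_hausdorff.
have key e e' : (0 < e)%R -> (0 < e')%R ->
    hausdorff_pre s e X + hausdorff_pre s e' Y <= hausdorff n s (X `|` Y).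
  move=> e0 e'0; pose f := Num.min d (Num.min e e').
  have f0 : (0 < f)%R by rewrite /f !lt_min d0 e0 e'0.
  apply: le_trans (hausdorff_pre_le _ f0).
  apply: le_trans (hausdorff_preD f0 _); last first.
    by move=> x y Xx Yy; apply: le_lt_trans (XY _ _ Xx Yy); rewrite ge_min lexx.
  by apply: leeD; apply: le_hausdorff_pre; rewrite /f !ge_min lexx ?orbT.
have Yfin : hausdorff n s Y \is a fin_num.
  by rewrite ge0_fin_numE ?hausdorff_ge0//; apply: le_lt_trans fin; exact: le_hausdorff.
rewrite -leeBrDr//; apply: ge_ereal_sup => _ [e /= e0 <-].
rewrite leeBrDr// addeC -leeBrDr ?pre_fin//; apply: ge_ereal_sup => _ [e' /= e'0 <-].
by rewrite leeBrDr ?pre_fin// addeC; exact: key.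
Qed.

(** Caratheodory's criterion: [f] cuts [X] into shells; shells with indices
    differing by two lie at positive distance, so that the measures of the shells
    form a convergent series and the thin neighbourhoods of [f <= 0] in [X] lose
    all their measure outside of it. *)
Lemma caratheodory_sublevel (f : 'rV[R]_n -> R) :
    (forall x y, (`|f x - f y| <= norm2 (x - y))%R) ->
  caratheodory_measurable (hausdorff n s) [set x | (f x <= 0)%R].
Proof.
move=> flip; apply: le_caratheodory_measurable => X.
pose mu : set 'rV[R]_n -> \bar R := hausdorff n s.
pose A := [set x | (f x <= 0)%R].
change (mu (X `&` A) + mu (X `&` ~` A) <= mu X).
have [->|] := eqVneq (mu X) +oo; first by rewrite leey.
rewrite -ltey => Xfin.
pose u k : R := (k.+1%:R^-1)%R.
have u_gt0 k : (0 < u k)%R by rewrite invr_gt0.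
have u_lt k j : (k < j)%N -> (u j < u k)%R.
  by move=> kj; rewrite /u ltf_pV2 ?posrE// ltr_nat.
pose T k := X `&` [set x | (u k <= f x)%R].
pose S k := X `&` [set x | (u k.+1 <= f x < u k)%R].
have sep (a b : R) Y Z : (a < b)%R -> Y `<=` [set x | (b <= f x)%R] ->
    Z `<=` [set x | (f x <= a)%R] -> mu Y + mu Z <= mu (Y `|` Z).
  move=> ab Yb Za; apply: (@hausdorffD_separated ((b - a) / 2)%R).
    by rewrite divr_gt0// subr_gt0.
  move=> x y /Yb /= xb /Za /= ya; apply: lt_le_trans (flip x y).
  apply: lt_le_trans (ler_norm _).
  by rewrite ltr_pdivrMr//; lra.
have mono Y : Y `<=` X -> mu Y <= mu X by exact: le_hausdorff.
(* the shells of a fixed parity [b] are pairwise separated *)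
have alt b N : \sum_(j < N) mu (S (j.*2 + b)%N.+1) <= mu (T (N.*2 + b)%N).
  elim: N => [|N IH]; first by rewrite big_ord0 hausdorff_ge0.
  rewrite big_ord_recr /=; apply: le_trans (leeD IH (lexx _)) _.
  apply: le_trans (@sep (u (N.*2 + b)%N.+1) (u (N.*2 + b)%N) _ _ _ _ _) _.
  - exact: u_lt.
  - by move=> x [].
  - by move=> x [_ /=/andP[_ /ltW]].
  apply: le_hausdorff => x [[Xx /= h]|[Xx /= /andP[h _]]].
    split; first exact: Xx.
    by apply: le_trans h; apply/ltW/u_lt; rewrite doubleS !addSn ltnS leqnSn.
  split; first exact: Xx.
  by apply: le_trans h; rewrite doubleS !addSn lexx.
have sumS N : \sum_(0 <= k < N) mu (S k.+1) <= mu X + mu X.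
  apply: (@le_trans _ _ (\sum_(0 <= k < N.*2) mu (S k.+1))).
    apply: lee_sum_nneg_natr => [k _ _|]; first exact: hausdorff_ge0.
    by rewrite -addnn leq_addr.
  have -> : \sum_(0 <= k < N.*2) mu (S k.+1) =
      \sum_(j < N) mu (S (j.*2 + 0)%N.+1) + \sum_(j < N) mu (S (j.*2 + 1)%N.+1).
    elim: N => [|N IH]; first by rewrite big_nil !big_ord0 adde0.
    rewrite doubleS !big_nat_recr//= IH !big_ord_recr /= addn0 addn1.
    by rewrite -!addeA; congr (_ + _); rewrite addeCA.
  by apply: leeD; apply: le_trans (alt _ _) _; apply: mono => x [].
have serS : \sum_(0 <= k <oo) mu (S k.+1) < +oo.
  apply: (@le_lt_trans _ _ (mu X + mu X)); last by rewrite lte_add_pinfty.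
  apply: lime_le; first by apply: is_cvg_nneseries => *; exact: hausdorff_ge0.
  by apply: nearW => N; exact: sumS.
have tail := nneseries_tail_cvg serS (fun k _ => hausdorff_ge0 s (S k.+1)).
have main N : mu (X `&` A) + mu (X `&` ~` A) <=
    mu X + \sum_(N <= k <oo) mu (S k.+1).
  have -> : X `&` ~` A = T N.+1 `|` \bigcup_(k in [set k | (N <= k)%N]) S k.+1.
    apply/seteqP; split=> [x [Xx /negP]|x [[Xx h]|[k /= _ [Xx /andP[h _]]]]]; last 2 first.
    - split => //= fx; have := lt_le_trans (u_gt0 N.+1) h.
      by rewrite ltNge fx.
    - split => //= fx; have := lt_le_trans (u_gt0 k.+2) h.
      by rewrite ltNge fx.
    rewrite -ltNge => fx.
    have [h|h] := leP (u N.+1) (f x); [by left|right].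
    have [K Kx] : exists K, (u K <= f x)%R.
      have [K] := ltr_add_invr fx; rewrite add0r => K0.
      by exists K; exact: ltW.
    have ex : exists K, (u K <= f x)%R by exists K.
    case: (ex_minnP ex) => -[|k] kx kmin.
      by have := le_lt_trans kx (lt_trans h (u_lt 0%N N.+1 isT)); rewrite ltxx.
    have Nk : (N.+1 < k.+1)%N.
      rewrite ltnNge; apply/negP => kN.
      have := le_lt_trans kx h; apply/negP; rewrite -leNgt.
      by move: kN; rewrite leq_eqVlt => /predU1P[->//|/u_lt/ltW].
    case: k => // k in kx kmin Nk *.
    exists k => //=; split => //=; rewrite kx /= ltNge; apply/negP => /kmin.
    by rewrite ltnn.
  apply: (@le_trans _ _ (mu (X `&` A) + (mu (T N.+1) + \sum_(N <= k <oo) mu (S k.+1)))).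
    apply: leeD => //; apply: le_trans (outer_measureU2 _ _ _) _.
    apply: leeD => //.
    have -> : \sum_(N <= k <oo) mu (S k.+1) = \sum_(k <oo) mu (S (k + N)%N.+1).
      by rewrite -(nneseries_addn N (fun k => hausdorff_ge0 s (S k.+1))).
    have -> : \bigcup_(k in [set k | (N <= k)%N]) S k.+1 = \bigcup_k S (k + N)%N.+1.
      apply/seteqP; split=> [x [k /= Nk Sx]|x [k _ Sx]].
        by exists (k - N)%N => //; rewrite subnK.
      by exists (k + N)%N => //=; rewrite leq_addl.
    exact: hausdorff_sigma_subadditive.
  rewrite addeA; apply: leeD => //; rewrite addeC.
  apply: le_trans (@sep 0%R (u N.+1) _ _ _ _ _) _ => //.
  - by move=> x [].
  - by apply: mono => x [[]|[]].
have : (mu X + \sum_(N <= k <oo) mu (S k.+1)) @[N --> \oo] --> mu X + 0.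
  apply: cvgeD => //; last exact: cvg_cst.
  by rewrite fin_num_adde_defl.
rewrite adde0 => /(cvg_lim (@ereal_hausdorff _)) <-.
apply: lime_ge; last by apply: nearW; exact: main.
apply: cvgP; apply: cvgeD; last exact: tail; last exact: cvg_cst.
by rewrite fin_num_adde_defl.
Qed.

End MetricOuter.

Section Measurability.
Context {R : realType} {n s : nat}.
Implicit Types (x y : 'rV[R]_n).
Local Notation mu := (@hausdorff R n s).
Local Notation hm := (@hausdorff_measure R n s).

Lemma dist2_lipschitz (C : set 'rV[R]_n) x y : C !=set0 ->
  `|dist2 C x - dist2 C y| <= norm2 (x - y).
Proof.
move=> [c Cc].
have has_infC u : has_inf [set norm2 (u - v) | v in C].
  by split; [exists (norm2 (u - c)), c|exists 0 => _ [v _ <-]; exact: norm2_ge0].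
have half u v : dist2 C u <= norm2 (u - v) + dist2 C v.
  rewrite -lerBlDl; apply: lb_le_inf; first by case: (has_infC v).
  move=> _ [w Cw <-]; rewrite lerBlDl; apply: le_trans (norm2_triangle u v w).
  by apply: ge_inf; [case: (has_infC u)|exists w].
have h1 := half x y; have h2 := half y x; rewrite norm2_distC in h2.
by rewrite ler_norml; apply/andP; split; lra.
Qed.

Lemma dist2_le0 (C : set 'rV[R]_n) x : C !=set0 -> closed C ->
  dist2 C x <= 0 <-> C x.
Proof.
move=> C0 cC; have hi : has_inf [set norm2 (x - v) | v in C].
  split; first by case: C0 => c Cc; exists (norm2 (x - c)), c.
  by exists 0 => _ [v _ <-]; exact: norm2_ge0.
split=> [dx|Cx]; last first.
  by apply: ge_inf; [case: hi|exists x; rewrite ?subrr ?norm20].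
apply: cC => A /nbhs_norm2[e e0 eA].
have [_ [v Cv <-] ve] := inf_adherent e0 hi.
exists v; split => //; apply: eA; rewrite norm2_distC.
by apply: lt_le_trans ve _; rewrite gerDr.
Qed.

Lemma closed_cara_measurable (C : set 'rV[R]_n) :
  closed C -> mu.-cara.-measurable C.
Proof.
move=> cC; have [->|/set0P C0] := eqVneq C set0; first exact: measurable0.
rewrite (_ : C = [set x | dist2 C x <= 0]); last first.
  by apply/seteqP; split=> x /dist2_le0; apply.
by apply: caratheodory_sublevel => x y; exact: dist2_lipschitz.
Qed.

Lemma open_cara_measurable (C : set 'rV[R]_n) :
  open C -> mu.-cara.-measurable C.
Proof.
move=> oC; rewrite -(setCK C); apply: measurableC.
by apply: closed_cara_measurable; exact: open_closedC.
Qed.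

Lemma continuous_cara_measurable_fun (D : set 'rV[R]_n) (f : 'rV[R]_n -> R) :
    mu.-cara.-measurable D -> (forall x, D x -> {for x, continuous f}) ->
  measurable_fun (D : set (caratheodory_type mu)) f.
Proof.
move=> mD cf; apply: (measurability _ (RGenOInfty.measurableE R)).
move=> _ [_ [a -> <-]].
rewrite (_ : D `&` _ = D `&` interior [set x | a < f x]).
  apply: measurableI => //; apply: open_cara_measurable; exact: open_interior.
rewrite predeqE => x; split.
  move=> [Dx]; rewrite /= in_itv/= andbT => ax; split=> //.
  exact: (cvgr_gt (FF := nbhs_filter x) (f x) (cf x Dx) _ ax).
move=> [Dx /interior_subset /= ax]; split => //=.
by rewrite in_itv/= andbT.
Qed.

End Measurability.

(** * Comparison of integrals through superlevel sets *)

Section Levels.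
Context d (T : measurableType d) {R : realType} (mu : {measure set T -> \bar R}).
Variables (D : set T) (mD : measurable D) (f : T -> R).
Hypotheses (f_ge0 : forall x, D x -> 0 <= f x) (mf : measurable_fun D f).

Definition superlevel (t : R) : set T := D `&` [set x | t <= f x].

Lemma measurable_superlevel t : measurable (superlevel t).
Proof. by apply: measurable_fun_le => //; exact: measurable_cst. Qed.

(** On [D], a lower approximation of [f] by multiples of [h], truncated at [h * i]. *)
Definition staircase (h : R) (i : nat) (x : T) : R :=
  \sum_(k < i) h * \1_(superlevel (h * k.+1%:R)) x.

Lemma indic_superlevel t x : D x -> \1_(superlevel t) x = (t <= f x)%R%:R :> R.
Proof.
move=> Dx; rewrite indicE; congr (nat_of_bool _)%:R.
by apply/idP/idP => [|tx]; [rewrite inE => -[]|rewrite inE].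
Qed.

Lemma staircase_bounds h K x : D x -> 0 < h ->
  Num.min (f x) (h * K.+1%:R) <= h + staircase h K x /\
  staircase h K x <= Num.min (f x) (h * K%:R).
Proof.
move=> Dx h0; rewrite /staircase; elim: K => [|K [IH1 IH2]].
  rewrite big_ord0 addr0 mulr0 mulr1; split; first by rewrite ge_min lexx orbT.
  by rewrite le_min f_ge0 ?lexx.
rewrite big_ord_recr/= indic_superlevel//.
move: IH1 IH2; set S := \sum_(i < K) _.
have [/= fK|fK] := leP (h * K.+1%:R) (f x).
  rewrite mulr1 => IH1; rewrite le_min => /andP[S1 S2].
  have hK : S + h <= h * K.+1%:R by rewrite -natr1 mulrDr mulr1 lerD2r.
  split; last exact: hK.
  rewrite ge_min; apply/orP; right.
  by rewrite -natr1 mulrDr mulr1; lra.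
rewrite mulr0 addr0 => IH1 IH2.
have fK2 : f x <= h * K.+2%:R.
  by apply: le_trans (ltW fK) _; rewrite ler_pM2l// ler_nat.
rewrite (min_l fK2); split => //.
by move: IH2; rewrite le_min => /andP[].
Qed.

Lemma measurable_staircase h K : measurable_fun D (staircase h K).
Proof.
apply: measurable_sum => k; apply: measurable_funM; first exact: measurable_cst.
by apply: measurable_indic; exact: measurable_superlevel.
Qed.

Lemma staircase_ge0 h K x : 0 < h -> 0 <= staircase h K x.
Proof.
by move=> h0; apply: sumr_ge0 => i _; rewrite mulr_ge0 ?(ltW h0)// indicE ler0n.
Qed.

Local Open Scope ereal_scope.

Lemma integral_staircase h K : (0 < h)%R ->
  \int[mu]_(x in D) (staircase h K x)%:E =
  \sum_(k < K) h%:E * mu (superlevel (h * k.+1%:R)%R).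
Proof.
move=> h0; rewrite /staircase; under eq_integral do rewrite -sumEFin.
rewrite ge0_integral_sum//; last 2 first.
- move=> k; apply/measurable_EFinP; apply: measurable_funM; first exact: measurable_cst.
  by apply: measurable_indic; exact: measurable_superlevel.
- by move=> k x _; rewrite lee_fin mulr_ge0 ?(ltW h0)// indicE ler0n.
apply: eq_bigr => k _; under eq_integral do rewrite EFinM.
rewrite ge0_integralZl_EFin//; last 2 first.
- by apply/measurable_EFinP/measurable_indic; exact: measurable_superlevel.
- exact: ltW.
rewrite integral_indic//; last exact: measurable_superlevel.
by congr (_ * mu _); apply/setIidPl => x [].
Qed.

End Levels.

Section CompareIntegrals.
Context d1 (T1 : measurableType d1) d2 (T2 : measurableType d2) {R : realType}.
Variables (mu1 : {measure set T1 -> \bar R}) (mu2 : {measure set T2 -> \bar R}).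
Local Open Scope ereal_scope.

(** Layer-cake comparison: an integral only sees the measures of the superlevel
    sets. The integrands may thus live on unrelated spaces. *)
Lemma le_integral_superlevel (D1 : set T1) (D2 : set T2)
    (f : T1 -> R) (g : T2 -> R) (M C : R) :
    measurable D1 -> measurable D2 -> mu1 D1 < +oo ->
    measurable_fun D1 f -> measurable_fun D2 g ->
    (forall x, D1 x -> (0 <= f x <= M)%R) -> (forall x, D2 x -> (0 <= g x)%R) ->
    (0 <= C)%R ->
    (forall t, (0 < t)%R -> mu1 (superlevel D1 f t) <= C%:E * mu2 (superlevel D2 g t)) ->
  \int[mu1]_(x in D1) (f x)%:E <= C%:E * \int[mu2]_(x in D2) (g x)%:E.
Proof.
move=> mD1 mD2 fin mf mg fM g0 C0 lev; apply/lee_addgt0Pr => e e0.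
have f0 x : D1 x -> (0 <= f x)%R by move=> /fM/andP[].
pose v := fine (mu1 D1); have vE : mu1 D1 = v%:E by rewrite fineK// ge0_fin_numE.
have v0 : (0 <= v)%R by rewrite fine_ge0.
(* a staircase of step [h] costs at most [h * v <= e] in the integral *)
pose h : R := (e / (v + 1))%R.
have h0 : (0 < h)%R by rewrite divr_gt0// ltr_wpDl.
pose K := Num.truncn (M / h); have MK : (M <= h * K.+1%:R)%R.
  by rewrite mulrC -ler_pdivrMr// ltW// truncnS_gt.
apply: (@le_trans _ _ (\int[mu1]_(x in D1) (h%:E + (staircase D1 f h K x)%:E))).
  apply: ge0_le_integral => //.
  - exact/measurable_EFinP.
  - apply/measurable_EFinP; apply: measurable_funD; first exact: measurable_cst.
    exact: measurable_staircase.
  - move=> x Dx; rewrite -EFinD lee_fin.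
    have [+ _] := staircase_bounds f0 K Dx h0; apply: le_trans.
    by rewrite le_min lexx/=; case/andP: (fM _ Dx) => _ /le_trans; apply.
rewrite ge0_integralD//; last 3 first.
- by move=> x _; rewrite lee_fin ltW.
- by move=> x _; rewrite lee_fin staircase_ge0.
- exact/measurable_EFinP/measurable_staircase.
rewrite integral_cst// integral_staircase// addeC; apply: leeD; last first.
  rewrite vE -EFinM lee_fin /h -mulrA ler_piMr ?(ltW e0)//.
  by rewrite mulrC ler_pdivrMr ?mul1r ?lerDl// ltr_wpDl.
apply: (@le_trans _ _ (C%:E * \int[mu2]_(x in D2) (staircase D2 g h K x)%:E)).
  rewrite integral_staircase// ge0_sume_distrr; last first.
    by move=> k _; rewrite mule_ge0// lee_fin ltW.
  apply: lee_sum => k _; rewrite muleCA; apply: lee_wpmul2l; first by rewrite lee_fin ltW.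
  by apply: lev; rewrite mulr_gt0.
apply: lee_wpmul2l => //; apply: ge0_le_integral => //.
- by move=> x _; rewrite lee_fin staircase_ge0.
- exact/measurable_EFinP/measurable_staircase.
- exact/measurable_EFinP.
- move=> x Dx; rewrite lee_fin.
  have [_] := staircase_bounds g0 K Dx h0; rewrite le_min => /andP[+ _]; exact.
Qed.

End CompareIntegrals.

Section BoundedIntegrands.
Context d (T : measurableType d) {R : realType} (mu : {measure set T -> \bar R}).

Lemma bounded_integrable (D : set T) (f : T -> R) (M : R) :
    measurable D -> (mu D < +oo)%E -> measurable_fun D f ->
    (forall x, D x -> `|f x| <= M) ->
  mu.-integrable D (EFin \o f).
Proof.
move=> mD fin mf fM; apply: measurable_bounded_integrable => //.
exists M; split; first exact: num_real.
by move=> N MN x /= Dx; rewrite (le_trans (fM x Dx))// ltW.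
Qed.

Lemma Rintegral_le_cst (D : set T) (f : T -> R) (M : R) :
    measurable D -> (mu D < +oo)%E -> mu.-integrable D (EFin \o f) ->
    (forall x, D x -> f x <= M) ->
  Rintegral mu D f <= M * fine (mu D).
Proof.
move=> mD fin fi fM; rewrite -Rintegral_cst//; apply: le_Rintegral => //.
apply: (@bounded_integrable _ _ `|M|) => //; exact: measurable_cst.
Qed.

Lemma integral_le_sup (D : set T) (f : T -> R) (M : R) :
    measurable D -> measurable_fun D f -> (forall x, D x -> 0 <= f x <= M) ->
  (\int[mu]_(x in D) (f x)%:E <= M%:E * mu D)%E.
Proof.
move=> mD mf fM; rewrite -integral_cst//; apply: ge0_le_integral => //.
- by move=> x /fM /andP[f0 _]; rewrite lee_fin.
- exact/measurable_EFinP.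
- by move=> x /fM /andP[_ f1]; rewrite lee_fin.
Qed.

Lemma EFin_Rintegral (D : set T) (f : T -> R) : measurable D ->
  mu.-integrable D (EFin \o f) ->
  (\int[mu]_(x in D) (f x)%:E)%E = (Rintegral mu D f)%:E.
Proof. by move=> mD fi; rewrite fineK//; exact: integrable_fin_num. Qed.

End BoundedIntegrands.

Section SplitIntegral.
Context d (T : measurableType d) {R : realType} (mu : {measure set T -> \bar R}).

Lemma Rintegral_setID (D B : set T) (f : T -> R) : measurable D -> measurable B ->
    mu.-integrable D (EFin \o f) ->
  Rintegral mu D f = Rintegral mu (D `&` B) f + Rintegral mu (D `\` B) f.
Proof.
move=> mD mB fi; rewrite -{1}(setUIDK D B).
apply: Rintegral_setU; first exact: measurableI; first exact: measurableD.
  by rewrite setUIDK.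
by apply/disj_setPS => x [[_ Bx] [_ nBx]].
Qed.

(** On [G] the integrand is only compared with the possibly large [k]; on [Y],
    which may meet [G], it is very negative, and this gain is not lost to [k]
    because [k >= 0]. *)
Lemma Rintegral_three_parts (D G Y : set T) (h k : T -> R) (M A : R) :
    measurable D -> measurable G -> measurable Y -> (mu D < +oo)%E ->
    G `<=` D -> Y `<=` D ->
    mu.-integrable D (EFin \o h) -> mu.-integrable G (EFin \o k) ->
    (forall x, G x -> 0 <= k x) -> (forall x, G x -> h x <= k x) ->
    0 <= M -> (forall x, D x -> ~ G x -> h x <= M) -> (forall x, Y x -> h x <= - A) ->
  Rintegral mu D h <= Rintegral mu G k + M * fine (mu D) - A * fine (mu Y).
Proof.
move=> mD mG mY Dfin GD YD hi ki k0 hk M0 hM hA.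
have sub_fin X : measurable X -> X `<=` D -> (mu X < +oo)%E.
  by move=> mX XD; apply: le_lt_trans Dfin; apply: le_measure => //; rewrite inE.
have mDY : measurable (D `\` Y) by exact: measurableD.
have mP : measurable ((D `\` Y) `&` G) by exact: measurableI.
have mQ : measurable ((D `\` Y) `\` G) by exact: measurableD.
have sub_i X : measurable X -> X `<=` D -> mu.-integrable X (EFin \o h).
  by move=> mX XD; exact: integrableS hi.
have PD : (D `\` Y) `&` G `<=` D by move=> x [[]].
have QD : (D `\` Y) `\` G `<=` D by move=> x [[]].
rewrite (Rintegral_setID mD mY hi) (_ : D `&` Y = Y); last exact/setIidPr.
rewrite (Rintegral_setID mDY mG); last by apply: sub_i => // x [].
have e1 : Rintegral mu Y h <= - A * fine (mu Y).
  apply: Rintegral_le_cst => //; [exact: sub_fin|exact: sub_i].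
have e2 : Rintegral mu ((D `\` Y) `\` G) h <= M * fine (mu D).
  apply: (@le_trans _ _ (M * fine (mu ((D `\` Y) `\` G)))).
    apply: Rintegral_le_cst => //; [exact: sub_fin|exact: sub_i|].
    by move=> x [[Dx _] nGx]; exact: hM.
  rewrite ler_wpM2l// fine_le ?ge0_fin_numE ?measure_ge0//; first exact: sub_fin.
  by apply: le_measure; rewrite ?inE.
have e3 : Rintegral mu ((D `\` Y) `&` G) h <= Rintegral mu G k.
  have kP : mu.-integrable ((D `\` Y) `&` G) (EFin \o k).
    by apply: (integrableS mG mP _ ki) => x [].
  apply: (@le_trans _ _ (Rintegral mu ((D `\` Y) `&` G) k)).
    by apply: le_Rintegral => //; [exact: sub_i|move=> x [_ Gx]; exact: hk].
  rewrite (Rintegral_setID mG mDY ki) setIC lerDl.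
  by apply: Rintegral_ge0 => x [Gx _]; exact: k0.
by apply: le_trans (lerD e1 (lerD e3 e2)) _; rewrite mulNr [leLHS]addrC.
Qed.

End SplitIntegral.

(** * Size estimates for Hausdorff measures *)

Section LipschitzImage.
Context {R : realType} {n n' s : nat}.
Local Open Scope ereal_scope.

Lemma gauge_diam_le (k : nat) (U : set 'rV[R]_k) (r : R) : (0 <= r)%R ->
  diam2 U <= r%:E ->
  hausdorff_gauge s U <= (unit_ball_volume s / 2 ^+ s * r ^+ s)%:E.
Proof.
move=> r0 Ur; have c0 : (0 <= unit_ball_volume s / 2 ^+ s :> R)%R.
  by rewrite divr_ge0 ?exprn_ge0// ltW// unit_ball_volume_gt0.
rewrite /hausdorff_gauge; case: eqVneq => [_|/set0P U0].
  by rewrite lee_fin mulr_ge0// exprn_ge0.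
rewrite [leRHS]EFinM; apply: lee_wpmul2l => //.
have := diam2_ge0 U0; move: Ur; case: (diam2 U) => [t| |]//=.
by rewrite !lee_fin -!EFin_expe lee_fin => tr t0; rewrite lerXn2r ?nnegrE.
Qed.

(** Only pairs of nearby points matter, since coverings may be taken fine. *)
Lemma hausdorff_lipschitz_image (F : 'rV[R]_n -> 'rV[R]_n') (X : set 'rV[R]_n)
    (L eta : R) : (0 < L)%R -> (0 < eta)%R ->
    (forall x y, X x -> X y -> (norm2 (x - y) < eta)%R ->
      (norm2 (F x - F y) <= L * norm2 (x - y))%R) ->
  hausdorff n' s [set F x | x in X] <= (L ^+ s)%:E * hausdorff n s X.
Proof.
move=> L0 eta0 FL; apply: ge_ereal_sup => _ [e /= e0 <-].
pose d : R := (Num.min (eta / 2) (e / L))%R.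
have d0 : (0 < d)%R by rewrite lt_min !divr_gt0.
have d_eta : (d < eta)%R.
  by rewrite gt_min ltr_pdivrMr// ltr_pMr// ltr1n.
have Ld : (L * d <= e)%R.
  by rewrite mulrC -ler_pdivlMr// ge_min lexx orbT.
apply: (@le_trans _ _ ((L ^+ s)%:E * hausdorff_pre s d X)); last first.
  by apply: lee_wpmul2l; [rewrite lee_fin exprn_ge0// ltW|exact: hausdorff_pre_le].
rewrite -lee_pdivrMl ?exprn_gt0//; apply: le_ereal_inf_tmp => _ [G [Gd XG] <-].
rewrite lee_pdivrMl ?exprn_gt0// -nneseriesZl; last first.
  by move=> k _; exact: hausdorff_gauge_ge0.
pose G' k := [set F x | x in G k `&` X].
have FG k (t : R) : diam2 (G k) = t%:E -> diam2 (G' k) <= (L * t)%:E.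
  move=> Gt; apply/diam2_leP => _ _ [x [Gx Xx] <-] [y [Gy Xy] <-].
  have /diam2_leP/(_ x y Gx Gy) xyt : diam2 (G k) <= t%:E by rewrite Gt.
  have td : (t <= d)%R by have := Gd k; rewrite /= Gt lee_fin.
  apply: le_trans (FL _ _ Xx Xy _) _; last by rewrite ler_pM2l.
  exact: le_lt_trans (le_trans xyt td) d_eta.
have fin k : G k !=set0 -> exists2 t : R, (0 <= t <= d)%R & diam2 (G k) = t%:E.
  move=> G0; have := diam2_ge0 G0; have := Gd k; rewrite /=.
  case: (diam2 (G k)) => [t| |]//; rewrite !lee_fin => td t0.
  by exists t; rewrite // t0 td.
apply: (@le_trans _ _ (\sum_(k <oo) hausdorff_gauge s (G' k))).
  apply: ereal_inf_lbound; exists G' => //; split=> [k /=|_ [x Xx <-]]; last first.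
    by have [k _ Gx] := XG x Xx; exists k => //; exists x.
  have [G0|/set0P/fin[t /andP[t0 td] Gt]] := eqVneq (G k) set0.
    by rewrite /G' G0 set0I image_set0; exact: diam2_set0.
  by apply: le_trans (FG k t Gt) _; rewrite lee_fin (le_trans _ Ld)// ler_pM2l.
apply: lee_nneseries => [k _ _|k _]; first exact: hausdorff_gauge_ge0.
have [G0|/set0P G0] := eqVneq (G k) set0.
  by rewrite /G' G0 set0I image_set0 !hausdorff_gauge0 mule0.
have [t /andP[t0 td] Gt] := fin k G0.
apply: le_trans (gauge_diam_le _ (FG k t Gt)) _; first by rewrite mulr_ge0// ltW.
rewrite /hausdorff_gauge ifF; last by apply/negbTE/set0P.
by rewrite Gt -EFin_expe -!EFinM lee_fin exprMn mulrCA.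
Qed.

End LipschitzImage.

Section Boxes.
Context {R : realType} {m : nat}.
Local Open Scope ereal_scope.

Definition box (a b : 'rV[R]_m) : set 'rV[R]_m :=
  [set x | forall i, (a 0 i <= x 0 i <= b 0 i)%R].

Lemma hausdorff_pre_finite_cover (n s : nat) (d : R) (I : finType)
    (C : I -> set 'rV[R]_n) (X : set 'rV[R]_n) :
    (forall i, diam2 (C i) <= d%:E) -> X `<=` \bigcup_i C i ->
  hausdorff_pre s d X <= \sum_i hausdorff_gauge s (C i).
Proof.
move=> Cd XC.
pose F k := if insub k is Some i then C (enum_val (i : 'I_#|I|)) else set0.
apply: (@le_trans _ _ (\sum_(k <oo) hausdorff_gauge s (F k))).
  apply: ereal_inf_lbound; exists F => //; split=> [k /=|x /XC[i _ Cx]].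
    by rewrite /F; case: insubP => [i _ _|_]; [exact: Cd|exact: diam2_set0].
  by exists (enum_rank i) => //; rewrite /F valK enum_rankK.
rewrite (@nneseries_split _ _ 0 #|I|); last first.
  by move=> k _; exact: hausdorff_gauge_ge0.
rewrite eseries0 ?adde0 => [|k kI _]; last first.
  by rewrite /F insubF ?hausdorff_gauge0//; apply/negbTE; rewrite -leqNgt.
rewrite add0n big_mkord (reindex_onto (@enum_rank I) enum_val)/=; last first.
  by move=> i _; rewrite enum_valK.
rewrite (eq_bigl xpredT); last by move=> i; rewrite enum_rankK eqxx.
by apply: lee_sum => i _; rewrite /F valK enum_rankK.
Qed.

(** An upper bound is enough here: the constant comes from bounding the
    diameter of a unit cube by [m], and exceeds the sharp value 1 in general. *)
Definition box_constant : R := (unit_ball_volume m / 2 ^+ m * m%:R ^+ m)%R.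

(** Cut the box into cubes of side [h]; the summand [h] accounts for the last,
    possibly incomplete, layer in each direction. *)
Lemma hausdorff_pre_box (d h : R) (a b : 'rV[R]_m) :
    (0 < h)%R -> (m%:R * h <= d)%R -> (forall i, (a 0 i <= b 0 i)%R) ->
  hausdorff_pre m d (box a b) <= (box_constant * \prod_(i < m) (b 0 i - a 0 i + h))%:E.
Proof.
move=> h0 hd ab.
pose N i := (Num.truncn ((b 0 i - a 0 i) / h)%R).+1.
have N_le i : ((N i)%:R * h <= b 0 i - a 0 i + h)%R.
  rewrite /N -natr1 mulrDl mul1r lerD2r -ler_pdivlMr//.
  by rewrite truncn_le// divr_ge0 ?(ltW h0)// subr_ge0.
pose K := (\sum_i N i)%N; have NK i : (N i <= K.+1)%N.
  by rewrite /K (bigD1 i)//= ltnW// ltnS leq_addr.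
pose good (f : {ffun 'I_m -> 'I_K.+1}) := [forall i, (f i < N i)%N].
(* cubes of side [h]; multi-indices out of range get the empty cell, of gauge 0 *)
pose cell (f : {ffun 'I_m -> 'I_K.+1}) : set 'rV[R]_m := if good f then
  [set x | forall i, (a 0 i + (f i)%:R * h <= x 0 i <= a 0 i + (f i)%:R * h + h)%R]
  else set0.
have cell_diam f : diam2 (cell f) <= (m%:R * h)%:E.
  rewrite /cell; case: ifP => _; last exact: diam2_set0.
  apply/diam2_leP => x y xc yc; apply: le_trans (norm2_le_norm _) _.
  rewrite ler_wpM2l//; apply: norm_le_coord => [|i]; first exact: ltW.
  rewrite !mxE; move: (xc i) (yc i) => /andP[x1 x2] /andP[y1 y2].
  by rewrite ler_norml; apply/andP; split; lra.
apply: le_trans (hausdorff_pre_finite_cover m (C := cell) _ _) _.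
- by move=> f; apply: le_trans (cell_diam f) _; rewrite lee_fin.
- move=> x xab; pose t i := Num.truncn ((x 0 i - a 0 i) / h)%R.
  have tN i : (t i < N i)%N.
    rewrite ltnS; apply: le_truncn.
    by rewrite ler_pM2r ?invr_gt0// lerD2r; case/andP: (xab i).
  have tK i : (t i < K.+1)%N by apply: leq_trans (NK i).
  exists [ffun i => Ordinal (tK i)] => //.
  rewrite /cell ifT; last by apply/forallP => i; rewrite ffunE /= tN.
  move=> i; rewrite ffunE /=; have /andP[ax xb] := xab i.
  have q0 : (0 <= (x 0 i - a 0 i) / h)%R by rewrite divr_ge0 ?(ltW h0)// subr_ge0.
  have : ((t i)%:R <= (x 0 i - a 0 i) / h)%R by rewrite truncn_le.
  rewrite ler_pdivlMr// => t1.
  have := truncnS_gt ((x 0 i - a 0 i) / h)%R; rewrite ltr_pdivrMr// -/(t i) -natr1 mulrDl mul1r => t2.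
  by apply/andP; split; lra.
pose w : R := (unit_ball_volume m / 2 ^+ m * (m%:R * h) ^+ m)%R.
have w0 : (0 <= w)%R.
  by rewrite mulr_ge0 ?divr_ge0 ?exprn_ge0 ?mulr_ge0 ?(ltW h0)// ltW// unit_ball_volume_gt0.
apply: (@le_trans _ _ (\sum_(f : {ffun 'I_m -> 'I_K.+1}) (w * \prod_(i < m) (f i < N i)%N%:R)%:E)).
  apply: lee_sum => f _; have [gf|gf] := boolP (good f).
    rewrite big1 ?mulr1; last by move=> i _; move/forallP: gf => ->.
    by apply: gauge_diam_le; [rewrite mulr_ge0// ltW|exact: cell_diam].
  rewrite /cell (negbTE gf) hausdorff_gauge0 lee_fin mulr_ge0// prodr_ge0//.
rewrite sumEFin lee_fin -mulr_sumr.
rewrite -(bigA_distr_bigA (fun i (j : 'I_K.+1) => (j < N i)%N%:R : R))/=.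
have -> : (\prod_(i < m) \sum_(j < K.+1) (j < N i)%N%:R = \prod_(i < m) (N i)%:R :> R)%R.
  apply: eq_bigr => i _; rewrite -natr_sum; congr _%:R.
  rewrite -(big_mkord xpredT (fun j => (j < N i)%N : nat)) (big_cat_nat (n := N i))//=.
  rewrite [X in (_ + X)%N]big_nat_cond [X in (_ + X)%N]big1 ?addn0; last first.
    by move=> j /andP[/andP[Nj _] _]; rewrite ltnNge Nj.
  rewrite big_nat_cond (eq_bigr (fun=> 1%N)); last by move=> j /andP[/andP[_ ->]].
  by rewrite -big_nat_cond sum_nat_const_nat subn0 muln1.
rewrite /w /box_constant exprMn -!mulrA ler_wpM2l//; first by rewrite ltW// unit_ball_volume_gt0.
rewrite ler_wpM2l ?invr_ge0 ?exprn_ge0// ler_wpM2l ?exprn_ge0//.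
have -> : (h ^+ m = \prod_(i < m) h)%R by rewrite prodr_const card_ord.
rewrite -big_split /=; apply: ler_prod => i _; rewrite mulrC N_le andbT.
by rewrite mulr_ge0// ltW.
Qed.

Lemma hausdorff_box (a b : 'rV[R]_m) : (forall i, (a 0 i <= b 0 i)%R) ->
  hausdorff m m (box a b) <= (box_constant * \prod_(i < m) (b 0 i - a 0 i))%:E.
Proof.
move=> ab; apply: ge_ereal_sup => _ [d /= d0 <-].
pose p h : R := (box_constant * \prod_(i < m) (b 0 i - a 0 i + h))%R.
have p_cvg : p h @[h --> (0:R)^'+] --> p 0%R.
  apply: cvg_at_right_filter; apply: cvgM; first exact: cvg_cst.
  elim: (index_enum _) => [|i l IH].
    by under eq_fun do rewrite big_nil; rewrite big_nil; exact: cvg_cst.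
  under eq_fun do rewrite big_cons; rewrite big_cons; apply: cvgM => //.
  by apply: cvgD; [exact: cvg_cst|exact: cvg_id].
have -> : (box_constant * \prod_(i < m) (b 0 i - a 0 i))%R = p 0%R.
  by congr (_ * _)%R; apply: eq_bigr => i _; rewrite addr0.
have near0 : \forall h \near (0:R)^'+, hausdorff_pre m d (box a b) <= (p h)%:E.
  near=> h; apply: hausdorff_pre_box => //.
  have h1 : (h < d / m.+1%:R)%R by near: h; apply: nbhs_right_lt; rewrite divr_gt0.
  have h0 : (0 < h)%R by [].
  move: h1; rewrite ltr_pdivlMr// mulrC => /ltW; apply: le_trans.
  by rewrite ler_wpM2r// ?(ltW h0)// ler_nat.
have fin : hausdorff_pre m d (box a b) \is a fin_num.
  rewrite ge0_fin_numE ?hausdorff_pre_ge0//.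
  have [h hh] := filter_ex near0.
  exact: le_lt_trans hh (ltry _).
rewrite -(fineK fin) lee_fin -(cvg_lim (@Rhausdorff R) p_cvg).
apply: limr_ge; first exact: cvgP p_cvg.
by apply: filterS near0 => h; rewrite -{1}(fineK fin) lee_fin.
Unshelve. all: by end_near. Qed.

Lemma hausdorff_lebesgue_null (N : set 'rV[R]_m) :
  lebesgue_null N -> hausdorff m m N = 0.
Proof.
move=> N0; have c0 : (0 <= box_constant)%R.
  by rewrite mulr_ge0 ?divr_ge0 ?exprn_ge0// ltW// unit_ball_volume_gt0.
apply/eqP; rewrite eq_le hausdorff_ge0 andbT; apply/lee_addgt0Pr => e e0.
rewrite add0e; have d0 : (0 < box_constant + 1)%R by rewrite ltr_wpDl.
have [a [b [ab Nab sab]]] := N0 (e / (box_constant + 1))%R (divr_gt0 e0 d0).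
apply: le_trans (le_hausdorff m Nab) _.
apply: le_trans (hausdorff_sigma_subadditive _ _) _.
apply: (@le_trans _ _ (\sum_(j <oo) (box_constant%:E * (\prod_(i < m) (b j 0%R i - a j 0%R i))%:E))).
  apply: lee_nneseries => [k _ _|k _]; first exact: hausdorff_ge0.
  by rewrite -EFinM; apply: hausdorff_box => i.
have pos j : 0 <= (\prod_(i < m) (b j 0%R i - a j 0%R i))%:E :> \bar R.
  by rewrite lee_fin prodr_ge0// => i _; rewrite subr_ge0.
rewrite nneseriesZl//; apply: le_trans (lee_wpmul2l _ sab) _; first by rewrite lee_fin.
by rewrite -EFinM lee_fin mulrCA ger_pMr// ler_pdivrMr// mul1r lerDl.
Qed.

End Boxes.

(** * The Poisson kernel as a harmonic function *)

Section Kernel.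
Context {R : realType} {m : nat}.
Local Notation E := 'rV[R]_m.+1.
Local Notation e_ i := (basis_vec i : E).
Implicit Types (x w v p : E) (i j : 'I_m.+1).

Lemma is_derive_line (f : E -> R) x v (df : R) :
  is_derive (0 : R) 1 (fun t : R => f (t *: v + x)) df -> is_derive x v f df.
Proof.
have H : (fun h : R => h^-1 *: (((fun t : R => f (t *: v + x)) \o shift 0) (h *: 1) -
    (fun t : R => f (t *: v + x)) 0)) =
    (fun h : R => h^-1 *: ((f \o shift x) (h *: v) - f x)).
  by apply/funext => h /=; rewrite addr0 scale0r add0r [h *: 1]mulr1.
by move=> [d1 d2]; split; [move: d1; rewrite /derivable H|rewrite -d2 /derive H].
Qed.

Lemma is_derive_translate (f : E -> R) x v p (df : R) :
  is_derive (x + p) v f df -> is_derive x v (fun y => f (y + p)) df.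
Proof.
have H : (fun h : R => h^-1 *: ((f \o shift (x + p)) (h *: v) - f (x + p))) =
    (fun h : R => h^-1 *: (((fun y => f (y + p)) \o shift x) (h *: v) - f (x + p))).
  by apply/funext => h /=; rewrite addrA.
by move=> [d1 d2]; split; [move: d1; rewrite /derivable H|rewrite -d2 /derive H].
Qed.

Lemma is_derive_dot x v w : is_derive x v (fun y => dot y w) (dot v w).
Proof.
apply: is_derive_line.
rewrite (_ : (fun t : R => _) = horner ((dot v w)%:P * 'X + (dot x w)%:P)); last first.
  by apply/funext => t; rewrite dotDl dotZl !hornerE mulrC.
apply: is_derive_eq; rewrite !poly.derivE !(hornerD, hornerM, hornerC, hornerXn, hornerX, hornerMn); ring.
Qed.

Lemma is_derive_coord x i j : is_derive x (e_ j) (fun y => y 0 i) (i == j)%:R.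
Proof.
rewrite (_ : (fun y : E => _) = fun y => dot y (e_ i)); last first.
  by apply/funext => y; rewrite dot_basis.
apply: is_derive_eq; first exact: is_derive_dot.
by rewrite dot_basis mxE eqxx.
Qed.

Lemma is_derive_norm2 x v : x != 0 ->
  is_derive x v (@norm2 R m.+1) (dot x v / norm2 x).
Proof.
move=> x0; apply: is_derive_line.
have nx : 0 < norm2 x by rewrite norm2_gt0.
pose q (t : R) := t ^+ 2 * dot v v + 2 * t * dot x v + dot x x.
rewrite (_ : (fun t : R => _) = Num.sqrt \o q); last first.
  apply/funext => t; rewrite /= norm2E /q; congr Num.sqrt.
  by rewrite dotDl !dotDr !dotZl !dotZr (dotC v x); ring.
have q0 : q 0 = norm2 x ^+ 2 by rewrite /q norm2_sq; ring.
have dq : is_derive (0 : R) 1 q (2 * dot x v).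
  rewrite (_ : q = horner ((dot v v)%:P * 'X^2 + (2 * dot x v)%:P * 'X + (dot x x)%:P)); last first.
    by apply/funext => t; rewrite /q !(hornerD, hornerM, hornerC, hornerXn, hornerX); ring.
  by apply: is_derive_eq; rewrite !poly.derivE !(hornerD, hornerM, hornerC, hornerXn, hornerX, hornerMn); ring.
have ds : is_derive (q 0) 1 Num.sqrt (2 * Num.sqrt (q 0))^-1.
  by apply: is_derive1_sqrt; rewrite q0 exprn_gt0.
have [d1 d2] := is_derive1_comp ds dq.
split => //; rewrite d2 q0 sqrtr_sqr gtr0_norm//.
by field; rewrite gt_eqF.
Qed.

Lemma is_derive_norm2V x j k : x != 0 ->
  is_derive x (e_ j) (fun y => norm2 y ^- k) (- k%:R * x 0 j * norm2 x ^- k.+2).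
Proof.
move=> x0; have nx : norm2 x != 0 by rewrite gt_eqF// norm2_gt0.
have nk : norm2 x ^+ k != 0 by rewrite expf_neq0.
have dn := is_derive_norm2 (e_ j) x0.
have dk : is_derive x (e_ j) (fun y => norm2 y ^+ k)
    (k%:R * norm2 x ^+ k.-1 * (x 0 j / norm2 x)).
  rewrite -(dot_basis x j) (_ : (fun y => _) = (@norm2 R m.+1 : E -> R) ^+ k); last first.
    by rewrite exprfctE.
  exact: is_deriveX.
have [dk1 dk2] := dk.
split; first exact: (@derivableV _ _ (fun y : E => norm2 y ^+ k)).
rewrite (@deriveV _ _ (fun y : E => norm2 y ^+ k))// dk2 {dk dk1 dk2}.
case: k nk => [|k] nk; first by rewrite !mul0r scaler0 oppr0 !mul0r.
have nk' : norm2 x ^+ k != 0 by rewrite expf_neq0.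
rewrite /GRing.scale/= !exprSr; move: (norm2 x ^+ k) nk' => a a0.
by field; rewrite a0 nx.
Qed.

Lemma is_derive_mulf (f g : E -> R) x v (df dg : R) :
  is_derive x v f df -> is_derive x v g dg ->
  is_derive x v (fun y => f y * g y) (f x * dg + df * g x).
Proof.
move=> hf hg; have h := is_deriveM hf hg.
by apply: (is_derive_eq h); rewrite /GRing.scale/= [g x * _]mulrC.
Qed.

Lemma is_derive_addf (f g : E -> R) x v (df dg : R) :
  is_derive x v f df -> is_derive x v g dg ->
  is_derive x v (fun y => f y + g y) (df + dg).
Proof. by move=> hf hg; exact: is_deriveD. Qed.

Lemma is_derive_cmulf (c : R) (f : E -> R) x v (df : R) :
  is_derive x v f df -> is_derive x v (fun y => c * f y) (c * df).
Proof. by move=> hf; exact: is_deriveZ. Qed.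

(** With [w = x - p] and [v = p - c], this is
    [(|p - c|^2 - |x - c|^2) / |x - p|^n] in dimension [n = m + 1]. *)
Definition poisson (v w : E) : R :=
  - 1 * norm2 w ^- m.-1 + - 2 * (dot w v * norm2 w ^- m.+1).

Let predE w : (0 < m)%N ->
  (norm2 w ^+ m = norm2 w * norm2 w ^+ m.-1) * (m%:R = m.-1%:R + 1 :> R).
Proof. by move=> m0; rewrite -exprS natr1 prednK. Qed.

Lemma poissonE v w : (0 < m)%N -> w != 0 ->
  poisson v w = (norm2 v ^+ 2 - norm2 (w + v) ^+ 2) * norm2 w ^- m.+1.
Proof.
move=> m0 w0; have nw : norm2 w != 0 by rewrite gt_eqF// norm2_gt0.
rewrite /poisson norm2_sqD.
have nk : norm2 w ^+ m.-1 != 0 by rewrite expf_neq0.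
rewrite !exprS (predE w m0); move: (norm2 w ^+ m.-1) nk => a a0; field.
by rewrite nw a0.
Qed.

(** The partial derivatives of [poisson v] of order one and two, in closed form. *)
Definition poisson1 v i w : R :=
  (m.-1%:R * (w 0 i * norm2 w ^- m.+1) + (- 2 * v 0 i) * norm2 w ^- m.+1)
  + 2 * m.+1%:R * (dot w v * (w 0 i * norm2 w ^- m.+3)).

Definition poisson2 v i j w : R :=
  m.-1%:R * ((i == j)%:R * norm2 w ^- m.+1 - m.+1%:R * w 0 i * w 0 j * norm2 w ^- m.+3)
  + 2 * m.+1%:R * (v 0 i * w 0 j + v 0 j * w 0 i + dot w v * (i == j)%:R)
      * norm2 w ^- m.+3
  - 2 * m.+1%:R * m.+3%:R * dot w v * w 0 i * w 0 j * norm2 w ^- m.+4.+1.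

Lemma is_derive_poisson v w i : (0 < m)%N -> w != 0 ->
  is_derive w (e_ i) (poisson v) (poisson1 v i w).
Proof.
move=> m0 w0; have nw : norm2 w != 0 by rewrite gt_eqF// norm2_gt0.
have D := is_derive_addf (is_derive_cmulf (-1) (is_derive_norm2V i m.-1 w0))
  (is_derive_cmulf (-2) (is_derive_mulf (is_derive_dot w (e_ i) v) (is_derive_norm2V i m.+1 w0))).
apply: (is_derive_eq D).
rewrite /poisson1 (dotC (e_ i) v) dot_basis;
have nk : norm2 w ^+ m.-1 != 0 by rewrite expf_neq0.
rewrite !exprS -natr1 !(predE w m0); move: (norm2 w ^+ m.-1) nk => a a0; field.
by rewrite nw a0.
Qed.

Lemma is_derive_poisson1 v w i j : w != 0 ->
  is_derive w (e_ j) (poisson1 v i) (poisson2 v i j w).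
Proof.
move=> w0; have nw : norm2 w != 0 by rewrite gt_eqF// norm2_gt0.
have dn k := is_derive_norm2V j k w0; have dc := is_derive_coord w i j.
have D := is_derive_addf (is_derive_addf
   (is_derive_cmulf m.-1%:R (is_derive_mulf dc (dn m.+1)))
   (is_derive_cmulf (- 2 * v 0 i) (dn m.+1)))
   (is_derive_cmulf (2 * m.+1%:R)
     (is_derive_mulf (is_derive_dot w (e_ j) v) (is_derive_mulf dc (dn m.+3)))).
apply: (is_derive_eq D).
rewrite /poisson2 (dotC (e_ j)) dot_basis.
have nk : norm2 w ^+ m != 0 by rewrite expf_neq0.
rewrite !exprS; move: (norm2 w ^+ m) nk => a a0; field.
by rewrite nw a0.
Qed.

Lemma sum_poisson2 v w : (0 < m)%N -> w != 0 -> \sum_i poisson2 v i i w = 0.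
Proof.
move=> m0 w0; have nw : norm2 w != 0 by rewrite gt_eqF// norm2_gt0.
have dE (u u' : E) : \sum_i u 0 i * u' 0 i = dot u u' by [].
pose A : R := m.-1%:R * norm2 w ^- m.+1 + 2 * m.+1%:R * dot w v * norm2 w ^- m.+3.
pose B : R := - m.-1%:R * m.+1%:R * norm2 w ^- m.+3
  - 2 * m.+1%:R * m.+3%:R * dot w v * norm2 w ^- m.+4.+1.
pose C : R := 4 * m.+1%:R * norm2 w ^- m.+3.
rewrite (eq_bigr (fun i => A + B * (w 0 i * w 0 i) + C * (w 0 i * v 0 i))); last first.
  move=> i _; rewrite /poisson2 eqxx mulr1n /A /B /C.
  by move: (norm2 w ^- m.+1) (norm2 w ^- m.+3) (norm2 w ^- m.+4.+1) => a b c; ring.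
have -> (a b c : R) : \sum_i (a + b * (w 0 i * w 0 i) + c * (w 0 i * v 0 i)) =
    m.+1%:R * a + b * norm2 w ^+ 2 + c * dot w v.
  by rewrite !big_split/= sumr_const card_ord -!mulr_sumr !dE -norm2_sq mulr_natl.
rewrite /A /B /C.
have nk : norm2 w ^+ m.-1 != 0 by rewrite expf_neq0.
rewrite !exprS -[m.+3%:R]natr1 -[m.+2%:R]natr1 -[m.+1%:R]natr1 !(predE w m0).
move: (norm2 w ^+ m.-1) nk => a a0; field.
by rewrite nw a0.
Qed.

Lemma continuous_norm2V k w : w != 0 ->
  {for w, continuous (fun x : E => norm2 x ^- k)}.
Proof.
move=> w0; have nw : norm2 w != 0 by rewrite gt_eqF// norm2_gt0.
apply: (@cvgV _ _ (nbhs w) (nbhs_filter w) (fun x : E => norm2 x ^+ k) (norm2 w ^+ k)).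
  exact: expf_neq0.
apply: (continuous_comp (f := @norm2 R m.+1) (g := fun t : R => t ^+ k)).
  exact: continuous_norm2.
exact: exprn_continuous.
Qed.

Lemma continuous_poisson2 v i j w : w != 0 -> {for w, continuous (poisson2 v i j)}.
Proof.
move=> w0; have cn k : {for w, continuous (fun x : E => norm2 x ^- k)}.
  exact: continuous_norm2V.
have cc k : {for w, continuous (fun x : E => x 0 k)} by exact: coord_continuous.
have cd : {for w, continuous (fun x : E => dot x v)} by exact: continuous_dotl.
have ck (k : R) : {for w, continuous (fun x : E => k)} by exact: cst_continuous.
rewrite /poisson2.
repeat first [exact: cn|exact: cc|exact: cd|exact: ck|apply: continuousM|apply: continuousD|apply: continuousB|apply: continuousN].
Qed.

Lemma is_derive_along_line (f : E -> R) x v (t df : R) :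
  is_derive (t *: v + x) v f df -> is_derive t 1 (fun t : R => f (t *: v + x)) df.
Proof.
have H : (fun h : R => h^-1 *: ((f \o shift (t *: v + x)) (h *: v) - f (t *: v + x))) =
    (fun h : R => h^-1 *: (((fun t : R => f (t *: v + x)) \o shift t) (h *: 1) -
    f (t *: v + x))).
  by apply/funext => h /=; rewrite [h *: 1]mulr1 scalerDl addrA.
by move=> [d1 d2]; split; [move: d1; rewrite /derivable H|rewrite -d2 /derive H].
Qed.

(** Away from the pole the second derivatives are bounded uniformly in the
    direction of the pole: after dividing [w] by its norm, each term is a bounded
    factor times a power of [1 / |w|]. *)
Lemma poisson2_bound (a b : R) : 0 < a -> 0 < b ->
  exists C : R, forall v i w, norm2 v = b -> a <= norm2 w -> `|poisson2 v i i w| <= C.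
Proof.
move=> a0 b0; pose A1 := a ^- m.+1; pose A2 := a ^- m.+2.
exists (m.-1%:R * (A1 + m.+1%:R * A1) + 2 * m.+1%:R * (3 * b * A2)
  + 2 * m.+1%:R * m.+3%:R * (b * A2)) => v i w vb aw.
have q0 : 0 < norm2 w by exact: lt_le_trans aw.
have P k : 0 <= norm2 w ^- k <= a ^- k.
  rewrite invr_ge0 exprn_ge0 ?norm2_ge0//= lef_pV2 ?posrE ?exprn_gt0//.
  by rewrite lerXn2r ?nnegrE ?(ltW a0)// norm2_ge0.
pose al := w 0 i / norm2 w; pose be := dot w v / norm2 w.
have al1 : `|al| <= 1.
  by rewrite normrM normfV (gtr0_norm q0) ler_pdivrMr// mul1r coord_le_norm2.
have be1 : `|be| <= b.
  rewrite normrM normfV (gtr0_norm q0) ler_pdivrMr// -vb mulrC.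
  exact: cauchy_schwarz_abs.
have vi : `|v 0 i| <= b by rewrite -vb coord_le_norm2.
have /andP[P10 P1] := P m.+1; have /andP[P20 P2] := P m.+2.
have -> : poisson2 v i i w = m.-1%:R * (norm2 w ^- m.+1 - m.+1%:R * (al * al * norm2 w ^- m.+1))
    + 2 * m.+1%:R * ((v 0 i * al + v 0 i * al + be) * norm2 w ^- m.+2)
    - 2 * m.+1%:R * m.+3%:R * (be * al * al * norm2 w ^- m.+2).
  rewrite /poisson2 eqxx mulr1n /al /be; have nq : norm2 w != 0 by rewrite gt_eqF.
  have nk : norm2 w ^+ m != 0 by rewrite expf_neq0.
  rewrite !exprS; move: (norm2 w ^+ m) nk => d d0; field.
  by rewrite nq d0.
have M (x y X Y : R) : `|x| <= X -> `|y| <= Y -> `|x * y| <= X * Y.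
  by move=> xX yY; rewrite normrM ler_pM.
have D (x y X Y : R) : `|x| <= X -> `|y| <= Y -> `|x + y| <= X + Y.
  by move=> xX yY; rewrite (le_trans (ler_normD _ _))// lerD.
have N (x X : R) : `|x| <= X -> `|- x| <= X by rewrite normrN.
have K (x : R) : 0 <= x -> `|x| <= x by move=> x0; rewrite ger0_norm.
have nP1 : `|norm2 w ^- m.+1| <= A1 by rewrite ger0_norm.
have nP2 : `|norm2 w ^- m.+2| <= A2 by rewrite ger0_norm.
have -> : A1 + m.+1%:R * A1 = A1 + m.+1%:R * (1 * 1 * A1) by rewrite !mul1r.
have -> : 3 * b * A2 = (b * 1 + b * 1 + b) * A2 by ring.
have -> : b * A2 = b * 1 * 1 * A2 by rewrite !mulr1.
apply: (D); [apply: (D)|apply: (N)].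
- apply: (M); first exact: (K).
  apply: (D) => //; apply: (N); apply: (M); first exact: (K).
  by apply: (M) => //; exact: (M).
- apply: (M); first by apply: (K); rewrite mulr_ge0.
  by apply: (M) => //; apply: (D) => //; apply: (D); exact: (M).
- apply: (M); first by apply: (K); rewrite !mulr_ge0.
  by apply: (M) => //; apply: (M) => //; exact: (M).
Qed.

Lemma poisson_harmonic v p (W : set E) : (0 < m)%N -> ~ W p -> open W ->
  harmonic_on W (fun x => poisson v (x - p)).
Proof.
move=> m0 Wp oW.
have ne x : W x -> x - p != 0.
  by move=> Wx; apply/eqP => /subr0_eq xp; apply: Wp; rewrite -xp.
have D1 x i : W x -> is_derive x (e_ i) (fun x => poisson v (x - p)) (poisson1 v i (x - p)).
  by move=> Wx; apply: is_derive_translate; apply: is_derive_poisson => //; exact: ne.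
have D2 x i j : W x -> is_derive x (e_ j) ('D_(e_ i) (fun x => poisson v (x - p)))
    (poisson2 v i j (x - p)).
  move=> Wx; apply: (@near_eq_is_derive _ _ _ (fun x => poisson1 v i (x - p))).
    near=> y; have Wy : W y by near: y; exact: open_nbhs_nbhs.
    by have [_ ->] := D1 y i Wy.
  by apply: is_derive_translate; apply: is_derive_poisson1; exact: ne.
split=> [x Wx i j|x Wx].
  split; [by case: (D1 x i Wx)|by case: (D2 x i j Wx)|].
  have N : \forall y \near x, 'D_(e_ j) ('D_(e_ i) (fun x => poisson v (x - p))) y
      = poisson2 v i j (y - p).
    near=> y; have Wy : W y by near: y; exact: open_nbhs_nbhs.
    by have [_ ->] := D2 y i j Wy.
  have C : {for x, continuous (fun y : E => poisson2 v i j (y - p))}.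
    apply: (continuous_comp (f := fun y : E => y - p) (g := poisson2 v i j)); last first.
      by apply: continuous_poisson2; exact: ne.
    by apply: continuousB; [move=> A; exact|exact: cst_continuous].
  have Nx := nbhs_singleton N; move=> A; rewrite {1}Nx => /C.
  by rewrite /= !nbhs_simpl /=; apply: filterS2 N => y /= ->.
rewrite -[RHS](sum_poisson2 v m0 (ne x Wx)); apply: eq_bigr => i _.
by have [_ ->] := D2 x i i Wx.
Unshelve. all: by end_near. Qed.

End Kernel.

(** * The mean value property of the sphere *)

Section SecondDifference.
Context {R : realType}.

(** Taylor's formula for the symmetric second difference: [A] is chosen so that
    [f h + f (- h) - 2 f 0 - A h^2 = 0], and Rolle's theorem is applied twice to the
    symmetrized function [F]. *)
Lemma second_difference (f f1 f2 : R -> R) (h : R) : 0 < h ->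
    (forall t : R, -h <= t <= h -> is_derive t 1 f (f1 t)) ->
    (forall t : R, -h <= t <= h -> is_derive t 1 f1 (f2 t)) ->
  exists2 c, 0 < c < h & f h + f (- h) - 2 * f 0 = h ^+ 2 * ((f2 c + f2 (- c)) / 2).
Proof.
move=> h0 d1 d2; pose A := (f h + f (- h) - 2 * f 0) / h ^+ 2.
pose F t := f t + f (- t) - 2 * f 0 - A * t ^+ 2.
pose F1 t := f1 t - f1 (- t) - 2 * A * t.
pose F2 t := f2 t + f2 (- t) - 2 * A.
have hN (t : R) : -h <= t <= h -> -h <= - t <= h.
  by move=> /andP[t1 t2]; rewrite lerN2 t2 lerNl t1.
have dN (g g1 : R -> R) (t : R) : is_derive (- t) 1 g (g1 (- t)) ->
    is_derive t 1 (fun s => g (- s)) (- g1 (- t)).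
  by move=> dg; have := is_derive1_comp dg (is_deriveNid t (1 : R)); rewrite mulrN1.
have dF (t : R) : -h <= t <= h -> is_derive t 1 F (F1 t).
  move=> th; have D1 := d1 t th; have D2 := dN f f1 t (d1 _ (hN _ th)).
  have D3 := is_deriveD (is_deriveD D1 D2)
    (is_derive_poly (- (2 * f 0)%:P - A%:P * 'X^2) t).
  rewrite (_ : F = (f + (fun s => f (- s)) + horner (- (2 * f 0)%:P - A%:P * 'X^2))); last first.
    apply/funext => s; rewrite /F !fctE !(hornerD, hornerN, hornerM, hornerC, hornerX).
    by rewrite /=; ring.
  apply: (is_derive_eq D3).
  by rewrite /F1 !poly.derivE !(hornerD, hornerN, hornerM, hornerC, hornerXn, hornerX, hornerMn); ring.
have dF1 (t : R) : -h <= t <= h -> is_derive t 1 F1 (F2 t).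
  move=> th; have D1 := d2 t th; have D2 := dN f1 f2 t (d2 _ (hN _ th)).
  have D3 := is_deriveD (is_deriveB D1 D2) (is_derive_poly (- ((2 * A)%:P * 'X)) t).
  rewrite (_ : F1 = (f1 - (fun s => f1 (- s)) + horner (- ((2 * A)%:P * 'X)))); last first.
    by apply/funext => s; rewrite /F1 !fctE !(hornerD, hornerN, hornerM, hornerC, hornerX) /=; ring.
  apply: (is_derive_eq D3).
  by rewrite /F2 !poly.derivE !(hornerD, hornerN, hornerM, hornerC, hornerXn, hornerX, hornerMn); ring.
have cont (g g1 : R -> R) (a b : R) : -h <= a -> b <= h ->
    (forall t : R, -h <= t <= h -> is_derive t 1 g (g1 t)) -> {within `[a, b], continuous g}.
  move=> ha bh dg; apply: derivable_within_continuous => t; rewrite in_itv/= => /andP[t1 t2].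
  by have [] : is_derive t 1 g (g1 t) by apply: dg; rewrite (le_trans ha t1) (le_trans t2 bh).
have h2 : h ^+ 2 != 0 by rewrite expf_neq0// gt_eqF.
have F0 : F 0 = 0 by rewrite /F oppr0; ring.
have Fh : F h = 0 by rewrite /F /A; field; rewrite gt_eqF.
have [c1 c1h [_ Dc1]] : exists2 c, c \in `]0, h[%R & is_derive c 1 F 0.
  apply: Rolle => //.
  - move=> t; rewrite in_itv/= => /andP[t1 t2].
    have [] // : is_derive t 1 F (F1 t) by apply: dF; rewrite (ltW t2) (le_trans _ (ltW t1))// oppr_le0 ltW.
  - by apply: cont dF => //; rewrite oppr_le0 ltW.
  - by rewrite F0 Fh.
move: c1h; rewrite in_itv/= => /andP[c10 c1h].
have F1c1 : F1 c1 = 0.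
  have [_ <-//] : is_derive c1 1 F (F1 c1).
  by apply: dF; rewrite (ltW c1h) (le_trans _ (ltW c10))// oppr_le0 ltW.
have F10 : F1 0 = 0 by rewrite /F1 oppr0; ring.
have [c c_in [_ Dc]] : exists2 c, c \in `]0, c1[%R & is_derive c 1 F1 0.
  apply: Rolle => //.
  - move=> t; rewrite in_itv/= => /andP[t1 t2].
    have [] // : is_derive t 1 F1 (F2 t).
    by apply: dF1; rewrite (ltW (lt_trans t2 c1h)) (le_trans _ (ltW t1))// oppr_le0 ltW.
  - by apply: cont dF1; [rewrite oppr_le0 ltW|exact: ltW].
  - by rewrite F10 F1c1.
move: c_in; rewrite in_itv/= => /andP[c0 cc1].
have ch := lt_trans cc1 c1h; exists c; first by rewrite c0 ch.
have F2c : F2 c = 0.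
  have [_ <-//] : is_derive c 1 F1 (F2 c).
  by apply: dF1; rewrite (ltW ch) (le_trans _ (ltW c0))// oppr_le0 ltW.
have -> : f2 c + f2 (- c) = 2 * A by move: F2c; rewrite /F2 => /subr0_eq.
by rewrite /A; field; rewrite gt_eqF.
Qed.

End SecondDifference.

Section DominatedRintegral.
Context d (T : measurableType d) {R : realType} (mu : {measure set T -> \bar R}).

Lemma bounded_Rintegral_cvg0 (D : set T) (g : nat -> T -> R) (C : R) :
    measurable D -> (mu D < +oo)%E -> (forall k, measurable_fun D (g k)) ->
    (forall k x, D x -> `|g k x| <= C) ->
    (forall x, D x -> g k x @[k --> \oo] --> 0) ->
  Rintegral mu D (g k) @[k --> \oo] --> 0.
Proof.
move=> mD fin mg gC g0.
have mg' k : measurable_fun D (fun x => (g k x)%:E) by exact/measurable_EFinP.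
have m0 : measurable_fun D (cst 0%E : T -> \bar R) by exact: measurable_cst.
have cv : {ae mu, forall x, D x -> (g k x)%:E @[k --> \oo] --> (cst 0%E : T -> \bar R) x}.
  by apply: aeW => x Dx; apply: cvg_EFin; [exact: nearW|exact: g0].
have iC : mu.-integrable D (cst C%:E).
  by apply: (@bounded_integrable _ _ _ mu D (cst C) `|C|) => //; exact: measurable_cst.
have bd : {ae mu, forall x k, D x -> (`|(g k x)%:E| <= (cst C%:E : T -> \bar R) x)%E}.
  by apply: aeW => x k Dx; rewrite lee_fin gC.
have [_ _] := dominated_convergence mD mg' m0 cv iC bd.
rewrite integral0 => h; apply: fine_cvg; exact: h.
Qed.

Section IntegrableR.
Variables (D : set T) (mD : measurable D).
Implicit Types f g : T -> R.

Lemma integrable_scaleR k f : mu.-integrable D (EFin \o f) ->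
  mu.-integrable D (EFin \o (fun x => k * f x)).
Proof. by move=> fi; exact: (integrableZl mD k fi). Qed.

Lemma integrable_addR f g : mu.-integrable D (EFin \o f) ->
  mu.-integrable D (EFin \o g) -> mu.-integrable D (EFin \o (fun x => f x + g x)).
Proof. by move=> fi gi; exact: (integrableD mD fi gi). Qed.

Lemma integrable_subR f g : mu.-integrable D (EFin \o f) ->
  mu.-integrable D (EFin \o g) -> mu.-integrable D (EFin \o (fun x => f x - g x)).
Proof. by move=> fi gi; exact: (integrableB mD fi gi). Qed.

Lemma Rintegral_sum (I : Type) (s : seq I) (F : I -> T -> R) :
    (forall i, mu.-integrable D (EFin \o F i)) ->
  Rintegral mu D (fun x => \sum_(i <- s) F i x) = \sum_(i <- s) Rintegral mu D (F i).
Proof.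
move=> Fi; suff [] : mu.-integrable D (EFin \o (fun x => \sum_(i <- s) F i x)) /\
    Rintegral mu D (fun x => \sum_(i <- s) F i x) = \sum_(i <- s) Rintegral mu D (F i) by [].
elim: s => [|i s [IH1 IH2]].
  rewrite big_nil (_ : (fun x => _) = cst 0); last by apply/funext => x; rewrite big_nil.
  by split; [exact: integrable0|rewrite Rintegral_cst// mul0r].
rewrite big_cons (_ : (fun x => _) = (fun x => F i x + \sum_(i <- s) F i x)); last first.
  by apply/funext => x; rewrite big_cons.
by split; [exact: integrable_addR|rewrite RintegralD// IH2].
Qed.

End IntegrableR.

End DominatedRintegral.

Section SwapRadii.
Context {R : realType} {n : nat}.
Implicit Types u w : 'rV[R]_n.

Lemma norm2_rescale w (r b : R) : 0 < r -> 0 < b -> norm2 w = b ->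
  norm2 ((r / b) *: w) = r.
Proof.
by move=> r0 b0 wb; rewrite norm2Z wb gtr0_norm ?divr_gt0// divfK// gt_eqF.
Qed.

(** Exchanging the radii of two points preserves their distance; this is the
    symmetry of the Poisson kernel in its two arguments. *)
Lemma dist_swap_radii u w (r b : R) : 0 < r -> 0 < b -> norm2 u = r -> norm2 w = b ->
  norm2 ((r / b) *: w - (b / r) *: u) = norm2 (u - w).
Proof.
move=> r0 b0 ur wb; apply: (@pexpIrn _ 2) => //; rewrite ?nnegrE ?norm2_ge0//.
rewrite !norm2_sqB !norm2_rescale// ur wb dotZl dotZr (dotC w); field.
by rewrite !gt_eqF.
Qed.

End SwapRadii.

Section RadialMaximum.

Let half_gap (F : realFieldType) (A B : F) : A <= B + (A - B) / 2 -> A <= B.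
Proof. by lra. Qed.

Let perturbed_max (F : realFieldType) (s e A B C q d h : F) :
    s * C + e * (q - 2 * d + h) <= s * A + e * q ->
    s * B + e * (q + 2 * d + h) <= s * A + e * q ->
  s * (B + C - 2 * A) <= h * - (2 * e).
Proof. by lra. Qed.

Context {R : realType} {m : nat}.
Local Notation E := 'rV[R]_m.+1.
Local Notation e_ i := (basis_vec i : E).
Implicit Types (x y z : E) (b r : R).

(** Small enough for all points [y + step *: v] with [|v| = 1] to stay in the ball
    of radius [b]. *)
Definition step b y (k : nat) : R := (b - norm2 y) / 2 / k.+1%:R.

(** A discrete Laplacian of [F] at [y], whose step tends to zero with [k]. Working
    with second differences avoids differentiating twice under the integral. *)
Definition diff2 b (F : E -> R) y k : R :=
  \sum_i ((step b y k) ^- 2 *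
    (F (y + step b y k *: e_ i) + F (y - step b y k *: e_ i) - 2 * F y)).

Lemma step_gt0 b y k : norm2 y < b -> 0 < step b y k.
Proof. by move=> yb; rewrite !divr_gt0// subr_gt0. Qed.

Lemma step_le b y k : norm2 y < b -> step b y k <= (b - norm2 y) / 2.
Proof.
move=> yb; rewrite /step ler_pdivrMr// ler_peMr ?ler1n//.
by rewrite divr_ge0// subr_ge0 ltW.
Qed.

Lemma step_cvg b y : step b y k @[k --> \oo] --> 0.
Proof.
rewrite -(mulr0 ((b - norm2 y) / 2)); apply: cvgM; first exact: cvg_cst.
exact: cvg_harmonic.
Qed.

Local Notation dir := (basis_vec ord0 : E).

Lemma norm_dir (s : R) : norm2 (s *: dir) = `|s|.
Proof. by rewrite norm2Z norm2_basis mulr1. Qed.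

Variables (Phi : E -> R) (r b : R).
Hypotheses (r0 : 0 < r) (rb : r < b).
Hypothesis Phi_radial : forall y z, norm2 y = norm2 z -> norm2 y < b -> Phi y = Phi z.
Hypothesis Phi_continuous : forall q : R, 0 <= q <= r ->
  {for q, continuous (fun s : R => Phi (s *: dir))}.
Hypothesis diff2_Phi_cvg : forall y, norm2 y < b -> diff2 b Phi y k @[k --> \oo] --> 0.

(** The maximum principle for the radial harmonic function [Phi]: were its values
    at the centre and on the sphere of radius [r] different, adding a small
    multiple of [|y|^2] would produce an interior maximum. *)
Let Phi_center_le (sg : R) : sg * Phi 0 <= sg * Phi (r *: dir).
Proof.
rewrite leNgt; apply/negP => lt0.
pose e := (sg * Phi 0 - sg * Phi (r *: dir)) / (2 * r ^+ 2).
have e0 : 0 < e by rewrite divr_gt0 ?subr_gt0// mulr_gt0// exprn_gt0.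
have er : e * r ^+ 2 = (sg * Phi 0 - sg * Phi (r *: dir)) / 2.
  rewrite /e; move: (_ - _) => A; have : r ^+ 2 != 0 by rewrite expf_neq0// gt_eqF.
  by move: (r ^+ 2) => q q0; field.
pose G (s : R) := sg * Phi (s *: dir) + e * s ^+ 2.
have cG : {within `[0, r], continuous G}.
  apply: continuous_in_subspaceT => s; rewrite inE/= in_itv/= => sr.
  have c1 : {for s, continuous (fun s : R => sg * Phi (s *: dir))}.
    by apply: continuousM; [exact: cst_continuous|exact: Phi_continuous].
  have c2 : {for s, continuous (fun s : R => e * s ^+ 2)}.
    by apply: continuousM; [exact: cst_continuous|exact: exprn_continuous].
  exact: (continuousD c1 c2).
have [s] := EVT_max (ltW r0) cG; rewrite in_itv/= => /andP[s0 sr] smax.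
have {}sr : s < r.
  rewrite lt_neqAle sr andbT; apply/eqP => sE.
  have : G 0 <= G s by apply: smax; rewrite in_itv/= lexx ltW.
  rewrite sE {1}/G scale0r expr2 !mulr0 addr0 /G er => /half_gap.
  by rewrite leNgt lt0.
pose y := s *: dir; have ys : norm2 y = s by rewrite /y norm_dir ger0_norm.
have yb : norm2 y < b by rewrite ys (lt_trans sr).
have GP z : norm2 z <= r -> sg * Phi z + e * norm2 z ^+ 2 <= sg * Phi y + e * norm2 y ^+ 2.
  move=> zr; have : G (norm2 z) <= G s by apply: smax; rewrite in_itv/= norm2_ge0.
  rewrite /G -/y ys (@Phi_radial z (norm2 z *: dir)) ?norm_dir ?ger0_norm ?norm2_ge0//.
  exact: le_lt_trans rb.
have lim0 : sg * diff2 b Phi y k @[k --> \oo] --> sg * 0.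
  by apply: cvgM; [exact: cvg_cst|exact: diff2_Phi_cvg].
have rs : 0 < r - s by rewrite subr_gt0.
have near_le : \forall k \near \oo, sg * diff2 b Phi y k <= \sum_(i < m.+1) (- (2 * e)).
  have /cvgrPdist_lt/(_ _ rs) := step_cvg b y.
  apply: filterS => k; rewrite sub0r normrN (gtr0_norm (step_gt0 k yb)) => hk.
  rewrite /diff2 mulr_sumr; apply: ler_sum => i _.
  have h0 := step_gt0 k yb; set h := step b y k in hk h0 *.
  have nr (t : R) : `|t| <= h -> norm2 (y + t *: e_ i) <= r.
    move=> th; apply: le_trans (norm2D _ _) _.
    by rewrite norm2Z norm2_basis mulr1 ys -lerBrDl (le_trans th)// ltW.
  have P1 : norm2 (y + h *: e_ i) <= r by apply: nr; rewrite gtr0_norm.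
  have P2 : norm2 (y - h *: e_ i) <= r.
    by rewrite -scaleNr; apply: nr; rewrite normrN gtr0_norm.
  have := GP _ P1; have := GP _ P2.
  have he : norm2 (h *: e_ i) ^+ 2 = h ^+ 2 by rewrite norm2Z norm2_basis mulr1 gtr0_norm.
  have := norm2_sqD y (h *: e_ i); have := norm2_sqB y (h *: e_ i).
  rewrite he => -> -> HB HC.
  rewrite mulrCA -ler_pdivlMl ?invr_gt0 ?exprn_gt0// invrK.
  exact: perturbed_max HB HC.
have : sg * 0 <= \sum_(i < m.+1) (- (2 * e)).
  rewrite -(cvg_lim (@Rhausdorff R) lim0); apply: limr_le => //.
  exact: cvgP lim0.
rewrite mulr0 sumr_const card_ord -[X in _ <= X]mulr_natr; apply/negP; rewrite -ltNge.
by rewrite nmulr_rlt0 ?ltr0n// oppr_lt0 mulr_gt0.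
Qed.

Lemma radial_mean_value : Phi 0 = Phi (r *: dir).
Proof.
apply: le_anti; have := Phi_center_le 1; have := Phi_center_le (-1).
by rewrite !mulN1r !mul1r lerN2 => -> ->.
Qed.

End RadialMaximum.

Section SphereMeanValue.

Context {R : realType} {m : nat}.
Local Notation E := 'rV[R]_m.+1.
Local Notation e_ i := (basis_vec i : E).
Local Notation hm := (@hausdorff_measure R m.+1 m).
Implicit Types (x y u v w : E).

Definition sphere2 (c : E) (r : R) : set E := [set x | norm2 (x - c) = r].

Lemma closed_sphere2 c r : closed (sphere2 c r).
Proof.
apply: (@preimage_closed _ _ (fun x => norm2 (x - c)) [set r]).
  by move=> x _; exact: continuous_norm2B.
exact: closed_eq.
Qed.

(** Householder reflections suffice to move any point of a sphere to any other. *)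
Definition reflection (d u : E) : E := u - (2 * dot u d / dot d d) *: d.

Lemma norm2_reflection d u : norm2 (reflection d u) = norm2 u.
Proof.
rewrite !norm2E; congr Num.sqrt.
have [->|d0] := eqVneq d 0; first by rewrite /reflection scaler0 subr0.
have dd : dot d d != 0 by apply/eqP => /dot_eq0 /eqP; rewrite (negbTE d0).
rewrite /reflection dotBl !dotBr !dotZl !dotZr (dotC d u); field.
by rewrite dd.
Qed.

Lemma reflectionB d u v : reflection d (u - v) = reflection d u - reflection d v.
Proof.
rewrite /reflection dotBl mulrBr mulrBl scalerBl !opprD !opprK.
by rewrite addrACA.
Qed.

Lemma reflectionZ d k u : reflection d (k *: u) = k *: reflection d u.
Proof.
by rewrite /reflection dotZl scalerBr scalerA; congr (_ - _ *: _); ring.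
Qed.

Lemma reflectionK d u : reflection d (reflection d u) = u.
Proof.
have [->|d0] := eqVneq d 0; first by rewrite /reflection !scaler0 !subr0.
have dd : dot d d != 0 by apply/eqP => /dot_eq0 /eqP; rewrite (negbTE d0).
rewrite {1}/reflection {2}/reflection dotBl dotZl.
rewrite (_ : 2 * _ / _ = - (2 * dot u d / dot d d)); last by field.
by rewrite scaleNr opprK /reflection subrK.
Qed.

Lemma reflection_swap y z : norm2 y = norm2 z -> reflection (y - z) y = z.
Proof.
move=> yz; have [yz0|d0] := eqVneq (y - z) 0.
  by rewrite /reflection yz0 scaler0 subr0; exact: subr0_eq.
have dd : dot (y - z) (y - z) != 0 by apply/eqP => /dot_eq0 /eqP; rewrite (negbTE d0).
have E : 2 * dot y (y - z) = dot (y - z) (y - z).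
  have : norm2 y ^+ 2 = norm2 z ^+ 2 by rewrite yz.
  by rewrite !norm2_sq dotBl !dotBr (dotC z y) => h; ring: h.
by rewrite /reflection E divff// scale1r opprB addrC subrK.
Qed.

Variables (c : E) (r b : R).
Hypotheses (m0 : (0 < m)%N) (r0 : 0 < r) (rb : r < b).
Local Notation S := (sphere2 c r).
Hypothesis Sfin : (hm S < +oo)%E.

Let b0 : 0 < b. Proof. exact: lt_trans rb. Qed.

Let mS : measurable (S : set (caratheodory_type (hausdorff m.+1 m))).
Proof. exact/closed_cara_measurable/closed_sphere2. Qed.

(** The Poisson kernel of the ball [|y| < b], with the pole read off on the
    sphere of radius [r]. *)
Let pole x : E := (b / r) *: (x - c).
Let f y x : R := (b ^+ 2 - norm2 y ^+ 2) * norm2 (y - pole x) ^- m.+1.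
Let Phi y : R := Rintegral hm S (f y).

Let norm_pole x : S x -> norm2 (pole x) = b.
Proof. by rewrite /pole norm2Z => ->; rewrite gtr0_norm ?divr_gt0// divfK ?gt_eqF. Qed.

Let dist_pole y x : S x -> b - norm2 y <= norm2 (y - pole x).
Proof.
move=> /norm_pole nx; rewrite -nx norm2_distC.
exact: le_trans (ler_norm _) (norm2_lipschitz _ _).
Qed.

Let f_bound a y x : 0 < a -> norm2 y <= b - a -> S x ->
  0 <= f y x <= b ^+ 2 * a ^- m.+1.
Proof.
move=> a0 ya Sx; have ad : a <= norm2 (y - pole x).
  by apply: le_trans (dist_pole y Sx); rewrite lerBrDl -lerBrDr.
have n0 := norm2_ge0 y; have nb : norm2 y <= b by lra.
have d0 : 0 <= b ^+ 2 - norm2 y ^+ 2 by rewrite subr_ge0 lerXn2r ?nnegrE ?(ltW b0).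
apply/andP; split; first by rewrite mulr_ge0// invr_ge0 exprn_ge0// norm2_ge0.
apply: ler_pM => //; first by rewrite invr_ge0 exprn_ge0// norm2_ge0.
  by rewrite gerBl sqr_ge0.
rewrite lef_pV2 ?posrE ?exprn_gt0//; last exact: lt_le_trans ad.
by rewrite lerXn2r ?nnegrE ?(ltW a0)// norm2_ge0.
Qed.

Let mf y : norm2 y < b -> measurable_fun (S : set (caratheodory_type (hausdorff m.+1 m))) (f y).
Proof.
move=> yb; apply: continuous_cara_measurable_fun => // x Sx.
have ne : y - pole x != 0.
  by rewrite -norm2_gt0; apply: lt_le_trans (dist_pole y Sx); rewrite subr_gt0.
have cx : {for x, continuous (fun x : E => norm2 (y - pole x) ^- m.+1)}.
  apply: (continuous_comp (f := fun x : E => y - pole x) (g := fun w : E => norm2 w ^- m.+1)).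
    apply: continuousB; first exact: cst_continuous.
    apply: (continuous_comp (f := fun x : E => x - c) (g := fun w : E => (b / r) *: w)).
      by apply: continuousB; [move=> A; exact|exact: cst_continuous].
    exact: scaler_continuous.
  exact: continuous_norm2V.
by apply: continuousM; [exact: cst_continuous|exact: cx].
Qed.

Let f_ge0 y x : norm2 y < b -> S x -> 0 <= f y x.
Proof.
move=> yb Sx; have h : 0 < b - norm2 y by rewrite subr_gt0.
have ya : norm2 y <= b - (b - norm2 y) by rewrite subKr.
by have /andP[] := f_bound h ya Sx.
Qed.

Let f_le y x : norm2 y < b -> S x -> f y x <= b ^+ 2 * (b - norm2 y) ^- m.+1.
Proof.
move=> yb Sx; have h : 0 < b - norm2 y by rewrite subr_gt0.
have ya : norm2 y <= b - (b - norm2 y) by rewrite subKr.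
by have /andP[] := f_bound h ya Sx.
Qed.

Let fi y : norm2 y < b -> hm.-integrable S (EFin \o f y).
Proof.
move=> yb; apply: (bounded_integrable mS Sfin (mf yb) (M := b ^+ 2 * (b - norm2 y) ^- m.+1)).
by move=> x Sx; rewrite ger0_norm ?f_ge0// f_le.
Qed.

(** The reflection exchanging [y] and [z] is an isometry of [S], hence preserves the
    measures of superlevel sets. *)
Let Phi_radial_le y z : norm2 y = norm2 z -> norm2 y < b ->
  (\int[hm]_(x in S) (f y x)%:E <= \int[hm]_(x in S) (f z x)%:E)%E.
Proof.
move=> yz yb; have zb : norm2 z < b by rewrite -yz.
rewrite -[leRHS]mul1e.
apply: (le_integral_superlevel (M := b ^+ 2 * (b - norm2 y) ^- m.+1)) => //.
- exact: mf.
- exact: mf.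
- by move=> x Sx; rewrite f_ge0// f_le.
- by move=> x Sx; rewrite f_ge0.
move=> t t0; pose T x := c + reflection (y - z) (x - c).
have Tc x : T x - c = reflection (y - z) (x - c) by rewrite /T addrC addKr.
have TK x : T (T x) = x by rewrite {1}/T Tc reflectionK addrC subrK.
have ST x : S x -> S (T x) by rewrite /sphere2/= Tc norm2_reflection.
have fT x : f z (T x) = f y x.
  have -> : f z (T x) = (b ^+ 2 - norm2 z ^+ 2) * norm2 (reflection (y - z) (y - pole x)) ^- m.+1.
    by rewrite reflectionB reflection_swap// reflectionZ -Tc.
  by rewrite norm2_reflection -yz.
pose D u : set E := S `&` [set x | t <= f u x].
change (hausdorff m.+1 m (D y)
  <= 1%:E * hausdorff m.+1 m (D z))%E.
apply: (@le_trans _ _ (hausdorff m.+1 m [set T x | x in D z])).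
  apply: le_hausdorff => x [Sx /= tx]; exists (T x); last exact: TK.
  by split; [exact: ST|rewrite /= fT].
have Tlip x x' : D z x -> D z x' -> norm2 (x - x') < 1 ->
    norm2 (T x - T x') <= 1 * norm2 (x - x').
  move=> _ _ _; rewrite mul1r /T opprD addrACA subrr add0r -reflectionB.
  by rewrite norm2_reflection opprB addrA subrK.
have := hausdorff_lipschitz_image (s := m) ltr01 ltr01 Tlip.
by rewrite expr1n.
Qed.

Let Phi_radial y z : norm2 y = norm2 z -> norm2 y < b -> Phi y = Phi z.
Proof.
move=> yz yb; congr fine; apply: le_anti; apply/andP; split.
  exact: Phi_radial_le.
by apply: Phi_radial_le; rewrite -yz.
Qed.

Let f_poisson y x : S x -> norm2 y < b -> f y x = poisson (pole x) (y - pole x).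
Proof.
move=> Sx yb; rewrite poissonE// ?norm_pole ?subrK//.
by rewrite -norm2_gt0; apply: lt_le_trans (dist_pole y Sx); rewrite subr_gt0.
Qed.

Local Notation step := (step b).
Local Notation diff2 := (diff2 b).

Let norm_step y (t : R) i : norm2 y < b -> `|t| <= (b - norm2 y) / 2 ->
  norm2 (y + t *: e_ i) <= b - (b - norm2 y) / 2.
Proof.
move=> yb tb; apply: le_trans (norm2D _ _) _.
by rewrite norm2Z norm2_basis mulr1; lra.
Qed.

Let diff2_f y x k : S x -> norm2 y < b ->
  exists2 u : 'I_m.+1 -> R, (forall i, 0 < u i < step y k) &
  diff2 (f ^~ x) y k = \sum_i ((poisson2 (pole x) i i (y - pole x + u i *: e_ i) +
    poisson2 (pole x) i i (y - pole x - u i *: e_ i)) / 2).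
Proof.
move=> Sx yb; have h0 := step_gt0 k yb; have h1 := step_le k yb.
set h := step y k in h0 h1 *; pose w := y - pole x.
have tb i (t : R) : - h <= t <= h -> norm2 (y + t *: e_ i) < b.
  move=> th; apply: le_lt_trans (norm_step i yb _) _.
    by rewrite (le_trans _ h1)// ler_norml.
  by rewrite ltrBlDr ltrDl divr_gt0// subr_gt0.
have ne i (t : R) : - h <= t <= h -> t *: e_ i + w != 0.
  move=> /(tb i) tb'; rewrite -norm2_gt0 /w addrA (addrC _ y).
  by apply: lt_le_trans (dist_pole _ Sx); rewrite subr_gt0.
have [u uP] : {u : 'I_m.+1 -> R & forall i, 0 < u i < h /\
    h ^- 2 * (f (y + h *: e_ i) x + f (y - h *: e_ i) x - 2 * f y x) =
    (poisson2 (pole x) i i (w + u i *: e_ i) + poisson2 (pole x) i i (w - u i *: e_ i)) / 2}.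
  apply: (@choice _ _ (fun i c => 0 < c < h /\
    h ^- 2 * (f (y + h *: e_ i) x + f (y - h *: e_ i) x - 2 * f y x) =
    (poisson2 (pole x) i i (w + c *: e_ i) + poisson2 (pole x) i i (w - c *: e_ i)) / 2)) => i.
  have [||q qh Eq] := @second_difference R
    (fun t : R => poisson (pole x) (t *: e_ i + w)) (fun t : R => poisson1 (pole x) i (t *: e_ i + w))
    (fun t : R => poisson2 (pole x) i i (t *: e_ i + w)) h h0.
  - by move=> t th; apply: is_derive_along_line; apply: is_derive_poisson => //; exact: ne.
  - by move=> t th; apply: is_derive_along_line; apply: is_derive_poisson1; exact: ne.
  exists q; split => //.
  have hh : - h <= h <= h by apply/andP; split => //; lra.
  have hNh : - h <= - h <= h by apply/andP; split => //; lra.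
  rewrite !f_poisson//; [|by rewrite -scaleNr; exact: tb|exact: tb].
  have ew (t : E) : y + t - pole x = w + t by rewrite /w addrAC.
  rewrite !ew -/w -(scaleNr h) -(scaleNr q).
  move: Eq; rewrite scale0r add0r !(addrC _ w) => ->.
  by rewrite mulKf// expf_neq0// gt_eqF.
exists u; first by move=> i; case: (uP i).
by apply: eq_bigr => i _; case: (uP i).
Qed.

Let diff2_f_bound y : norm2 y < b ->
  exists C : R, forall k x, S x -> `|diff2 (f ^~ x) y k| <= C.
Proof.
move=> yb; have a0 : 0 < (b - norm2 y) / 2 by rewrite divr_gt0// subr_gt0.
have [C CP] := @poisson2_bound R m ((b - norm2 y) / 2) b a0 b0.
exists (\sum_(i < m.+1) C) => k x Sx; have [u u_in ->] := diff2_f k Sx yb.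
apply: le_trans (ler_norm_sum _ _ _) _; apply: ler_sum => i _.
have /andP[u0 uh] := u_in i; have us := le_trans (ltW uh) (step_le k yb).
have far (t : R) : `|t| <= (b - norm2 y) / 2 ->
    (b - norm2 y) / 2 <= norm2 (y - pole x + t *: e_ i).
  move=> tb; rewrite addrAC; apply: le_trans (dist_pole _ Sx).
  by rewrite lerBrDr -lerBrDl; exact: norm_step.
have B (t : R) : `|t| <= (b - norm2 y) / 2 ->
    `|poisson2 (pole x) i i (y - pole x + t *: e_ i)| <= C.
  by move=> tb; apply: CP; [exact: norm_pole|exact: far].
have B1 := B (u i); have B2 := B (- u i).
rewrite normrN scaleNr (gtr0_norm u0) in B1 B2 *.
rewrite normrM (ger0_norm (_ : 0 <= 2^-1 :> R))// ler_pdivrMr//.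
rewrite mulr_natr mulr2n (le_trans (ler_normD _ _))// lerD//; [exact: B1|exact: B2].
Qed.

Let diff2_f_cvg y x : S x -> norm2 y < b -> diff2 (f ^~ x) y k @[k --> \oo] --> 0.
Proof.
move=> Sx yb; pose w := y - pole x.
have w0 : w != 0.
  by rewrite -norm2_gt0; apply: lt_le_trans (dist_pole y Sx); rewrite subr_gt0.
apply/cvgrPdist_lt => e e0; pose e' := e / m.+2%:R.
have e'0 : 0 < e' by rewrite divr_gt0.
have [eta eta0 etaP] : exists2 eta : R, 0 < eta & forall i u, norm2 (u - w) < eta ->
    `|poisson2 (pole x) i i w - poisson2 (pole x) i i u| < e'.
  have /nbhs_norm2[eta eta0 etaP] : \forall u \near w, forall i,
      `|poisson2 (pole x) i i w - poisson2 (pole x) i i u| < e'.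
    apply: (@filter_forall _ _ _ _ (nbhs_filter w)) => i.
    have c2 := @continuous_poisson2 R m (pole x) i i w w0.
    by move/(cvgrPdist_lt (FF := nbhs_filter w)): c2 => /(_ e' e'0).
  by exists eta => // i u /etaP.
have /(cvgrPdist_lt _ _)/(_ eta eta0) := step_cvg b y.
apply: filterS => k; rewrite sub0r normrN (gtr0_norm (step_gt0 k yb)) => hk.
have [u u_in ->] := diff2_f k Sx yb.
rewrite -[X in X - _](sum_poisson2 (pole x) m0 w0) -sumrB.
apply: le_lt_trans (ler_norm_sum _ _ _) _.
apply: (@le_lt_trans _ _ (\sum_(i < m.+1) e')); last first.
  by rewrite sumr_const card_ord -mulr_natr /e' -mulrA gtr_pMr// mulrC ltr_pdivrMr// mul1r ltr_nat.
apply: ler_sum => i _; have /andP[u0 uh] := u_in i.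
have nu : norm2 (u i *: e_ i) < eta.
  by rewrite norm2Z norm2_basis mulr1 (gtr0_norm u0) (lt_trans uh).
have := etaP i (w + u i *: e_ i); rewrite addrC addKr => /(_ nu).
have := etaP i (w - u i *: e_ i); rewrite addrC addKr norm2N => /(_ nu).
rewrite -/w.
move: (poisson2 (pole x) i i w) (poisson2 (pole x) i i (w - u i *: e_ i))
  (poisson2 (pole x) i i (w + u i *: e_ i)) => A B C.
by rewrite !ltr_norml ler_norml => /andP[B1 B2] /andP[C1 C2]; apply/andP; split; lra.
Qed.

Let diff2_Phi_cvg y : norm2 y < b -> diff2 Phi y k @[k --> \oo] --> 0.
Proof.
move=> yb.
have stepb k i : norm2 (y + step y k *: e_ i) < b /\ norm2 (y - step y k *: e_ i) < b.
  have h0 := step_gt0 k yb; have h1 := step_le k yb.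
  have nb (t : R) : `|t| <= (b - norm2 y) / 2 -> norm2 (y + t *: e_ i) < b.
    move=> tb; apply: le_lt_trans (norm_step i yb tb) _.
    by rewrite ltrBlDr ltrDl divr_gt0// subr_gt0.
  split; last rewrite -scaleNr; apply: nb; by rewrite ?normrN gtr0_norm.
have mterm k i : measurable_fun (S : set (caratheodory_type (hausdorff m.+1 m)))
    (fun x => (step y k) ^- 2 * (f (y + step y k *: e_ i) x + f (y - step y k *: e_ i) x - 2 * f y x)).
  have [b1 b2] := stepb k i.
  apply: measurable_funM; first exact: measurable_cst.
  apply: measurable_funB; first by apply: measurable_funD; exact: mf.
  by apply: measurable_funM; [exact: measurable_cst|exact: mf].
have -> : diff2 Phi y = fun k => Rintegral hm S (fun x => diff2 (f ^~ x) y k).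
  apply/funext => k; have t1 i := fi (stepb k i).1; have t2 i := fi (stepb k i).2.
  have t0 := fi yb.
  have i0 : hm.-integrable S (EFin \o (fun x => 2 * f y x)).
    exact: integrable_scaleR.
  have i12 i : hm.-integrable S (EFin \o (fun x => f (y + step y k *: e_ i) x + f (y - step y k *: e_ i) x)).
    exact: integrable_addR.
  have i3 i : hm.-integrable S (EFin \o (fun x => f (y + step y k *: e_ i) x + f (y - step y k *: e_ i) x - 2 * f y x)).
    exact: integrable_subR.
  rewrite /diff2 Rintegral_sum//; last by move=> i; exact: integrable_scaleR.
  apply: eq_bigr => i _.
  by rewrite RintegralZl// RintegralB// RintegralD// RintegralZl.
have [C CP] := diff2_f_bound yb.
apply: (@bounded_Rintegral_cvg0 _ _ _ hm S (fun k x => diff2 (f ^~ x) y k) C mS Sfin).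
- by move=> k; apply: measurable_sum => i; exact: mterm.
- by move=> k x; exact: CP.
- by move=> x Sx; exact: diff2_f_cvg.
Qed.

Local Notation dir := (basis_vec ord0 : E).

Let Phi_continuous (q : R) : 0 <= q <= r -> {for q, continuous (fun s : R => Phi (s *: dir))}.
Proof.
pose r' := (r + b) / 2; have rr' : r < r' by have := rb; rewrite /r'; lra.
have r'b : r' < b by have := rb; rewrite /r'; lra.
have H : {in (`] (- r'), r'[%classic : set R), continuous (fun s : R => Phi (s *: dir))}.
  have inI (s : R) : (`] (- r'), r'[%classic : set R) s -> norm2 (s *: dir) <= r'.
    by rewrite /= in_itv/= norm_dir ler_norml => /andP[/ltW -> /ltW ->].
  have inI' (s : R) : (`] (- r'), r'[%classic : set R) s -> norm2 (s *: dir) < b.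
    by move=> /inI h; exact: le_lt_trans r'b.
  apply: (@continuity_under_integral R _ _ hm (fun s x => f (s *: dir) x) S mS (- r') r'
    _ _ (cst (b ^+ 2 * (b - r') ^- m.+1))).
  - by move=> s Is; apply: fi; exact: inI'.
  - apply: aeW => x Sx s; rewrite inE => Is.
    have ne : s *: dir - pole x != 0.
      by rewrite -norm2_gt0; apply: lt_le_trans (dist_pole _ Sx); rewrite subr_gt0 inI'.
    have cdir : {for s, continuous (fun s : R => s *: dir)} by exact: scalel_continuous.
    have c1 : {for s, continuous (fun s : R => norm2 (s *: dir) ^+ 2)}.
      apply: (continuous_comp (f := fun s : R => norm2 (s *: dir)) (g := fun t : R => t ^+ 2)).
        by apply: continuous_comp; [exact: cdir|exact: continuous_norm2].
      exact: exprn_continuous.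
    have c2 : {for s, continuous (fun s : R => norm2 (s *: dir - pole x) ^- m.+1)}.
      apply: (continuous_comp (f := fun s : R => s *: dir - pole x) (g := fun w : E => norm2 w ^- m.+1)).
        by apply: continuousB; [exact: cdir|exact: cst_continuous].
      exact: continuous_norm2V.
    have c3 : {for s, continuous (fun s : R => b ^+ 2 - norm2 (s *: dir) ^+ 2)}.
      by apply: continuousB; [exact: cst_continuous|exact: c1].
    exact: (continuousM c3 c2).
  - have mc : measurable_fun (S : set (caratheodory_type (hausdorff m.+1 m)))
        (cst (b ^+ 2 * (b - r') ^- m.+1) : _ -> R) by exact: measurable_cst.
    have := bounded_integrable mS Sfin mc (M := `|b ^+ 2 * (b - r') ^- m.+1|).
    by apply=> x _; exact: lexx.
  move=> s Is; apply: aeW => x Sx; have sb := inI' s Is.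
  have r'0 : 0 < b - r' by rewrite subr_gt0.
  have sr : norm2 (s *: dir) <= b - (b - r') by rewrite subKr; exact: inI.
  by have /andP[f0 f1] := f_bound r'0 sr Sx; rewrite ger0_norm.
move=> /andP[s0 sr].
by apply: H; rewrite inE/= in_itv/=; apply/andP; split; lra.
Qed.

Let Phi_center : Phi 0 = Phi (r *: dir).
Proof. exact: (radial_mean_value r0 rb Phi_radial Phi_continuous diff2_Phi_cvg). Qed.

(** As [dist_swap_radii] exchanges the pole and the variable, this integral is the
    harmonic radial function [Phi] at radius [r], equal to its value at the centre. *)
Lemma sphere_poisson_mean (p : E) : norm2 (p - c) = b ->
  Rintegral hm S (fun x => (b ^+ 2 - r ^+ 2) * norm2 (x - p) ^- m.+1) =
  b ^+ 2 * b ^- m.+1 * fine (hm S).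
Proof.
move=> pb; pose y := (r / b) *: (p - c).
have ny : norm2 y = r by exact: (norm2_rescale r0 b0 pb).
have -> : Rintegral hm S (fun x => (b ^+ 2 - r ^+ 2) * norm2 (x - p) ^- m.+1) = Phi y.
  apply: eq_Rintegral => x /set_mem Sx; rewrite /f ny; congr (_ * _ ^- _).
  rewrite (dist_swap_radii r0 b0 Sx pb); congr norm2.
  by rewrite opprB addrA subrK.
have yr : norm2 y = norm2 (r *: dir) by rewrite norm_dir ny gtr0_norm.
have yb : norm2 y < b by rewrite ny.
rewrite (Phi_radial yr yb) -Phi_center.
rewrite -(Rintegral_cst hm mS (b ^+ 2 * b ^- m.+1)).
apply: eq_Rintegral => x /set_mem Sx; rewrite /f norm20 expr0n subr0 sub0r norm2N.
by rewrite (norm_pole Sx).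
Qed.

End SphereMeanValue.

(** * The boundary near the touching point *)

(** The left-hand side is the size of the [j]-th term of the dyadic decomposition
    with [s = 2^-j] and [t = b - r]; its sum over [j] is bounded uniformly in [t]. *)
Lemma poisson_telescope (F : realFieldType) (t s : F) : 0 < t -> 0 < s ->
  t * s / (t + s / 4) ^+ 2 <= 8 * (t / (t + s / 2 / 4) - t / (t + s / 4)).
Proof.
move=> t0 s0; set u := t + s / 4; set v := t + s / 2 / 4.
have u0 : 0 < u by rewrite /u; lra.
have v0 : 0 < v by rewrite /v; lra.
have uv : v <= u by rewrite /u /v; lra.
have -> : 8 * (t / v - t / u) = t * s / (u * v).
  have -> : s = 8 * (u - v) by rewrite /u /v; lra.
  by field; rewrite !gt_eqF.
rewrite ler_wpM2l ?mulr_ge0 ?(ltW t0) ?(ltW s0)//.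
by rewrite lef_pV2 ?posrE ?mulr_gt0 ?exprn_gt0// expr2 ler_wpM2l// ltW.
Qed.

(** The supremum of the kernel times the area of a dyadic shell of radius [s],
    reduced to the form summed by [poisson_telescope]. *)
Lemma shell_bound (F : realFieldType) (m : nat) (t s r b L : F) : (0 < m)%N ->
    0 < s -> 0 <= r -> 0 <= L -> r < b < r + 1 -> t = b - r ->
  (b ^+ 2 - r ^+ 2) * (((t + s / 4) / 4) ^- m.+1 * ((1 + L) * s) ^+ m) <=
  (2 * r + 1) * 4 ^+ m.+1 * (1 + L) ^+ m * 4 ^+ m.-1 * (t * s / (t + s / 4) ^+ 2).
Proof.
move=> m0 s0 r0 L0 /andP[rb b1] tE; set u := t + s / 4.
have t0 : 0 < t by rewrite tE subr_gt0.
have u0 : 0 < u by rewrite /u; lra.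
have [k mk] : exists k, m = k.+1 by exists m.-1; rewrite prednK.
have -> : b ^+ 2 - r ^+ 2 = t * (b + r) by rewrite subr_sqr tE.
have K0 : 0 <= 1 + L by rewrite addr_ge0.
rewrite mk /= !exprMn exprVn invfM invrK; move: (1 + L) K0 => K K0.
have su : s ^+ k <= (4 * u) ^+ k.
  by rewrite lerXn2r ?nnegrE ?mulr_ge0 ?(ltW u0) ?(ltW s0)// /u; lra.
have uk : 0 < u ^+ k by rewrite exprn_gt0.
have pos x i : 0 < x -> 0 <= x ^+ i :> F by move=> x0; rewrite exprn_ge0// ltW.
have i1 : 0 <= u ^- k.+2 by rewrite invr_ge0 exprn_ge0// ltW.
have i2 : 0 <= 4 ^+ k.+2 :> F by rewrite exprn_ge0.
have i3 : 0 <= K ^+ k.+1 by rewrite exprn_ge0.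
have sk : 0 <= s ^+ k by rewrite exprn_ge0// ltW.
apply: (@le_trans _ _ (t * (2 * r + 1) * (u ^- k.+2 * 4 ^+ k.+2 * (K ^+ k.+1 * (s * (4 * u) ^+ k))))).
  apply: ler_pM.
  - by rewrite mulr_ge0 ?(ltW t0)//; lra.
  - by apply: mulr_ge0; [exact: mulr_ge0|exact: mulr_ge0 i3 (exprn_ge0 _ (ltW s0))].
  - by rewrite ler_wpM2l ?(ltW t0)//; lra.
  - rewrite ler_wpM2l ?(mulr_ge0 i1 i2)// ler_wpM2l// [s ^+ k.+1]exprS ler_wpM2l//.
    exact: ltW.
rewrite le_eqVlt; apply/orP; left; apply/eqP.
rewrite exprMn [u ^+ k.+2]exprS [u ^+ k.+1]exprS.
move: (u ^+ k) uk (4 ^+ k) (4 ^+ k.+2) (K ^+ k.+1) => U U0 A B D; field.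
by rewrite !gt_eqF.
Qed.

Lemma exp2V_lt (R : realType) (t : R) : 0 < t ->
  exists i, forall j, (i <= j)%N -> 2 ^- j < t.
Proof.
move=> t0; have := @cvg_geometric R 1 (2^-1); rewrite ger0_norm// => /(_ _)/cvgrPdist_lt.
move=> /(_ _ t t0)[|i _ iP]; first by lra.
exists i => j ij; have := iP j ij; rewrite /= sub0r normrN mul1r exprVn.
by rewrite ger0_norm// invr_ge0 exprn_ge0.
Qed.

Section LocalGraph.
Context {R : realType} {m : nat}.
Local Notation E := 'rV[R]_m.+1.
Local Notation hm := (@hausdorff_measure R m.+1 m).
Implicit Types (x p q : E) (y u xi : 'rV[R]_m).

Variables (c z : E) (r rB L lam : R) (psi : 'rV[R]_m -> R) (a : 'rV[R]_m).
Local Notation z' := (head_coords z).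
Local Notation B := (ball2 z' rB).

(** The slope of [psi] between [y] and nearby points is within [e] of [a]. *)
Definition flat_at (e : R) y := exists2 d : R, 0 < d &
  forall u, norm2 (u - y) < d -> `|psi u - psi y - dot a (u - y)| <= e * norm2 (u - y).

Hypotheses (m0 : (0 < m)%N) (r0 : 0 < r) (zc : norm2 (z - c) = r).
Hypotheses (rB0 : 0 < rB) (lam0 : 0 < lam) (L0 : 0 <= L).
Hypotheses (normal_head : head_coords (z - c) = - lam *: a)
  (normal_last : last_coord (z - c) = lam).
Hypothesis psi_z : psi z' = last_coord z.
Hypothesis psi_lip : forall y u, B y -> B u -> `|psi y - psi u| <= L * norm2 (y - u).
Hypothesis flat_z : forall e, 0 < e -> flat_at e z'.
Hypothesis flat_ray : forall e, 0 < e -> hausdorff m m [set xi |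
  ~ exists2 t0 : R, 0 < t0 & forall t, 0 < t < t0 -> flat_at e (z' + t *: xi)] = 0%E.

Let Bz : B z'. Proof. by rewrite /ball2/= subrr norm20. Qed.

Let psi_continuous y : B y -> {for y, continuous psi}.
Proof.
move=> By; apply/(cvgrPdist_lt (FF := nbhs_filter y)) => e e0.
have nB : nbhs y B by apply: open_nbhs_nbhs; split => //; exact: open_ball2.
have /nbhs_norm2[d d0 dP] := nB; have L1 : 0 < L + 1 by rewrite ltr_wpDl.
apply/nbhs_norm2; exists (Num.min d (e / (L + 1))).
  by rewrite lt_min d0 divr_gt0.
move=> u; rewrite lt_min => /andP[ud]; rewrite ltr_pdivlMr// norm2_distC => ue.
apply: le_lt_trans (psi_lip By (dP _ ud)) _; apply: le_lt_trans ue.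
by rewrite mulrC ler_wpM2l ?norm2_ge0// lerDl.
Qed.

(** ** Points where the graph is not almost parallel to the tangent plane *)

(** The slope bound of [flat_at e] fails at scale [1 / (k + 1)]: an open condition
    on [y], which would be lost if the scale were not fixed. *)
Definition steep (e : R) (k : nat) : set 'rV[R]_m :=
  [set y | B y /\ exists u, [/\ B u, norm2 (u - y) < k.+1%:R^-1 &
    e * norm2 (u - y) < `|psi u - psi y - dot a (u - y)| ]].

(** Points where [flat_at e] fails; a countable intersection of open sets, hence
    measurable. *)
Definition rough (e : R) : set 'rV[R]_m := \bigcap_k steep e k.

Lemma open_steep e k : open (steep e k).
Proof.
rewrite openE => y [By [u [Bu uy slope]]].
have c1 : {for y, continuous (fun y => norm2 (u - y))}.
  apply: (continuous_comp (f := fun y : 'rV[R]_m => u - y)); last exact: continuous_norm2.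
  by apply: continuousB; [exact: cst_continuous|move=> A; exact].
have c2 : {for y, continuous (fun y => `|psi u - psi y - dot a (u - y)| - e * norm2 (u - y))}.
  apply: continuousB; last by apply: continuousM; [exact: cst_continuous|exact: c1].
  apply: (continuous_comp (f := fun y : 'rV[R]_m => psi u - psi y - dot a (u - y))); last first.
    exact: norm_continuous.
  apply: continuousB.
    by apply: continuousB; [exact: cst_continuous|exact: psi_continuous].
  rewrite (_ : (fun y => dot a (u - y)) = (fun y => dot (u - y) a)); last first.
    by apply/funext => v; rewrite dotC.
  apply: (continuous_comp (f := fun y : 'rV[R]_m => u - y) (g := fun v => dot v a)).
    by apply: continuousB; [exact: cst_continuous|move=> A; exact].
  exact: continuous_dotl.
have nB : nbhs y B by apply: open_nbhs_nbhs; split => //; exact: open_ball2.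
have n1 := cvgr_lt (FF := nbhs_filter y) _ c1 _ uy.
have s0 : 0 < `|psi u - psi y - dot a (u - y)| - e * norm2 (u - y) by rewrite subr_gt0.
have n2 := cvgr_gt (FF := nbhs_filter y) _ c2 _ s0.
apply: filterS3 nB n1 n2 => v Bv v1 v2; split => //; exists u; split => //.
by rewrite -subr_gt0.
Qed.

Lemma le_steep e j k : (j <= k)%N -> steep e k `<=` steep e j.
Proof.
move=> jk y [By [u [Bu uy s]]]; split => //; exists u; split => //.
by apply: lt_le_trans uy _; rewrite lef_pV2 ?posrE// ler_nat.
Qed.

Lemma flat_not_rough e y : flat_at e y -> ~ rough e y.
Proof.
move=> [d d0 dP] ry; have [k kd] := ltr_add_invr d0; rewrite add0r in kd.
have [_ [u [_ uy s]]] := ry k I.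
by have := lt_le_trans s (dP u (lt_trans uy kd)); rewrite ltxx.
Qed.

Lemma cara_measurable_rough_preimage (T : nat) (s : nat) (g : 'rV[R]_T -> 'rV[R]_m) e :
  continuous g ->
  (@hausdorff R T s).-cara.-measurable (g @^-1` rough e).
Proof.
move=> cg; rewrite /rough preimage_bigcap; apply: bigcapT_measurable => k.
apply: open_cara_measurable; apply: open_comp => [x _|]; first exact: cg.
exact: open_steep.
Qed.

Let annulus : set 'rV[R]_m := [set xi | 2^-1 <= norm2 xi < 1].

(** The rough points of the shell of radius about [2 ^- j], rescaled to unit size. *)
Let rough_dir e j : set 'rV[R]_m :=
  annulus `&` [set xi | rough e (z' + (2 ^- j) *: xi)].

Let measurable_annulus : (@hausdorff R m m).-cara.-measurable annulus.
Proof.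
rewrite (_ : annulus = ball2 0 1 `\` ball2 0 2^-1); last first.
  rewrite predeqE => xi; rewrite /annulus /ball2 /= subr0; split.
    by move=> /andP[x1 x2]; split=> //; apply/negP; rewrite -leNgt.
  by move=> [x2 /negP]; rewrite -leNgt => x1; rewrite x1.
by apply: measurableD; apply: open_cara_measurable; exact: open_ball2.
Qed.

Let hausdorff_annulus_fin : (hausdorff m m annulus < +oo)%E.
Proof.
apply: (@le_lt_trans _ _ (hausdorff m m (box (\row_(i < m) -1 : 'rV[R]_m) (\row_(i < m) 1)))).
  apply: le_hausdorff => xi /andP[_ xi1] i; rewrite !mxE -ler_norml.
  exact: le_trans (coord_le_norm2 _ _) (ltW xi1).
apply: le_lt_trans (hausdorff_box _) (ltry _).
by move=> i; rewrite !mxE; lra.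
Qed.

Let measurable_rough_dir e j : (@hausdorff R m m).-cara.-measurable (rough_dir e j).
Proof.
apply: measurableI; first exact: measurable_annulus.
apply: (@cara_measurable_rough_preimage m m (fun xi => z' + (2 ^- j) *: xi)).
move=> xi.
have c1 : {for xi, continuous (fun x : 'rV[R]_m => (2 ^- j : R) *: x)} by exact: scaler_continuous.
have c2 : {for xi, continuous (fun x : 'rV[R]_m => z')} by exact: cst_continuous.
exact: (continuousD c2 c1).
Qed.

(** Almost every ray from [z'] meets the rough set only away from [z'], so by
    continuity of the measure the rough part of small annuli is negligible. *)
Lemma rough_dir_small e kap : 0 < e -> 0 < kap ->
  exists J, forall j, (J <= j)%N -> (hausdorff m m (rough_dir e j) <= kap%:E)%E.
Proof.
move=> e0 kap0; pose hmm : {measure set (caratheodory_type (@hausdorff R m m)) -> \bar R} := hausdorff_measure m m.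
pose U i := \bigcup_(j in [set j | (i <= j)%N]) rough_dir e j.
have mU i : (@hausdorff R m m).-cara.-measurable (U i).
  by apply: bigcup_measurable => j _; exact: measurable_rough_dir.
have cvgU : hmm (U i) @[i --> \oo] --> hmm (\bigcap_i U i).
  apply: nonincreasing_cvg_mu => //.
  - apply: le_lt_trans hausdorff_annulus_fin; apply: le_hausdorff.
    by move=> xi [j _ []].
  - exact: bigcapT_measurable.
  - move=> i j ij; apply/subsetPset => xi [k /= jk Kk].
    by exists k => //=; exact: leq_trans jk.
have capU : hmm (\bigcap_i U i) = 0%E.
  apply/eqP; rewrite eq_le hausdorff_ge0 andbT -(flat_ray e0).
  apply: le_hausdorff => xi Uxi [t0 t00 tP].
  have [i it0] : exists i, forall j, (i <= j)%N -> 2 ^- j < t0 :> R.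
    exact: exp2V_lt.
  have [j /= ij [_ /=]] := Uxi i I; apply: flat_not_rough; apply: tP.
  by rewrite it0// invr_gt0 exprn_gt0.
rewrite capU in cvgU.
have /fine_cvgP[_] : hmm (U i) @[i --> \oo] --> 0%:E by [].
move=> /cvgrPdist_lt/(_ kap kap0)[J _ JP]; exists J => j Jj.
have Ufin : (hmm (U J) \is a fin_num).
  rewrite ge0_fin_numE ?hausdorff_ge0//.
  apply: le_lt_trans hausdorff_annulus_fin; apply: le_hausdorff.
  by move=> xi [k _ []].
apply: (@le_trans _ _ (hmm (U J))); first by apply: le_hausdorff => xi Kxi; exists j.
have := JP J (leqnn J); rewrite /= sub0r normrN => h.
by rewrite -[leLHS](fineK Ufin) lee_fin (le_trans (ler_norm _))// ltW.
Qed.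

(** ** Comparison with the sphere *)

Local Notation S := (sphere2 c r).

Let Sz : S z. Proof. exact: zc. Qed.

Lemma dot_normal x : dot x (z - c) = lam * (last_coord x - dot a (head_coords x)).
Proof.
by rewrite dot_split normal_head normal_last dotZr (dotC a); ring.
Qed.

(** Chords of the sphere with ends near [z] are almost orthogonal to the normal
    [z - c]: [p - q] is orthogonal to the midpoint of [p - c] and [q - c]. *)
Lemma sphere_chord (p q : E) : S p -> S q ->
  `|dot (p - q) (z - c)| <= norm2 (p - q) * ((norm2 (p - z) + norm2 (q - z)) / 2).
Proof.
move=> Sp Sq; have e2 : dot (p - q) (z - c) = dot (q - p) (p - z + (q - z)) / 2.
  have : dot (p - q) (p - c + (q - c)) = 0.
    have gen (u v : E) : dot (u - v) (u + v) = norm2 u ^+ 2 - norm2 v ^+ 2.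
      by rewrite dotBl !dotDr (dotC v) !norm2_sq; ring.
    rewrite (_ : p - q = (p - c) - (q - c)); last by rewrite opprB addrA subrK.
    by rewrite gen (Sp : norm2 (p - c) = r) (Sq : norm2 (q - c) = r) subrr.
  by rewrite !(dotDl, dotNl, dotDr, dotNr); lra.
rewrite e2 normrM [`|2^-1|]ger0_norm// mulrA ler_pM2r//.
apply: le_trans (cauchy_schwarz_abs _ _) _.
by rewrite norm2_distC ler_wpM2l ?norm2_ge0// norm2D.
Qed.

(** The point of the upper half of the sphere above [y]. *)
Definition cap_point y : E :=
  graph_point y (last_coord c + Num.sqrt (r ^+ 2 - norm2 (y - head_coords c) ^+ 2)).

Lemma cap_point_near : exists C d : R, [/\ 0 < C, 0 < d & forall y, norm2 (y - z') < d ->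
  S (cap_point y) /\ norm2 (cap_point y - z) <= C * norm2 (y - z')].
Proof.
pose K := 2 * r + 1; have K0 : 0 < K by rewrite /K; have := r0; lra.
pose h := z' - head_coords c.
have hE : norm2 h ^+ 2 = r ^+ 2 - lam ^+ 2.
  rewrite -zc (norm2_split (z - c)) normal_last head_coordsB -/h; ring.
have hr : norm2 h <= r.
  by apply: ler_sqr_norm; [exact: ltW|rewrite hE gerBl sqr_ge0].
pose d := Num.min 1 (lam ^+ 2 / K); exists (1 + K / lam), d; split.
- by rewrite ltr_wpDr// divr_ge0// ltW.
- by rewrite lt_min ltr01 divr_gt0// exprn_gt0.
move=> y; rewrite lt_min => /andP[y1 yK]; rewrite ltr_pdivlMr// in yK.
set t := norm2 (y - z') in y1 yK *; have t0 : 0 <= t := norm2_ge0 _.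
pose g := y - head_coords c; have gh : `|norm2 g - norm2 h| <= t.
  apply: le_trans (norm2_lipschitz _ _) _.
  by rewrite /g /h opprB addrA subrK.
have g0 : 0 <= norm2 g := norm2_ge0 _; have h0 : 0 <= norm2 h := norm2_ge0 _.
have D : `|norm2 g ^+ 2 - norm2 h ^+ 2| <= t * K.
  rewrite subr_sqr normrM ler_pM// ger0_norm ?addr_ge0//.
  move: gh; rewrite ler_norml => /andP[_ gh]; rewrite /K.
  by lra.
pose A := r ^+ 2 - norm2 g ^+ 2.
have AE : `|A - lam ^+ 2| <= t * K.
  have -> : A - lam ^+ 2 = - (norm2 g ^+ 2 - norm2 h ^+ 2) by rewrite hE /A; ring.
  by rewrite normrN.
have A0 : 0 <= A.
  by move: AE yK; rewrite ler_norml => /andP[]; lra.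
have Sp : S (cap_point y).
  apply: (@pexpIrn _ 2) => //; rewrite ?nnegrE ?norm2_ge0 ?(ltW r0)//.
  rewrite norm2_split head_coordsB last_coordB head_graph_point last_graph_point.
  by rewrite (addrC (last_coord c)) addrK -/g -/A (sqr_sqrtr A0) /A addrC subrK.
split=> //; apply: le_trans (norm2_split_le _) _.
rewrite head_coordsB last_coordB head_graph_point last_graph_point -/t mulrDl mul1r lerD2l.
have -> : last_coord c + Num.sqrt (r ^+ 2 - norm2 (y - head_coords c) ^+ 2) - last_coord z =
    Num.sqrt A - lam.
  by rewrite -normal_last last_coordB -/g -/A; ring.
rewrite (_ : K / lam * t = t * K / lam); last by ring.
rewrite ler_pdivlMr//; apply: le_trans AE.
have sA : Num.sqrt A ^+ 2 = A by rewrite sqr_sqrtr.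
rewrite -[in leRHS]sA subr_sqr normrM ler_wpM2l//.
by rewrite ger0_norm ?addr_ge0 ?sqrtr_ge0 ?(ltW lam0)// lerDr sqrtr_ge0.
Qed.

(** At scales below [d], the graph and the cap of the sphere are [e]-close. *)
Definition fine_scale (e d : R) := d <= rB /\ forall y, norm2 (y - z') < d ->
  [/\ S (cap_point y), norm2 (cap_point y - z) <= lam * e &
      `|psi y - last_coord (cap_point y)| <= 2 * e * norm2 (y - z')].

Lemma fine_scale_ex e : 0 < e -> exists2 d, 0 < d & fine_scale e d.
Proof.
move=> e0; have [C [d1 [C0 d10 capP]]] := cap_point_near.
have [d2 d20 flatP] := flat_z e0.
pose d3 := lam * e / C; pose d4 := 2 * lam * e / C ^+ 2.
have d30 : 0 < d3 by rewrite divr_gt0 ?mulr_gt0.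
have d40 : 0 < d4 by rewrite divr_gt0 ?mulr_gt0 ?exprn_gt0.
pose d := Num.min rB (Num.min d1 (Num.min d2 (Num.min d3 d4))).
exists d; first by rewrite !lt_min rB0 d10 d20 d30 d40.
split=> [|y]; first by rewrite ge_min lexx.
rewrite !lt_min => /and5P[_ y1 y2 y3 y4]; have [Sp pz] := capP y y1.
have t0 := norm2_ge0 (y - z').
split=> //.
  apply: le_trans pz _; rewrite mulrC -ler_pdivlMr//; exact: ltW.
set p := cap_point y in Sp pz *.
have lastE : lam * (last_coord (p - z) - dot a (y - z')) = dot (p - z) (z - c).
  by rewrite dot_normal head_coordsB head_graph_point.
have chord : lam * `|last_coord (p - z) - dot a (y - z')| <= norm2 (p - z) ^+ 2 / 2.
  rewrite -[lam in leLHS]gtr0_norm// -normrM lastE.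
  by apply: le_trans (sphere_chord Sp Sz) _; rewrite subrr norm20 addr0 mulrA -expr2.
have {}chord : `|last_coord (p - z) - dot a (y - z')| <= e * norm2 (y - z').
  rewrite -(ler_pM2l lam0); apply: le_trans chord _.
  apply: (@le_trans _ _ ((C * norm2 (y - z')) ^+ 2 / 2)).
    by rewrite ler_pM2r// lerXn2r ?nnegrE ?norm2_ge0// mulr_ge0// ltW.
  have h : norm2 (y - z') * C ^+ 2 <= 2 * lam * e.
    by rewrite -ler_pdivlMr ?exprn_gt0// ltW.
  rewrite ler_pdivrMr// (_ : (C * norm2 (y - z')) ^+ 2 = norm2 (y - z') * C ^+ 2 * norm2 (y - z')); last by ring.
  by rewrite (_ : lam * _ * 2 = 2 * lam * e * norm2 (y - z')) ?ler_wpM2r//; ring.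
have := flatP y y2; rewrite psi_z => fl.
have -> : psi y - last_coord p =
    (psi y - last_coord z - dot a (y - z')) - (last_coord (p - z) - dot a (y - z')).
  by rewrite last_coordB; ring.
by rewrite (le_trans (ler_normB _ _))// -mulrA mulr_natl mulr2n lerD.
Qed.

Lemma fine_scaleW e d d' : d' <= d -> fine_scale e d -> fine_scale e d'.
Proof.
move=> dd' [dr h]; split; first exact: le_trans dr.
by move=> y yd; apply: h; exact: lt_le_trans dd'.
Qed.

(** ** The graph and the exterior pole *)

Definition lift y : E := graph_point y (psi y).

Definition graph (d : R) : set E :=
  [set x | norm2 (head_coords x - z') < d /\ last_coord x = psi (head_coords x)].

Definition pole (b : R) : E := c + (b / r) *: (z - c).

Lemma liftK x : last_coord x = psi (head_coords x) -> lift (head_coords x) = x.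
Proof. by move=> h; rewrite /lift -h graph_pointK. Qed.

Lemma lift_lipschitz y u : B y -> B u -> norm2 (lift y - lift u) <= (1 + L) * norm2 (y - u).
Proof.
move=> By Bu; apply: le_trans (norm2_split_le _) _.
rewrite head_coordsB last_coordB !head_graph_point !last_graph_point mulrDl mul1r.
by rewrite lerD2l psi_lip.
Qed.

Lemma pole_center b : 0 < b -> norm2 (pole b - c) = b.
Proof.
move=> b0; rewrite /pole addrC addKr norm2Z zc gtr0_norm ?divr_gt0//.
by rewrite divfK// gt_eqF.
Qed.

Lemma pole_dist b : r < b -> norm2 (pole b - z) = b - r.
Proof.
move=> rb; have -> : pole b - z = (b / r - 1) *: (z - c).
  by rewrite /pole scalerBl scale1r opprB addrCA addrA.
have br : b / r - 1 = (b - r) / r by rewrite mulrBl divff// gt_eqF.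
rewrite norm2Z zc br gtr0_norm ?divr_gt0 ?subr_gt0//.
by rewrite divfK// gt_eqF.
Qed.

Lemma sphere_pole_ge p b : S p -> r < b -> b - r <= norm2 (p - pole b).
Proof.
move=> Sp rb; have := norm2_lipschitz (pole b - c) (p - c).
rewrite pole_center ?(lt_trans r0)// (Sp : norm2 (p - c) = r) opprB addrA subrK norm2_distC.
by apply: le_trans; rewrite ler_norm.
Qed.

Lemma sphere_touch_le p b : S p -> r < b -> norm2 (p - z) <= 2 * norm2 (p - pole b).
Proof.
move=> Sp rb; have := sphere_pole_ge Sp rb.
have := norm2_triangle p (pole b) z; rewrite (pole_dist rb).
by lra.
Qed.

(** Comparing the graph with the cap loses only a factor [1 - 4 e] in the distance
    to the pole, because [sphere_touch_le] controls the distance to [z] by it. *)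
Lemma graph_pole_ge e d x b : 0 < e <= 8^-1 -> fine_scale e d -> graph d x -> r < b ->
  [/\ S (cap_point (head_coords x)),
     norm2 (head_coords x - z') <= norm2 (cap_point (head_coords x) - z) &
     (1 - 4 * e) * norm2 (cap_point (head_coords x) - pole b) <= norm2 (x - pole b)].
Proof.
move=> /andP[e0 e1] [_ fs] [xd xg] rb; set y := head_coords x in xd xg *.
have [Sp _ close] := fs y xd; set p := cap_point y in Sp close *.
have yp : norm2 (y - z') <= norm2 (p - z).
  by apply: le_trans (norm2_head_le _); rewrite head_coordsB head_graph_point.
split=> //.
have xp : norm2 (p - x) <= 2 * e * norm2 (y - z').
  apply: le_trans (norm2_split_le _) _; rewrite head_coordsB last_coordB.
  by rewrite head_graph_point -/y subrr norm20 add0r xg distrC.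
have pz := sphere_touch_le Sp rb.
have tri := norm2_triangle p x (pole b).
have : 2 * e * norm2 (y - z') <= 2 * e * (2 * norm2 (p - pole b)).
  by rewrite ler_wpM2l ?(le_trans yp)// mulr_ge0// ltW.
lra.
Qed.

Lemma measurable_graph d : d <= rB -> (@hausdorff R m.+1 m).-cara.-measurable (graph d).
Proof.
move=> dr; pose C := (@head_coords R m) @^-1` ball2 z' d.
have oC : open C by apply: open_comp => [x _|]; [exact: continuous_head|exact: open_ball2].
rewrite (_ : graph d = C `\` (C `&` [set x | last_coord x != psi (head_coords x)])); last first.
  rewrite predeqE => x; split.
    by move=> [xd xg]; split => // -[_ /=]; rewrite xg eqxx.
  move=> [Cx nx]; split=> //; apply/eqP; rewrite -[_ == _]negbK; apply/negP => h.
  by apply: nx; split.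
apply: measurableD; first exact: open_cara_measurable.
apply: open_cara_measurable; rewrite openE => x [Cx /= nx].
have Bx : B (head_coords x) by exact: lt_le_trans Cx dr.
have c1 : {for x, continuous (fun x : E => last_coord x - psi (head_coords x))}.
  apply: continuousB; first exact: continuous_last.
  by apply: (continuous_comp (f := @head_coords R m) (g := psi)); [exact: continuous_head|exact: psi_continuous].
have c2 : {for x, continuous (fun x : E => `|last_coord x - psi (head_coords x)|)}.
  by apply: (continuous_comp (g := fun t : R => `|t|)); [exact: c1|exact: norm_continuous].
have n0 : 0 < `|last_coord x - psi (head_coords x)| by rewrite normr_gt0 subr_eq0.
have n1 := cvgr_gt (FF := nbhs_filter x) _ c2 _ n0.
have n2 : nbhs x C by exact: open_nbhs_nbhs.
by apply: filterS2 n1 n2 => u /=; rewrite normr_gt0 subr_eq0.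
Qed.

Let head_rough e : set E := (@head_coords R m) @^-1` rough e.

Let measurable_head_rough e : (@hausdorff R m.+1 m).-cara.-measurable (head_rough e).
Proof. apply: cara_measurable_rough_preimage; exact: continuous_head. Qed.

Lemma hausdorff_ball_fin d : (hausdorff m m (ball2 z' d) < +oo)%E.
Proof.
have [d0|d0] := ltP d 0.
  rewrite (_ : ball2 z' d = set0) ?hausdorff0// -subset0 => y /= yd.
  by have := le_lt_trans (norm2_ge0 _) (lt_trans yd d0); rewrite ltxx.
apply: (@le_lt_trans _ _ (hausdorff m m (box (z' - const_mx d) (z' + const_mx d)))).
  apply: le_hausdorff => y /= yd i; rewrite !mxE.
  have := coord_le_norm2 (y - z') i; rewrite !mxE => /le_trans/(_ (ltW yd)).
  by rewrite ler_norml => /andP[]; lra.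
apply: le_lt_trans (hausdorff_box _) (ltry _).
by move=> i; rewrite !mxE; lra.
Qed.

Lemma hausdorff_graph_fin d : d <= rB -> (hm (graph d) < +oo)%E.
Proof.
move=> dr; have L1 : 0 < 1 + L by rewrite ltr_pwDl.
apply: (@le_lt_trans _ _ (hausdorff m.+1 m [set lift y | y in ball2 z' d])).
  by apply: le_hausdorff => x [xd xg]; exists (head_coords x) => //; exact: liftK.
apply: le_lt_trans (hausdorff_lipschitz_image (eta := 1) (L := 1 + L) _ _ _) _ => //.
  by move=> y u yd ud _; apply: lift_lipschitz; exact: lt_le_trans dr.
by rewrite lte_mul_pinfty ?lee_fin ?exprn_ge0 ?ltW ?hausdorff_ball_fin.
Qed.

Let kernel b x : R := norm2 (x - pole b) ^- m.+1.

Lemma measurable_kernel b (D : set E) : (@hausdorff R m.+1 m).-cara.-measurable D ->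
  ~ D (pole b) -> measurable_fun (D : set (caratheodory_type (@hausdorff R m.+1 m))) (kernel b).
Proof.
move=> mD Dp; apply: continuous_cara_measurable_fun => // x Dx.
have ne : x - pole b != 0 by apply/eqP => /subr0_eq xp; apply: Dp; rewrite -xp.
apply: (continuous_comp (f := fun x : E => x - pole b) (g := fun w : E => norm2 w ^- m.+1)).
  by apply: continuousB; [move=> A; exact|exact: cst_continuous].
exact: continuous_norm2V.
Qed.

Lemma kernel_ge0 b x : 0 <= kernel b x.
Proof. by rewrite /kernel invr_ge0 exprn_ge0// norm2_ge0. Qed.

Lemma kernel_le b x t : 0 < t -> t <= norm2 (x - pole b) -> kernel b x <= t ^- m.+1.
Proof.
move=> t0 tx; rewrite /kernel lef_pV2 ?posrE ?exprn_gt0//; last exact: lt_le_trans tx.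
by rewrite lerXn2r ?nnegrE ?(ltW t0)// norm2_ge0.
Qed.

Lemma sphere_avoids_pole b : r < b -> ~ S (pole b).
Proof.
move=> rb; rewrite /sphere2/= pole_center ?(lt_trans r0)// => br.
by rewrite br ltxx in rb.
Qed.

Lemma graph_avoids_pole e d b : 0 < e <= 8^-1 -> fine_scale e d -> r < b -> ~ graph d (pole b).
Proof.
move=> e01 fs rb gp; have [Sp _] := graph_pole_ge e01 fs gp rb.
have := sphere_pole_ge Sp rb; rewrite subrr norm20.
have br : 0 < b - r by rewrite subr_gt0.
move=> h1 h2; have : 0 < (1 - 4 * e) * norm2 (cap_point (head_coords (pole b)) - pole b).
  rewrite mulr_gt0//; last exact: lt_le_trans h1.
  by case/andP: e01; lra.
by rewrite ltNge h2.
Qed.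

(** Off the rough set, the vertical projection of the cap onto the graph is
    locally Lipschitz with a constant close to one. As it also nearly preserves
    the distance to the pole, it compares the superlevel sets of the kernel. *)
Lemma smooth_part e d b : 0 < e <= 8^-1 -> fine_scale e d -> r < b -> (hm S < +oo)%E ->
  (\int[hm]_(x in graph d `\` head_rough e) ((1 - 4 * e) ^+ m.+1 * kernel b x)%:E <=
   ((1 + 2 * e) ^+ m)%:E * \int[hm]_(x in S) (kernel b x)%:E)%E.
Proof.
move=> e01 fs rb Sfin; have /andP[e0 e1] := e01; have [dr fsP] := fs.
have mG := measurable_graph dr; have nGp := graph_avoids_pole e01 fs rb.
have q0 : 0 < 1 - 4 * e by lra.
have br : 0 < b - r by rewrite subr_gt0.
have far x : graph d x -> (1 - 4 * e) * (b - r) <= norm2 (x - pole b).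
  move=> gx; have [Sp _] := graph_pole_ge e01 fs gx rb; apply: le_trans.
  by rewrite ler_pM2l// sphere_pole_ge.
have mD : (@hausdorff R m.+1 m).-cara.-measurable (graph d `\` head_rough e).
  exact: measurableD.
have mkG : measurable_fun (graph d : set (caratheodory_type (@hausdorff R m.+1 m)))
    (fun x => (1 - 4 * e) ^+ m.+1 * kernel b x).
  by apply: measurable_funM; [exact: measurable_cst|exact: measurable_kernel].
apply: (@le_integral_superlevel _ _ _ _ _ hm hm (graph d `\` head_rough e) S
    (fun x => (1 - 4 * e) ^+ m.+1 * kernel b x) (kernel b)
    ((1 - 4 * e) ^+ m.+1 * ((1 - 4 * e) * (b - r)) ^- m.+1) ((1 + 2 * e) ^+ m) mD).
- exact/closed_cara_measurable/closed_sphere2.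
- apply: le_lt_trans (hausdorff_graph_fin dr); apply: le_hausdorff; exact: subDsetl.
- by apply: measurable_funS mkG => //; exact: subDsetl.
- apply: measurable_kernel; first exact/closed_cara_measurable/closed_sphere2.
  exact: sphere_avoids_pole.
- move=> x [gx _]; rewrite mulr_ge0 ?kernel_ge0 ?exprn_ge0 ?(ltW q0)//=.
  rewrite ler_wpM2l ?exprn_ge0 ?(ltW q0)// kernel_le ?far//.
  by rewrite mulr_gt0.
- by move=> x _; exact: kernel_ge0.
- by rewrite exprn_ge0// addr_ge0// mulr_ge0// ltW.
move=> t t0.
pose Gt := graph d `&` [set x | t <= (1 - 4 * e) ^+ m.+1 * kernel b x].
pose A k := Gt `\` (@head_coords R m) @^-1` steep e k.
have mA k : (@hausdorff R m.+1 m).-cara.-measurable (A k).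
  apply: measurableD; first by apply: measurable_fun_le => //; exact: measurable_cst.
  apply: open_cara_measurable; apply: open_comp => [x _|]; first exact: continuous_head.
  exact: open_steep.
pose St : set E := S `&` [set x | t <= kernel b x].
have AE : superlevel (graph d `\` head_rough e : set (caratheodory_type (@hausdorff R m.+1 m)))
    (fun x => (1 - 4 * e) ^+ m.+1 * kernel b x) t = \bigcup_k A k.
  rewrite predeqE => x; split.
    move=> [[gx nr] /= tx]; have : exists k, ~ steep e k (head_coords x).
      by apply/existsNP => h; apply: nr => k _; exact: h.
    by move=> [k hk]; exists k.
  by move=> [k _ [[gx tx] hk]]; split => //; split=> // /(_ k I).
rewrite AE.
(* on [A k] the Lipschitz bound holds at the fixed scale [1 / (k + 1)] *)
have Ale k : (hm (A k) <= ((1 + 2 * e) ^+ m)%:E * hm St)%E.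
  pose P : set E := St `&` [set cap_point y | y in ball2 z' d `\` steep e k].
  apply: (@le_trans _ _ (hausdorff m.+1 m [set lift (head_coords p) | p in P])).
    apply: le_hausdorff => x [[gx tx] hx]; have [Sp yp near] := graph_pole_ge e01 fs gx rb.
    have [xd xg] := gx; set y := head_coords x in hx Sp yp near xd xg *.
    exists (cap_point y); last by rewrite head_graph_point /y liftK.
    split; last by exists y.
    split=> //=; apply: le_trans tx _.
    have pp : 0 < norm2 (cap_point y - pole b) by apply: lt_le_trans br (sphere_pole_ge Sp rb).
    have := kernel_le (mulr_gt0 q0 pp) near; rewrite -[_ <= _](ler_pM2l (exprn_gt0 m.+1 q0)).
    by rewrite exprMn invfM mulrA divff ?mul1r// expf_neq0// gt_eqF.
  have Hlip v v' : P v -> P v' -> norm2 (v - v') < k.+1%:R^-1 ->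
      norm2 (lift (head_coords v) - lift (head_coords v')) <= (1 + 2 * e) * norm2 (v - v').
    move=> [_ [y [yd hy] <-]] [_ [y' [yd' hy'] <-]] pk.
    rewrite !head_graph_point; set p := cap_point y in pk *; set p' := cap_point y' in pk *.
    have [Sp pz _] := fsP y yd; have [Sp' pz' _] := fsP y' yd'.
    have hd : norm2 (y - y') <= norm2 (p - p').
      by apply: le_trans (norm2_head_le _); rewrite head_coordsB !head_graph_point.
    have slope : `|psi y - psi y' - dot a (y - y')| <= e * norm2 (y - y').
      rewrite leNgt; apply/negP => h; apply: hy'; split; first exact: lt_le_trans dr.
      by exists y; split => //; [exact: lt_le_trans dr|exact: le_lt_trans pk].
    have chord : `|last_coord (p - p') - dot a (y - y')| <= e * norm2 (p - p').
      rewrite -(ler_pM2l lam0) -[lam in leLHS]gtr0_norm// -normrM.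
      have -> : lam * (last_coord (p - p') - dot a (y - y')) = dot (p - p') (z - c).
        by rewrite dot_normal head_coordsB !head_graph_point.
      apply: le_trans (sphere_chord Sp Sp') _.
      rewrite (_ : lam * (e * norm2 (p - p')) = norm2 (p - p') * (lam * e)); last by ring.
      rewrite ler_wpM2l ?norm2_ge0// ler_pdivrMr//.
      by move: pz pz'; move: (lam * e) => le; lra.
    (* the lift differs from the chord [p - p'] by a small vertical vector *)
    have -> : lift y - lift y' = (p - p') +
        graph_point 0 ((psi y - psi y' - dot a (y - y')) - (last_coord (p - p') - dot a (y - y'))).
      apply: eq_split; rewrite !(head_coordsB, head_coordsD, last_coordB, last_coordD).
        by rewrite !head_graph_point addr0.
      by rewrite !last_graph_point; ring.
    apply: le_trans (norm2D _ _) _.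
    have : norm2 (graph_point (0 : 'rV[R]_m) ((psi y - psi y' - dot a (y - y')) -
        (last_coord (p - p') - dot a (y - y')))) <= e * norm2 (y - y') + e * norm2 (p - p').
      apply: le_trans (norm2_split_le _) _.
      rewrite head_graph_point last_graph_point norm20 add0r.
      by rewrite (le_trans (ler_normB _ _))// lerD.
    have : e * norm2 (y - y') <= e * norm2 (p - p') by rewrite ler_pM2l.
    by rewrite mulrDl mul1r; lra.
  have e21 : 0 < 1 + 2 * e by lra.
  have k0 : 0 < k.+1%:R^-1 :> R by rewrite invr_gt0.
  apply: le_trans (hausdorff_lipschitz_image (s := m) e21 k0 Hlip) _.
  apply: lee_wpmul2l; first by rewrite lee_fin exprn_ge0// ltW.
  by apply: le_hausdorff => p [].
have cA : hm (A k) @[k --> \oo] --> hm (\bigcup_k A k).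
  apply: nondecreasing_cvg_mu => //; first exact: bigcupT_measurable.
  move=> j k jk; apply/subsetPset => x [Gx hx]; split=> // hk; apply: hx.
  exact: le_steep hk.
rewrite -(cvg_lim (@ereal_hausdorff _) cA); apply: lime_le; first exact: cvgP cA.
by apply: nearW => k; exact: Ale.
Qed.

(** On the dyadic shell of radius [2^-j], the rough part of the graph has measure
    at most [kap (2^-j)^m] up to a constant, while the kernel is of order
    [(b - r + 2^-j)^-n]; the resulting series telescopes. *)
Lemma rough_part : exists2 C : R, 0 <= C & forall e kap, 0 < e <= 8^-1 -> 0 < kap ->
  exists J0, forall J, (J0 <= J)%N -> forall b, r < b < r + 1 ->
  ((b ^+ 2 - r ^+ 2)%:E *
    \int[hm]_(x in graph (2 ^- J) `&` head_rough e) (kernel b x)%:E <= (C * kap)%:E)%E.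
Proof.
have L1 : 0 < 1 + L by rewrite ltr_pwDl.
pose C : R := (2 * r + 1) * 4 ^+ m.+1 * (1 + L) ^+ m * 4 ^+ m.-1.
have C0 : 0 <= C.
  have r21 : 0 <= 2 * r + 1 by have := r0; lra.
  by rewrite !mulr_ge0 ?exprn_ge0// ltW.
exists (C * 8); first by rewrite mulr_ge0.
move=> e kap e01 kap0; have /andP[e0 e1] := e01.
have [d d0 fs] := fine_scale_ex e0.
have [J1 J1P] := rough_dir_small e0 kap0.
have [J2 J2P] : exists J2, forall j, (J2 <= j)%N -> 2 ^- j <= d.
  by have [i iP] := exp2V_lt d0; exists i => j /iP/ltW.
exists (maxn J1 J2) => J; rewrite geq_max => /andP[J1J J2J] b /andP[rb b1].
have {}fs : fine_scale e (2 ^- J) := fine_scaleW (J2P J J2J) fs.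
have [dr fsP] := fs; have mG := measurable_graph dr.
have nGp := graph_avoids_pole e01 fs rb.
have br : 0 < b - r by rewrite subr_gt0.
pose s i : R := 2 ^- (J + i).
have s0 i : 0 < s i by rewrite invr_gt0 exprn_gt0.
have sS i : s i.+1 = s i / 2 by rewrite /s addnS exprS invfM mulrC.
have s_anti i j : (i <= j)%N -> s j <= s i.
  by move=> ij; rewrite lef_pV2 ?posrE ?exprn_gt0// ler_eXn2l ?leq_add2l// ltr1n.
pose Cyl (rho : R) := (@head_coords R m) @^-1` ball2 z' rho.
have mCyl rho : (@hausdorff R m.+1 m).-cara.-measurable (Cyl rho).
  apply: open_cara_measurable; apply: open_comp => [x _|]; first exact: continuous_head.
  exact: open_ball2.
pose D := graph (2 ^- J) `&` head_rough e.
have mD : (@hausdorff R m.+1 m).-cara.-measurable D by exact: measurableI.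
pose T i := D `&` (Cyl (s i) `\` Cyl (s i.+1)).
have mT i : (@hausdorff R m.+1 m).-cara.-measurable (T i).
  by apply: measurableI => //; exact: measurableD.
have TP i x : T i x -> s i.+1 <= norm2 (head_coords x - z') < s i.
  by move=> [_ [/= x1 /negP]]; rewrite -leNgt x1 andbT.
have DE : D = \bigcup_i T i.
  rewrite predeqE => x; split=> [Dx|[i _ []//]].
  have [[xd _] rx] := Dx; set t := norm2 (head_coords x - z') in xd.
  have t0 : 0 < t.
    rewrite lt_neqAle norm2_ge0 andbT eq_sym; apply/eqP => /norm2_eq0/subr0_eq xz.
    by move: rx; rewrite /head_rough/= xz; exact: flat_not_rough (flat_z e0).
  have ex : exists i, s i.+1 <= t.
    have [i iP] := exp2V_lt t0; exists i; apply/ltW/iP.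
    by rewrite addnS ltnW// ltnS leq_addl.
  case: (ex_minnP ex) => i it imin; exists i => //; split=> //.
  split; last by apply/negP; rewrite -leNgt.
  rewrite /Cyl/= -/t; case: i it imin => [|i] it imin; first by rewrite /ball2/= -/t /s addn0.
  by rewrite /ball2/= -/t ltNge; apply/negP => /imin; rewrite ltnn.
have tT : trivIset setT T.
  apply: ltn_trivIset => j i ij; rewrite -subset0 => x [/TP/andP[xi _] /TP/andP[_ xj]].
  by have := lt_le_trans xj (le_trans (s_anti _ _ ij) xi); rewrite ltxx.
set t := b - r in br; pose phi i := t / (t + s i / 4).
have phi_pos i : 0 <= phi i <= 1.
  have ts : 0 < t + s i / 4 by rewrite addr_gt0// divr_gt0.
  have s4 : 0 <= s i / 4 by rewrite divr_ge0// ltW.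
  apply/andP; split; first by apply: divr_ge0; exact: ltW.
  by rewrite ler_pdivrMr// mul1r lerDl.
have muT i : (hm (T i) <= (((1 + L) * s i) ^+ m * kap)%:E)%E.
  pose G xi := lift (z' + s i *: xi).
  apply: (@le_trans _ _ (hausdorff m.+1 m [set G xi | xi in rough_dir e (J + i)])).
    apply: le_hausdorff => x Tx; have /andP[x1 x2] := TP i x Tx.
    have [[[_ xg] rx] _] := Tx; pose xi := (s i)^-1 *: (head_coords x - z').
    have E1 : z' + s i *: xi = head_coords x.
      by rewrite /xi scalerA divff ?gt_eqF// scale1r addrC subrK.
    exists xi; last by rewrite /G E1 liftK.
    split; last by rewrite /= -/(s i) E1.
    rewrite /annulus/= norm2Z gtr0_norm ?invr_gt0// mulrC ler_pdivlMr// ltr_pdivrMr//.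
    by rewrite mul1r x2 andbT mulrC -sS.
  have Glip xi xi' : rough_dir e (J + i) xi -> rough_dir e (J + i) xi' ->
      norm2 (xi - xi') < 1 -> norm2 (G xi - G xi') <= ((1 + L) * s i) * norm2 (xi - xi').
    move=> [_ /= r1] [_ /= r2] _; have [B1 _] := r1 0%N I; have [B2 _] := r2 0%N I.
    apply: le_trans (lift_lipschitz B1 B2) _.
    by rewrite opprD addrACA subrr add0r -scalerBr norm2Z gtr0_norm// mulrA.
  apply: le_trans (hausdorff_lipschitz_image (s := m) (mulr_gt0 L1 (s0 i)) ltr01 Glip) _.
  rewrite EFinM; apply: lee_wpmul2l; first by rewrite lee_fin exprn_ge0// mulr_ge0// ltW.
  by apply: J1P; apply: leq_trans J1J _; exact: leq_addr.
have kT i x : T i x -> 0 <= kernel b x <= ((t + s i / 4) / 4) ^- m.+1.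
  move=> Tx; have /andP[x1 x2] := TP i x Tx; have [[gx _] _] := Tx.
  have [Sp yp far] := graph_pole_ge e01 fs gx rb.
  have h1 := sphere_pole_ge Sp rb; have h2 := sphere_touch_le Sp rb.
  rewrite kernel_ge0 kernel_le//.
    by rewrite divr_gt0// addr_gt0// divr_gt0.
  apply: le_trans far; set P := norm2 (_ - pole b) in h1 h2 *.
  have h3 : s i / 2 <= 2 * P by rewrite -sS (le_trans x1)// (le_trans yp).
  have h4 : 2^-1 * P <= (1 - 4 * e) * P by rewrite ler_wpM2r ?norm2_ge0//; lra.
  by apply: le_trans h4; move: h1 h3; rewrite -/t; lra.
have mk A : (@hausdorff R m.+1 m).-cara.-measurable A -> A `<=` graph (2 ^- J) ->
    measurable_fun (A : set (caratheodory_type (@hausdorff R m.+1 m))) (kernel b).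
  by move=> mA AG; apply: measurable_kernel => // /AG.
have b2 : 0 <= b ^+ 2 - r ^+ 2.
  by rewrite subr_ge0 lerXn2r ?nnegrE ?(ltW r0) ?(ltW rb) ?(ltW (lt_trans r0 rb)).
have TG i : T i `<=` graph (2 ^- J) by move=> x [[]].
have term i : ((b ^+ 2 - r ^+ 2)%:E * \int[hm]_(x in T i) (kernel b x)%:E <=
    (C * kap * (8 * (phi i.+1 - phi i)))%:E)%E.
  apply: (@le_trans _ _ ((b ^+ 2 - r ^+ 2)%:E *
      ((((t + s i / 4) / 4) ^- m.+1)%:E * (((1 + L) * s i) ^+ m * kap)%:E))%E).
    apply: lee_wpmul2l; first by rewrite lee_fin.
    have le_sup := integral_le_sup hm (mT i) (mk _ (mT i) (TG i)) (kT i).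
    apply: le_trans le_sup _.
    apply: lee_wpmul2l; last exact: muT.
    by rewrite lee_fin invr_ge0 exprn_ge0// divr_ge0// addr_ge0 ?divr_ge0// ltW.
  rewrite -!EFinM lee_fin.
  have rb1 : r < b < r + 1 by rewrite rb b1.
  have h1 := shell_bound m0 (s0 i) (ltW r0) L0 rb1 (erefl t).
  have h2 := poisson_telescope br (s0 i).
  rewrite (_ : _ * (_ * (_ * kap)) = (b ^+ 2 - r ^+ 2) *
    (((t + s i / 4) / 4) ^- m.+1 * ((1 + L) * s i) ^+ m) * kap); last by rewrite !mulrA.
  apply: le_trans (ler_wpM2r (ltW kap0) h1) _.
  rewrite -/C mulrAC ler_wpM2l ?(mulr_ge0 C0 (ltW kap0))//.
  by apply: le_trans h2 _; rewrite /phi sS.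
have mU : measurable_fun (\bigcup_i T i : set (caratheodory_type (@hausdorff R m.+1 m)))
    (EFin \o kernel b).
  by apply/measurable_EFinP; apply: mk; rewrite -DE// => x [].
have kU x : (\bigcup_i T i) x -> (0 <= (EFin \o kernel b) x)%E.
  by move=> _; rewrite lee_fin kernel_ge0.
rewrite -/D DE; have -> := ge0_integral_bigcup hm mT mU kU tT.
have int0 i : (0 <= \int[hm]_(x in T i) (kernel b x)%:E)%E.
  by apply: integral_ge0 => x _; rewrite lee_fin kernel_ge0.
rewrite -nneseriesZl//; apply: lime_le.
  by apply: is_cvg_nneseries => i _ _; rewrite mule_ge0// lee_fin.
apply: nearW => N; apply: (@le_trans _ _ (\sum_(0 <= i < N) (C * kap * (8 * (phi i.+1 - phi i)))%:E)%E).
  by apply: lee_sum => i _; exact: term.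
rewrite sumEFin lee_fin -!mulr_sumr telescope_sumr//.
rewrite (_ : C * 8 * kap = C * kap * (8 * 1)); last by rewrite mulr1 mulrAC.
rewrite ler_wpM2l ?(mulr_ge0 C0 (ltW kap0))// ler_wpM2l//.
by have /andP[_ p1] := phi_pos N; have /andP[p0 _] := phi_pos 0%N; move: p0 p1; lra.
Qed.

(** Near the touching point the boundary contributes hardly more than the whole
    sphere does. The mean over the sphere is known exactly; the factor of
    [smooth_part] and the term of [rough_part] are absorbed in [eta]. The scale [d]
    does not depend on [b], which may thus tend to [r] afterwards. *)
Lemma near_estimate eta : 0 < eta -> (hm S < +oo)%E ->
  exists d, [/\ 0 < d, d <= rB & forall b, r < b < r + 1 ->
    hm.-integrable (graph d) (EFin \o (fun x => norm2 (x - pole b) ^- m.+1)) /\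
    (b ^+ 2 - r ^+ 2) * Rintegral hm (graph d) (fun x => norm2 (x - pole b) ^- m.+1) <=
      (1 + eta) * (b ^+ 2 * b ^- m.+1 * fine (hm S)) + eta].
Proof.
move=> eta0 Sfin.
have [e e01 eP] : exists2 e, 0 < e <= 8^-1 & (1 + 2 * e) ^+ m <= (1 + eta) * (1 - 4 * e) ^+ m.+1.
  pose g (e : R) := (1 + eta) * (1 + (- 4) * e) ^+ m.+1 - (1 + 2 * e) ^+ m.
  have g0 : 0 < g 0 by rewrite /g !mulr0 !addr0 !expr1n mulr1; lra.
  have cg : {for 0, continuous g}.
    have lin (k l : R) j : {for (0 : R), continuous (fun e : R => (k + l * e) ^+ j)}.
      apply: (continuous_comp (f := fun e : R => k + l * e) (g := fun t : R => t ^+ j)).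
        by apply: continuousD; [exact: cst_continuous|apply: continuousM; [exact: cst_continuous|move=> A; exact]].
      exact: exprn_continuous.
    have l1 := lin 1 (- 4) m.+1; have l2 := lin 1 2 m.
    apply: continuousB; last exact: l2.
    by apply: continuousM; [exact: cst_continuous|exact: l1].
  have /nbhs_ballP[t /= t0 tP] := cvgr_gt (FF := nbhs_filter (0 : R)) _ cg _ g0.
  pose e := Num.min (t / 2) 8^-1; have e0 : 0 < e.
    by rewrite lt_min divr_gt0//=; lra.
  exists e; first by rewrite e0 ge_min lexx orbT.
  have : ball (0 : R) t e.
    rewrite -ball_normE /= sub0r normrN gtr0_norm// /e gt_min.
    by rewrite ltr_pdivrMr// ltr_pMr// ltr1n.
  by move=> /tP; rewrite /g mulNr subr_gt0 => /ltW.
have /andP[e0 e1] := e01; have [C C0 CP] := rough_part.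
have kap0 : 0 < eta / (C + 1) by rewrite divr_gt0// ltr_wpDl.
have [J1 J1P] := CP e _ e01 kap0; have [d d0 fs] := fine_scale_ex e0.
have [J2 J2P] := exp2V_lt d0; pose J := maxn J1 J2.
have {}fs : fine_scale e (2 ^- J).
  by apply: fine_scaleW fs; apply/ltW/J2P; exact: leq_maxr.
have dr := fs.1; exists (2 ^- J); split => //.
move=> b b01; have /andP[rb b1] := b01; have b0 := lt_trans r0 rb.
have mG := measurable_graph dr; have Gfin := hausdorff_graph_fin dr.
have nGp := graph_avoids_pole e01 fs rb.
have q0 : 0 < 1 - 4 * e by lra.
have br : 0 < b - r by rewrite subr_gt0.
have mN := measurable_head_rough e.
have mk := measurable_kernel mG nGp.
have iG : hm.-integrable (graph (2 ^- J)) (EFin \o kernel b).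
  apply: (bounded_integrable mG Gfin mk (M := ((1 - 4 * e) * (b - r)) ^- m.+1)) => x gx.
  rewrite ger0_norm ?kernel_ge0// kernel_le ?mulr_gt0//.
  have [Sp _] := graph_pole_ge e01 fs gx rb; apply: le_trans.
  by rewrite ler_pM2l// sphere_pole_ge.
split; first exact: iG.
have mS : (@hausdorff R m.+1 m).-cara.-measurable S.
  exact/closed_cara_measurable/closed_sphere2.
have iS : hm.-integrable S (EFin \o kernel b).
  have mkS := measurable_kernel mS (sphere_avoids_pole rb).
  apply: (bounded_integrable mS Sfin mkS (M := (b - r) ^- m.+1)) => x Sx.
  by rewrite ger0_norm ?kernel_ge0// kernel_le// sphere_pole_ge.
have mG1 : (@hausdorff R m.+1 m).-cara.-measurable (graph (2 ^- J) `\` head_rough e).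
  exact: measurableD.
have mG2 : (@hausdorff R m.+1 m).-cara.-measurable (graph (2 ^- J) `&` head_rough e).
  exact: measurableI.
have iG1 : hm.-integrable (graph (2 ^- J) `\` head_rough e) (EFin \o kernel b).
  by apply: integrableS iG => //; exact: subDsetl.
have iG2 : hm.-integrable (graph (2 ^- J) `&` head_rough e) (EFin \o kernel b).
  by apply: integrableS iG => //; exact: subIsetl.
have mean : (b ^+ 2 - r ^+ 2) * Rintegral hm S (kernel b) = b ^+ 2 * b ^- m.+1 * fine (hm S).
  rewrite -(sphere_poisson_mean m0 r0 rb Sfin (pole_center b0)).
  by rewrite (RintegralZl _ mS iS).
have split_G : Rintegral hm (graph (2 ^- J)) (kernel b) =
    Rintegral hm (graph (2 ^- J) `\` head_rough e) (kernel b) +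
    Rintegral hm (graph (2 ^- J) `&` head_rough e) (kernel b).
  by rewrite addrC; exact: (Rintegral_setID mG mN iG).
have smooth := smooth_part e01 fs rb Sfin.
have rough := J1P J (leq_maxl _ _) b b01.
move: smooth rough.
rewrite (EFin_Rintegral mS iS) (EFin_Rintegral mG2 iG2).
rewrite (EFin_Rintegral mG1 (integrable_scaleR mG1 _ iG1)) -!EFinM !lee_fin.
rewrite (RintegralZl _ mG1 iG1) split_G -mean.
set A1 := Rintegral hm _ _; set AS := Rintegral hm _ _; set A2 := Rintegral hm _ _.
have AS0 : 0 <= AS by apply: Rintegral_ge0 => x _; exact: kernel_ge0.
clearbody A1 A2 AS => smooth rough.
have b2 : 0 <= b ^+ 2 - r ^+ 2.
  by rewrite subr_ge0 lerXn2r ?nnegrE ?(ltW r0) ?(ltW b0) ?(ltW rb).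
have A1S : A1 <= (1 + eta) * AS.
  rewrite -(ler_pM2l (exprn_gt0 m.+1 q0)); apply: le_trans smooth _.
  by rewrite [leRHS]mulrCA [leRHS]mulrA ler_wpM2r.
have Ceta : C * (eta / (C + 1)) <= eta.
  by rewrite mulrCA ger_pMr// ler_pdivrMr ?mul1r ?lerDl// ltr_wpDl.
rewrite mulrDr lerD ?(le_trans rough)//.
by rewrite [leRHS]mulrCA ler_wpM2l.
Qed.

End LocalGraph.

(** * Global geometry of the domain *)

Section Exit.
Context {R : realType} {n : nat}.
Implicit Types (W : set 'rV[R]_n) (x v c : 'rV[R]_n).

Lemma boundary_open W x : open W -> boundary W x <-> closure W x /\ ~ W x.
Proof. by move=> /interior_id oW; rewrite /boundary oW. Qed.

Lemma closed_boundary W : closed (boundary W).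
Proof.
rewrite /boundary setDE; apply: closedI; first exact: closed_closure.
by apply: open_closedC; exact: open_interior.
Qed.

(** A segment that leaves an open set crosses its boundary. *)
Lemma exit_point W x v (T : R) : open W -> W x -> 0 <= T -> ~ W (x + T *: v) ->
  exists2 t, 0 < t <= T & boundary W (x + t *: v).
Proof.
move=> oW Wx T0 WT; pose A := [set t : R | 0 <= t <= T /\ ~ W (x + t *: v)].
have AT : A T by split; rewrite ?T0/=.
have hA : has_inf A by split; [exists T|exists 0 => t [/andP[]]].
have gap t u : norm2 ((x + u *: v) - (x + t *: v)) = `|u - t| * norm2 v.
  by rewrite opprD addrACA subrr add0r -scalerBl norm2Z.
pose t0 := inf A.
have t00 : 0 <= t0 by apply: lb_le_inf; [exists T|move=> t [/andP[]]].
have t0T : t0 <= T by apply: ge_inf => //; case: hA.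
have nv : 0 < norm2 v + 1 by rewrite ltr_wpDl// norm2_ge0.
have WAt t : 0 <= t -> t < t0 -> W (x + t *: v).
  move=> tge tlt; apply: contrapT => h; have : t0 <= t.
    by apply: ge_inf; [case: hA|split=> //; rewrite tge (le_trans (ltW tlt))].
  by rewrite leNgt tlt.
have Wt0 : ~ W (x + t0 *: v).
  move=> h; have /nbhs_norm2[e e0 eW] : nbhs (x + t0 *: v) W by exact: open_nbhs_nbhs.
  have [s As se] := inf_adherent (divr_gt0 e0 nv) hA; have [_ Ws] := As.
  have sE : t0 <= s by apply: ge_inf => //; case: hA.
  apply: Ws; apply: eW; rewrite gap ger0_norm ?subr_ge0//.
  apply: (@le_lt_trans _ _ ((s - t0) * (norm2 v + 1))).
    by rewrite ler_wpM2l ?subr_ge0// lerDl.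
  by rewrite -ltr_pdivlMr// ltrBlDl.
exists t0.
  rewrite t0T andbT lt_neqAle t00 andbT; apply/eqP => t0E.
  by apply: Wt0; rewrite -t0E scale0r addr0.
apply/boundary_open => //; split=> // B /nbhs_norm2[e e0 eB].
have t0p : 0 < t0.
  rewrite lt_neqAle t00 andbT; apply/eqP => t0E.
  by apply: Wt0; rewrite -t0E scale0r addr0.
pose s := Num.max 0 (t0 - e / (norm2 v + 1) / 2).
have ev : 0 < e / (norm2 v + 1) by rewrite divr_gt0.
have st : s < t0 by rewrite gt_max t0p/=; lra.
exists (x + s *: v); split.
  by apply: WAt => //; rewrite le_max lexx.
apply: eB; rewrite gap ltr0_norm ?subr_lt0// opprB.
have se : t0 - s < e / (norm2 v + 1).
  have : t0 - e / (norm2 v + 1) / 2 <= s by rewrite le_max lexx orbT.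
  lra.
rewrite ltr_pdivlMr// in se; apply: le_lt_trans se.
by rewrite ler_wpM2l ?lerDl// subr_ge0 ltW.
Qed.

Definition radial_proj c (r : R) x := c + (r / norm2 (x - c)) *: (x - c).

(** Outside of the ball the nearest point map to the ball contracts distances; it
    is the radial projection. *)
Lemma radial_proj_lipschitz c r x y : 0 < r -> r <= norm2 (x - c) -> r <= norm2 (y - c) ->
  norm2 (radial_proj c r x - radial_proj c r y) <= norm2 (x - y).
Proof.
move=> r0 xr yr; set u := x - c in xr *; set v := y - c in yr *.
have u0 : 0 < norm2 u := lt_le_trans r0 xr; have v0 : 0 < norm2 v := lt_le_trans r0 yr.
have -> : x - y = u - v by rewrite /u /v opprB addrA subrK.
have -> : radial_proj c r x - radial_proj c r y = (r / norm2 u) *: u - (r / norm2 v) *: v.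
  by rewrite /radial_proj opprD addrACA subrr add0r.
apply: ler_sqr_norm; first exact: norm2_ge0.
clearbody u v; rewrite !norm2_sqB !norm2Z !gtr0_norm ?divr_gt0// !divfK ?gt_eqF// dotZl dotZr.
have := cauchy_schwarz u v; move: u0 v0 xr yr; move: (norm2 u) (norm2 v) (dot u v) => a b d.
move=> a0 b0 ra rb dab.
have k1 : r / a <= 1 by rewrite ler_pdivrMr// mul1r.
have k2 : r / b <= 1 by rewrite ler_pdivrMr// mul1r.
have ab : 0 < a * b by rewrite mulr_gt0.
pose t := d / (a * b).
have t1 : t <= 1 by rewrite ler_pdivrMr// mul1r.
have -> : r / a * (r / b * d) = r ^+ 2 * t by rewrite /t; field; rewrite !gt_eqF.
have -> : d = a * b * t by rewrite /t; field; rewrite !gt_eqF.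
have rab : r ^+ 2 <= a * b by rewrite expr2 ler_pM// ltW.
have p1 : 0 <= (a * b - r ^+ 2) * (1 - t) by rewrite mulr_ge0// subr_ge0.
by have := sqr_ge0 (a - b); move: p1; nra.
Qed.

Lemma radial_proj_sphere c r x : 0 < r -> 0 < norm2 (x - c) -> norm2 (radial_proj c r x - c) = r.
Proof.
move=> r0 x0; rewrite /radial_proj addrC addKr norm2Z gtr0_norm ?divr_gt0//.
by rewrite divfK// gt_eqF.
Qed.

End Exit.

Section HarmonicIdentity.
Context {R : realType} {m : nat}.
Local Notation E := 'rV[R]_m.+1.
Local Notation hm := (@hausdorff_measure R m.+1 m).

Lemma continuous_poisson (v w : E) : w != 0 -> {for w, continuous (poisson v)}.
Proof.
move=> w0.
have cn k : {for w, continuous (fun x : E => norm2 x ^- k)} by exact: continuous_norm2V.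
have cd : {for w, continuous (fun x : E => dot x v)} by exact: continuous_dotl.
apply: continuousD; apply: continuousM.
- exact: cst_continuous.
- exact: cn.
- exact: cst_continuous.
- by apply: continuousM; [exact: cd|exact: cn].
Qed.

(** The Poisson kernel with a pole outside of the closure of the domain is an
    admissible test function; its value at [c] is positive, which rules out a
    boundary of measure zero. *)
Lemma pseudosphere_poisson (W : set E) (c p : E) : (0 < m)%N -> open W -> W c ->
    (hm (boundary W) < +oo)%E -> harmonic_pseudosphere W c -> ~ closure W p ->
  let b := norm2 (p - c) in
  Rintegral hm (boundary W) (fun x => (b ^+ 2 - norm2 (x - c) ^+ 2) * norm2 (x - p) ^- m.+1) =
  b ^+ 2 * b ^- m.+1 * fine (hm (boundary W)) /\ 0 < fine (hm (boundary W)).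
Proof.
move=> m0 oW Wc fin ps Wp b.
have nWp : ~ W p by move=> h; apply: Wp; exact: subset_closure.
have ne x : closure W x -> x - p != 0.
  by move=> Wx; apply/eqP => /subr0_eq xp; apply: Wp; rewrite -xp.
have b0 : 0 < b.
  by rewrite norm2_gt0; apply/eqP => /subr0_eq pc; apply: nWp; rewrite pc.
have uE x : closure W x -> poisson (p - c) (x - p) =
    (b ^+ 2 - norm2 (x - c) ^+ 2) * norm2 (x - p) ^- m.+1.
  by move=> Wx; rewrite poissonE ?ne// addrA subrK.
have cu : {within closure W, continuous (fun x => poisson (p - c) (x - p))}.
  apply: continuous_in_subspaceT => x; rewrite inE => Wx.
  apply: (continuous_comp (f := fun x : E => x - p) (g := poisson (p - c))).
    by apply: continuousB; [move=> A; exact|exact: cst_continuous].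
  by apply: continuous_poisson; exact: ne.
have := ps _ (poisson_harmonic (p - c) m0 nWp oW) cu.
rewrite uE; last exact: subset_closure.
rewrite subrr norm20 expr0n subr0 norm2_distC -/b /average_boundary.
have -> : Rintegral hm (boundary W) (fun x => poisson (p - c) (x - p)) =
    Rintegral hm (boundary W) (fun x => (b ^+ 2 - norm2 (x - c) ^+ 2) * norm2 (x - p) ^- m.+1).
  by apply: eq_Rintegral => x /set_mem [Wx _]; exact: uE.
have ub : 0 < b ^+ 2 * b ^- m.+1 by rewrite mulr_gt0 ?invr_gt0 ?exprn_gt0.
have sE : surface (boundary W) = hm (boundary W) by [].
rewrite sE.
have s0 : 0 <= fine (hm (boundary W)) by rewrite fine_ge0.
have [s00|sn0] := eqVneq (fine (hm (boundary W))) 0.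
  by rewrite s00 invr0 mul0r => h; rewrite h ltxx in ub.
move=> ->; split; last by rewrite lt_neqAle eq_sym sn0.
by rewrite mulrAC mulVf ?mul1r.
Qed.

End HarmonicIdentity.

Section Rays.
Context {R : realType} {n : nat}.
Implicit Types (W X Y : set 'rV[R]_n) (x v c p q : 'rV[R]_n).

Lemma radial_proj_ray c r t v : 0 < t -> 0 < r -> norm2 v = r ->
  radial_proj c r (c + t *: v) = c + v.
Proof.
move=> t0 r0 vr; rewrite /radial_proj [c + t *: v - c]addrC addKr norm2Z vr gtr0_norm//.
by rewrite scalerA (_ : r / (t * r) * t = 1) ?scale1r//; field; rewrite !gt_eqF.
Qed.

Lemma le_hausdorff_radial_proj (s : nat) c r X Y : 0 < r ->
    (forall y, Y y -> r <= norm2 (y - c)) -> X `<=` radial_proj c r @` Y ->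
  (hausdorff n s X <= hausdorff n s Y)%E.
Proof.
move=> r0 Yr XY; apply: le_trans (le_hausdorff _ XY) _.
have := @hausdorff_lipschitz_image R n n s (radial_proj c r) Y 1 1 ltr01 ltr01.
rewrite expr1n mul1e; apply=> x y Yx Yy _; rewrite mul1r.
by apply: radial_proj_lipschitz => //; exact: Yr.
Qed.

Lemma bounded_norm2 W : bounded_set W -> exists2 K, 0 < K & forall x, closure W x -> norm2 x <= K.
Proof.
move=> [M [_ WM]]; pose K := n%:R * (`|M| + 1) + 1.
have K0 : 0 < K by rewrite ltr_wpDl// mulr_ge0// addr_ge0.
exists K => // x; have cK : closed [set x : 'rV[R]_n | norm2 x <= K].
  apply: (closed_comp (f := norm2) (D := [set t | t <= K])) => [y _|]; last exact: closed_le.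
  exact: continuous_norm2.
have WK : W `<=` [set x | norm2 x <= K].
  move=> y Wy /=; apply: le_trans (norm2_le_norm y) _; rewrite -[leLHS]addr0 lerD//.
  by rewrite ler_wpM2l// (WM (`|M| + 1))// ltr_pwDr// ler_norm.
by move=> /(closure_subset WK); rewrite -(closure_id _).1.
Qed.

Lemma exit_ray W p v : open W -> bounded_set W -> W p -> v != 0 ->
  exists2 t, 0 < t & boundary W (p + t *: v).
Proof.
move=> oW /bounded_norm2[K K0 KW] Wp v0.
have nv : 0 < norm2 v by rewrite norm2_gt0.
pose T := (K + norm2 p + 1) / norm2 v.
have T0 : 0 < T by rewrite divr_gt0// ltr_wpDl// addr_ge0 ?norm2_ge0// ltW.
have nW : ~ W (p + T *: v).
  move=> /subset_closure /KW; apply/negP; rewrite -ltNge.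
  have := norm2_triangle (p + T *: v) 0 p.
  rewrite !subr0 sub0r norm2N [p + _]addrC addrK norm2Z gtr0_norm// divfK ?gt_eqF//; lra.
by have [t /andP[t0 _] bt] := exit_point oW Wp (ltW T0) nW; exists t.
Qed.

(** A segment leaving the domain inside the ball would meet the boundary closer to
    [c] than the touching point. *)
Lemma touching_ball W c z : open W -> W c -> touching_set W c z ->
  [/\ 0 < norm2 (z - c), forall x, boundary W x -> norm2 (z - c) <= norm2 (x - c) &
      ball2 c (norm2 (z - c)) `<=` W].
Proof.
move=> oW Wc [bz dz].
have far x : boundary W x -> norm2 (z - c) <= norm2 (x - c).
  move=> bx; rewrite norm2_distC dz norm2_distC; apply: ge_inf; last by exists x.
  by exists 0 => _ [y _ <-]; exact: norm2_ge0.
split=> //.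
  rewrite norm2_gt0; apply/eqP => /subr0_eq zc.
  by move: bz; rewrite boundary_open// zc => -[].
move=> x xr; apply: contrapT => nWx.
have nWx1 : ~ W (c + 1 *: (x - c)) by rewrite scale1r addrC subrK.
have [t /andP[t0 t1] /far] := exit_point oW Wc ler01 nWx1.
rewrite [c + _]addrC addrK norm2Z gtr0_norm//; apply/negP; rewrite -ltNge; apply: le_lt_trans xr.
by rewrite ler_piMl ?norm2_ge0.
Qed.

End Rays.

(** * From Lipschitz flatness to the local graph *)

Section Flat.
Context {R : realType} {m : nat}.
Local Notation E := 'rV[R]_m.+1.
Implicit Types (x : E) (y xi : 'rV[R]_m).

Lemma diff_grad (psi : 'rV[R]_m -> R) y u : differentiable psi y ->
  'd psi y u = dot (grad psi y) u.
Proof.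
move=> dpsi; rewrite [in LHS](row_sum_basis u) linear_sum.
apply: eq_bigr => i _; rewrite linearZ -deriveE// mxE.
by rewrite mulrC.
Qed.

(** Continuity of the gradient along rays enters only through this consequence. *)
Lemma differentiable_flat (psi : 'rV[R]_m -> R) (a : 'rV[R]_m) y (e : R) :
    differentiable psi y -> 0 < e -> norm2 (grad psi y - a) <= e / 2 ->
  flat_at psi a e y.
Proof.
move=> dpsi e0 ga; have /diff_locallyP[_ H] := dpsi.
have e2 : 0 < e / 2 by rewrite divr_gt0.
have := H; move=> /eqaddoP/(_ _ e2) /nbhs_norm2[d d0 dP].
exists d => // u uy; have := dP (u - y); rewrite subr0 => /(_ uy).
rewrite !fctE /= subrK (diff_grad _ dpsi) => h.
have -> : psi u - psi y - dot a (u - y) =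
    (psi u - (psi y + dot (grad psi y) (u - y))) + dot (grad psi y - a) (u - y).
  by rewrite dotBl; ring.
apply: le_trans (ler_normD _ _) _.
rewrite (_ : e * norm2 (u - y) = e / 2 * norm2 (u - y) + e / 2 * norm2 (u - y)); last by field.
apply: lerD.
  by apply: le_trans h _; rewrite ler_wpM2l ?(ltW e2)// norm_le_norm2.
apply: le_trans (cauchy_schwarz_abs _ _) _.
by rewrite ler_wpM2r ?norm2_ge0.
Qed.

Variables (W : set E) (c z : E) (r : R).
Hypotheses (oW : open W) (r0 : 0 < r) (zc : norm2 (z - c) = r) (Wz : boundary W z).
Hypothesis ballW : ball2 c r `<=` W.

(** What the later estimates use of the flatness hypothesis. The vector [z - c] is
    [lam] times the upward normal [(- a, 1)] of the graph; the last field says that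
    points slightly beyond [z] on the ray from [c] are exterior. *)
Record local_graph (rB L lam : R) (psi : 'rV[R]_m -> R) (a : 'rV[R]_m) : Prop := LocalGraph {
  lg_rB : 0 < rB;
  lg_lam : 0 < lam;
  lg_L : 0 <= L;
  lg_head : head_coords (z - c) = - lam *: a;
  lg_last : last_coord (z - c) = lam;
  lg_psi : psi (head_coords z) = last_coord z;
  lg_lip : forall y u, ball2 (head_coords z) rB y -> ball2 (head_coords z) rB u ->
    `|psi y - psi u| <= L * norm2 (y - u);
  lg_flat : forall e, 0 < e -> flat_at psi a e (head_coords z);
  lg_ray : forall e, 0 < e -> hausdorff m m [set xi |
    ~ exists2 t0 : R, 0 < t0 & forall t, 0 < t < t0 ->
        flat_at psi a e (head_coords z + t *: xi)] = 0%E;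
  lg_graph : forall d, d <= rB -> graph z psi d `<=` boundary W;
  lg_near : forall d, 0 < d -> d <= rB -> exists2 rho, 0 < rho &
    forall x, boundary W x -> norm2 (x - z) < rho -> graph z psi d x;
  lg_pole : exists2 t0, 0 < t0 & forall b, r < b < r + t0 -> ~ closure W (pole c z r b)
}.

(** The inscribed ball lies below the graph and touches it at [z], so both have the
    same tangent plane there; this determines the direction of [z - c]. *)
Lemma local_graph_ex : lipschitz_flat W z ->
  exists rB L lam psi a, local_graph rB L lam psi a.
Proof.
move=> [rB [lo [hi [psi]]]] /= [[rB0 /andP[loz zhi] psi_in] [[psi_lip psi_diff null] [bdU WU]]].
set z' := head_coords z in rB0 psi_in psi_lip psi_diff null bdU WU *.
set B := ball2 z' rB in psi_in psi_lip psi_diff null bdU WU *.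
set U := cylinder B lo hi in bdU WU *.
pose a := grad psi z'.
have Bz : B z' by rewrite /B /ball2/= subrr norm20.
have oB : open B by exact: open_ball2.
have Uz : U z by split=> //; rewrite loz zhi.
have oU : open U.
  have -> : U = (@head_coords R m) @^-1` B `&` (@last_coord R m) @^-1` `]lo, hi[.
    by rewrite predeqE => x; split=> -[? h]; split; move: h; rewrite /= ?in_itv.
  apply: openI; first by apply: open_comp => // x _; exact: continuous_head.
  apply: open_comp => [x _|]; [exact: continuous_last|exact: itv_open].
have psi_z : psi z' = last_coord z.
  by have : (boundary W `&` U) z by []; rewrite bdU => -[_ ->].
have [L L0 Llip] : exists2 L, 0 <= L & forall y u, B y -> B u -> `|psi y - psi u| <= L * norm2 (y - u).
  have [M [_ MP]] := psi_lip; exists (`|M| + 1); first by rewrite addr_ge0.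
  have M1 : M < `|M| + 1 by rewrite ltr_pwDr// ler_norm.
  move=> y u By Bu; have /= h := MP _ M1 (y, u) (conj By Bu).
  apply: le_trans h _; rewrite ler_wpM2l ?norm_le_norm2// addr_ge0//.
have flat_z e : 0 < e -> flat_at psi a e z'.
  move=> e0; apply: differentiable_flat => //; first exact: psi_diff.
  by rewrite subrr norm20 divr_ge0// ltW.
have nBray xi : exists2 t1 : R, 0 < t1 & forall t, 0 < t < t1 -> B (z' + t *: xi).
  have n1 : 0 < norm2 xi + 1 by rewrite ltr_wpDl// norm2_ge0.
  exists (rB / (norm2 xi + 1)); first by rewrite divr_gt0.
  move=> t /andP[t0]; rewrite ltr_pdivlMr// => tr; rewrite /B /ball2/= addrC addKr.
  rewrite norm2Z gtr0_norm//; apply: le_lt_trans tr.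
  by rewrite ler_wpM2l ?(ltW t0)// lerDl.
have ray e : 0 < e -> hausdorff m m [set xi |
    ~ exists2 t0 : R, 0 < t0 & forall t, 0 < t < t0 -> flat_at psi a e (z' + t *: xi)] = 0%E.
  move=> e0; apply/eqP; rewrite eq_le hausdorff_ge0 andbT.
  rewrite -(hausdorff_lebesgue_null null); apply: le_hausdorff => xi nflat; apply: contra_not nflat.
  move=> cv; have e2 : 0 < e / 2 by rewrite divr_gt0.
  have nb : nbhs a [set g | norm2 (g - a) < e / 2] by apply/nbhs_norm2; exists (e / 2).
  have /nbhs_ballP[t0 /= t00 tP] := cv _ nb.
  have [t1 t10 t1P] := nBray xi.
  exists (Num.min t0 t1); first by rewrite lt_min t00.
  move=> t /andP[tp]; rewrite lt_min => /andP[tt0 tt1].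
  apply: differentiable_flat => //; first by apply: psi_diff; apply: t1P; rewrite tp.
  apply/ltW; apply: (tP t); last by rewrite gt_eqF.
  by rewrite -ball_normE/= sub0r normrN gtr0_norm.
(* directions pointing into the ball point below the tangent plane of the graph *)
have tangent v : dot v (z - c) < 0 -> last_coord v <= dot a (head_coords v).
  move=> vn; rewrite leNgt; apply/negP => gap.
  have M0 : 0 < norm2 v + 1 by rewrite ltr_wpDl// norm2_ge0.
  have [rho rho0 rhoU] : exists2 e, 0 < e & forall x, norm2 (x - z) < e -> U x.
    by apply/nbhs_norm2; exact: open_nbhs_nbhs.
  pose e := (last_coord v - dot a (head_coords v)) / 2 / (norm2 v + 1).
  have e0 : 0 < e by rewrite !divr_gt0// subr_gt0.
  have [d d0 dP] := flat_z _ e0.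
  pose k := - (2 * dot v (z - c)) / (norm2 v + 1).
  have k0 : 0 < k by rewrite divr_gt0//; lra.
  pose q := Num.min rho (Num.min d k).
  have q0 : 0 < q by rewrite !lt_min rho0 d0.
  pose t := q / 2 / (norm2 v + 1).
  have t0 : 0 < t by rewrite !divr_gt0.
  have tv : t * norm2 v < q.
    apply: (@le_lt_trans _ _ (t * (norm2 v + 1))).
      by rewrite ler_wpM2l ?(ltW t0)// lerDl.
    by rewrite /t divfK ?gt_eqF//; lra.
  have tz : norm2 (z + t *: v - z) = t * norm2 v by rewrite addrC addKr norm2Z gtr0_norm.
  have Ux : U (z + t *: v) by apply: rhoU; rewrite tz (lt_le_trans tv)// ge_min lexx.
  have Wx : W (z + t *: v).
    apply: ballW; rewrite /ball2/= addrAC.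
    rewrite -(@ltr_pXn2r _ 2)// ?nnegrE ?norm2_ge0 ?(ltW r0)// norm2_sqD zc dotZr norm2Z gtr0_norm//.
    have tq : t * norm2 v < k by apply: (lt_le_trans tv); rewrite !ge_min lexx !orbT.
    have kv : k * norm2 v < - (2 * dot v (z - c)).
      apply: (@lt_le_trans _ _ (k * (norm2 v + 1))); first by rewrite ltr_pM2l// ltrDl.
      by rewrite /k divfK ?gt_eqF.
    have h1 : (t * norm2 v) * (t * norm2 v) <= (t * norm2 v) * k.
      by rewrite ler_wpM2l ?(ltW tq)// mulr_ge0 ?norm2_ge0// ltW.
    have h2 : t * (k * norm2 v) < t * - (2 * dot v (z - c)) by rewrite ltr_pM2l.
    rewrite (dotC (z - c)); nra.
  have : (W `&` U) (z + t *: v) by [].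
  rewrite WU => -[_ /andP[_]]; rewrite last_coordD last_coordZ head_coordsD head_coordsZ -/z'.
  move=> up; have := dP (z' + t *: head_coords v).
  rewrite addrC addKr norm2Z gtr0_norm// psi_z dotZr => /(_ _) le.
  have hv : t * norm2 (head_coords v) <= t * norm2 v by rewrite ler_wpM2l ?(ltW t0)// norm2_head_le.
  have {le} := le (le_lt_trans hv (lt_le_trans tv _)).
  rewrite !ge_min lexx orbT => /(_ isT); rewrite addrC ler_norml => /andP[_ le].
  have eE : e * (norm2 v + 1) * 2 = last_coord v - dot a (head_coords v).
    by rewrite /e divfK ?gt_eqF// divfK.
  have ev : e * (t * norm2 (head_coords v)) <= t * (e * (norm2 v + 1)).
    rewrite mulrCA ler_wpM2l ?(ltW t0)// ler_wpM2l ?(ltW e0)//.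
    by rewrite (le_trans (norm2_head_le _))// lerDl.
  have : 0 < t * (e * (norm2 v + 1)) by exact: mulr_gt0 t0 (mulr_gt0 e0 M0).
  have : t * (e * (norm2 v + 1) * 2) = t * last_coord v - t * dot a (head_coords v).
    by rewrite eE mulrBr.
  by rewrite mulrA; move: ev le up; clear; lra.
pose N := graph_point (- a) 1 : E.
have dotN v : dot v N = last_coord v - dot a (head_coords v).
  by rewrite dot_split head_graph_point last_graph_point dotNr mulr1 addrC (dotC a).
have cone v : dot v (z - c) < 0 -> dot v N <= 0.
  by move=> /tangent; rewrite dotN subr_le0.
have r2 : dot (z - c) (z - c) = r ^+ 2 by rewrite -norm2_sq zc.
have r20 : 0 < r ^+ 2 by rewrite exprn_gt0.
have zN : 0 <= dot (z - c) N.
  by have := cone (- (z - c)); rewrite !dotNl r2 oppr_lt0 oppr_le0; apply.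
pose k := dot (z - c) N / r ^+ 2.
(* the component [d] of [N] orthogonal to [z - c] vanishes, as [d - eta (z - c)]
   points into the ball for every [eta > 0] *)
have NkE : N = k *: (z - c).
  apply: subr0_eq; apply: norm2_eq0; apply/eqP; rewrite -sqrf_eq0 norm2_sq; set d := N - _.
  have dz : dot d (z - c) = 0 by rewrite dotBl dotZl r2 /k divfK ?gt_eqF// dotC subrr.
  have dd : dot d d = dot d N.
    have -> : dot d d = dot d N - k * dot d (z - c) by rewrite -dotZr -dotBr.
    by rewrite dz mulr0 subr0.
  rewrite eq_le -norm2_sq sqr_ge0 andbT norm2_sq leNgt; apply/negP => d0.
  have q0 : 0 < dot (z - c) N + 1 by rewrite ltr_wpDl.
  pose eta := dot d d / (dot (z - c) N + 1).
  have eta0 : 0 < eta by rewrite divr_gt0.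
  have : dot (d - eta *: (z - c)) N <= 0.
    apply: cone; rewrite (_ : dot _ (z - c) = dot d (z - c) - eta * dot (z - c) (z - c)); last first.
      by rewrite -dotZl -dotBl.
    by rewrite dz r2 sub0r oppr_lt0 mulr_gt0.
  rewrite (_ : dot _ N = dot d N - eta * dot (z - c) N); last by rewrite -dotZl -dotBl.
  rewrite -dd subr_le0 leNgt => /negP; apply.
  have etaE : eta * (dot (z - c) N + 1) = dot d d by rewrite divfK ?gt_eqF.
  by rewrite -etaE ltr_pM2l ?ltrDl.
have k0 : 0 < k.
  rewrite lt_neqAle divr_ge0 ?(ltW r20)// andbT; apply/eqP => k0.
  have := last_graph_point (- a) (1 : R); rewrite -/N NkE -k0 scale0r /last_coord mxE.
  by apply/eqP; rewrite eq_sym oner_eq0.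
pose lam := k^-1.
have lam0 : 0 < lam by rewrite invr_gt0.
have NE : z - c = lam *: N by rewrite NkE scalerA mulVf ?scale1r// gt_eqF.
exists rB, L, lam, psi, a; split => //.
- by rewrite NE head_coordsZ head_graph_point scalerN scaleNr.
- by rewrite NE last_coordZ last_graph_point mulr1.
- move=> d dr x [xd xg]; have : [set x : E | B (head_coords x) /\ last_coord x = psi (head_coords x)] x.
    by split=> //; exact: lt_le_trans dr.
  by rewrite -bdU => -[].
- move=> d d0 dr.
  have : nbhs z (U `&` (@head_coords R m) @^-1` ball2 z' d).
    apply: open_nbhs_nbhs; split; last by split=> //; rewrite /ball2/= subrr norm20.
    apply: openI => //; apply: open_comp => [x _|]; [exact: continuous_head|exact: open_ball2].
  move=> /nbhs_norm2[rho rho0 rhoP]; exists rho => // x bx /rhoP[Ux xd].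
  split=> //; have : (boundary W `&` U) x by [].
  by rewrite bdU => -[].
- have [rho rho0 rhoU] : exists2 e, 0 < e & forall x, norm2 (x - z) < e -> U x.
    by apply/nbhs_norm2; exact: open_nbhs_nbhs.
  have [d d0 dP] := flat_z _ ltr01.
  exists (Num.min rho d); first by rewrite lt_min rho0.
  move=> b /andP[rb]; rewrite -ltrBlDl lt_min => /andP[brho bd].
  pose s := (b - r) / r; have s0 : 0 < s by rewrite divr_gt0// subr_gt0.
  have bE : b / r = 1 + s by rewrite /s mulrBl divff ?gt_eqF// addrC subrK.
  have pE : pole c z r b = z + s *: (z - c).
    by rewrite /pole bE scalerDl scale1r addrA [c + _]addrC subrK.
  have pz : norm2 (pole c z r b - z) = b - r by exact: pole_dist.
  have sr : s * r = b - r by rewrite /s divfK// gt_eqF.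
  have Up : U (pole c z r b) by apply: rhoU; rewrite pz.
  have hp : head_coords (pole c z r b) - z' = - (s * lam) *: a.
    rewrite pE head_coordsD addrC addKr head_coordsZ NE head_coordsZ head_graph_point.
    by rewrite scalerN scalerN scaleNr !scalerA.
  have lp : last_coord (pole c z r b) = last_coord z + s * lam.
    by rewrite pE last_coordD last_coordZ NE last_coordZ last_graph_point mulr1.
  have := dP (head_coords (pole c z r b)).
  rewrite -head_coordsB => /(_ (le_lt_trans (norm2_head_le _) _)); rewrite pz => /(_ bd).
  rewrite head_coordsB -/z' hp dotZr psi_z norm2Z normrN mul1r -norm2_sq.
  have sl : 0 < s * lam by rewrite mulr_gt0.
  rewrite (gtr0_norm sl) ler_norml => /andP[_ le].
  have psi_lt : psi (head_coords (pole c z r b)) < last_coord (pole c z r b).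
    rewrite lp; move: le sl; clear -R; move: (psi _) (last_coord z) (s * lam) (norm2 a) => p q k1 A le k10.
    have : 0 < k1 * (1 - A + A ^+ 2) by rewrite mulr_gt0//; have := sqr_ge0 (A - 2^-1); lra.
    by move: le; lra.
  have nW : ~ W (pole c z r b).
    move=> Wp; have : (W `&` U) (pole c z r b) by [].
    by rewrite WU => -[_ /andP[_]]; rewrite ltNge (ltW psi_lt).
  move=> clp; have : (boundary W `&` U) (pole c z r b) by split=> //; apply/boundary_open.
  by rewrite bdU => -[_ h]; move: psi_lt; rewrite h ltxx.
Qed.

End Flat.

(** * Rigidity of the domain *)

Section Limits.
Context {R : realType}.

Lemma le0_right (f : R -> R) (r t : R) : 0 < t -> {for r, continuous f} ->
  (forall b, r < b < r + t -> f b <= 0) -> f r <= 0.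
Proof.
move=> t0 cf fle; rewrite leNgt; apply/negP => fr.
have /nbhs_ballP[e /= e0 eP] := cvgr_gt (FF := nbhs_filter r) _ cf _ fr.
pose s := Num.min e t / 2.
have m0 : 0 < Num.min e t by rewrite lt_min e0.
have me : Num.min e t <= e by rewrite ge_min lexx.
have mt : Num.min e t <= t by rewrite ge_min lexx orbT.
have s0 : 0 < s by rewrite divr_gt0.
have : ball r e (r + s).
  by rewrite -ball_normE/= opprD addNKr normrN gtr0_norm// /s; lra.
move=> /eP /=; apply/negP; rewrite -leNgt fle// ltrDl s0/= ltrD2l /s; lra.
Qed.

(** The form of all estimates below: the term carrying [M], which comes from the
    points far from the touching point, disappears as [b] tends to [r]. *)
Lemma limit_at_radius (n : nat) (r t s al be M q A : R) : 0 < r -> 0 < t ->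
    (forall b, r < b < r + t -> b ^+ 2 * b ^- n * s <=
      al * (b ^+ 2 * b ^- n) + be + (b ^+ 2 - r ^+ 2) * M - (q - b ^+ 2) * A) ->
  r ^+ 2 * r ^- n * s <= al * (r ^+ 2 * r ^- n) + be - (q - r ^+ 2) * A.
Proof.
move=> r0 t0 h.
pose f b := (s - al) * (b ^+ 2 * b ^- n) - be - (b ^+ 2 - r ^+ 2) * M + (q - b ^+ 2) * A.
suff : f r <= 0 by rewrite /f; lra.
apply: (le0_right t0) => [|b /h]; last by rewrite /f; lra.
have c2 : {for r, continuous (fun b : R => b ^+ 2)} by exact: exprn_continuous.
have cn : {for r, continuous (fun b : R => b ^- n)}.
  by apply: cvgV; [rewrite expf_neq0// gt_eqF|exact: exprn_continuous].
have cc (k : R) : {for r, continuous (fun=> k)} by exact: cst_continuous.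
apply: continuousD; first apply: continuousB; first apply: continuousB.
- by apply: continuousM => //; exact: continuousM.
- exact: cc.
- by apply: continuousM => //; exact: continuousB.
- by apply: continuousM => //; exact: continuousB.
Qed.

End Limits.

Section Rigidity.
Context {R : realType} {m : nat}.
Local Notation E := 'rV[R]_m.+1.
Local Notation hm := (@hausdorff_measure R m.+1 m).
Implicit Types (x p q : E).

Let fine_ge0 (X : set E) : 0 <= fine (hm X).
Proof. by rewrite fine_ge0// measure_ge0. Qed.

Lemma le_hm (X Y : set E) : X `<=` Y -> (hm X <= hm Y)%E.
Proof. exact: le_hausdorff. Qed.

(** A cap of a sphere has positive area: otherwise the Poisson kernels with poles
    tending to its centre would have mean values tending to zero. *)
Lemma sphere_cap_not_null (c q0 : E) (r d : R) : (0 < m)%N -> 0 < r -> 0 < d ->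
    (hm (sphere2 c r) < +oo)%E -> 0 < fine (hm (sphere2 c r)) -> norm2 (q0 - c) = r ->
  hm (sphere2 c r `&` ball2 q0 d) <> 0%E.
Proof.
move=> m0 r0 d0 Sfin Spos qr null; set S := sphere2 c r in Sfin Spos null.
have mS : (@hausdorff R m.+1 m).-cara.-measurable S.
  by apply: closed_cara_measurable; exact: closed_sphere2.
have mC : (@hausdorff R m.+1 m).-cara.-measurable (S `&` ball2 q0 d).
  by apply: measurableI => //; apply: open_cara_measurable; exact: open_ball2.
pose M := (d / 2) ^- m.+1 * fine (hm S).
have d2 : 0 < d / 2 by rewrite divr_gt0.
suff : r ^+ 2 * r ^- m.+1 * fine (hm S) <= 0 * (r ^+ 2 * r ^- m.+1) + 0 - (0 - r ^+ 2) * 0.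
  rewrite mul0r mulr0 addr0 subr0; apply/negP; rewrite -ltNge.
  by rewrite mulr_gt0// mulr_gt0 ?invr_gt0 ?exprn_gt0.
apply: (limit_at_radius (M := M) r0 d2) => b /andP[rb bd].
have b0 := lt_trans r0 rb; have pd := pole_dist r0 qr rb.
rewrite -(sphere_poisson_mean m0 r0 rb Sfin (pole_center r0 qr b0)).
pose h := fun x : E => (b ^+ 2 - r ^+ 2) * norm2 (x - pole c q0 r b) ^- m.+1.
have br : 0 <= b ^+ 2 - r ^+ 2 by rewrite subr_ge0 lerXn2r ?nnegrE ?ltW.
have h0 x : 0 <= h x by rewrite mulr_ge0// invr_ge0 exprn_ge0// norm2_ge0.
have ge_p x : S x -> b - r <= norm2 (x - pole c q0 r b) by move=> Sx; exact: sphere_pole_ge.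
have br0 : 0 < b - r by rewrite subr_gt0.
have mh : measurable_fun (S : set (caratheodory_type (@hausdorff R m.+1 m))) h.
  apply: continuous_cara_measurable_fun => // x Sx.
  apply: continuousM; first exact: cst_continuous.
  apply: (continuous_comp (f := fun x : E => x - pole c q0 r b) (g := fun x : E => norm2 x ^- m.+1)).
    by apply: continuousB; [move=> A; exact|exact: cst_continuous].
  by apply: continuous_norm2V; rewrite -norm2_gt0 (lt_le_trans br0)// ge_p.
have hi : hm.-integrable S (EFin \o h).
  apply: (bounded_integrable mS Sfin mh (M := (b ^+ 2 - r ^+ 2) * (b - r) ^- m.+1)) => x Sx.
  rewrite ger0_norm// ler_wpM2l// lef_pV2 ?posrE ?exprn_gt0 ?(lt_le_trans br0) ?ge_p//.
  by rewrite lerXn2r ?nnegrE ?norm2_ge0 ?ge_p// ltW.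
have hiC : hm.-integrable (S `&` ball2 q0 d) (EFin \o h) by apply: (integrableS mS mC _ hi) => x [].
have Cint : Rintegral hm (S `&` ball2 q0 d) h = 0.
  by rewrite /Rintegral (null_set_integral mC (measurable_int hm hiC) null).
have := Rintegral_three_parts (mu := hm) (M := (b ^+ 2 - r ^+ 2) * (d / 2) ^- m.+1) (A := 0)
  mS mC (measurable0 : measurable (set0 : set (caratheodory_type (@hausdorff R m.+1 m)))) Sfin _ _ hi hiC (fun x _ => h0 x) (fun x _ => lexx (h x)) _ _ _.
rewrite Cint mul0r add0r subr0 => h1; apply: le_trans (h1 _ _ _ _ _) _.
- by move=> x [].
- by [].
- by rewrite mulr_ge0// invr_ge0 exprn_ge0// ltW.
- move=> x Sx nx; rewrite ler_wpM2l//.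
  have dx : d / 2 <= norm2 (x - pole c q0 r b).
    have : d <= norm2 (x - q0) by rewrite leNgt; apply/negP => ?; apply: nx.
    by have := norm2_triangle x (pole c q0 r b) q0; rewrite pd; lra.
  rewrite lef_pV2 ?posrE ?exprn_gt0 ?(lt_le_trans d2)//.
  by rewrite lerXn2r ?nnegrE ?norm2_ge0// ltW.
- by [].
- by rewrite mul0r !mulr0 !add0r subr0 /M mulrA.
Qed.

Variables (W : set E) (c z : E).
Hypotheses (m0 : (0 < m)%N) (oW : open W) (bW : bounded_set W) (Wc : W c)
  (Dfin : (hm (boundary W) < +oo)%E) (ps : harmonic_pseudosphere W c)
  (tz : touching_set W c z) (flat : lipschitz_flat W z).
Local Notation r := (norm2 (z - c)).
Local Notation S := (sphere2 c r).
Local Notation D := (boundary W).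

Let r0 : 0 < r. Proof. by have [] := touching_ball oW Wc tz. Qed.

Let far x : D x -> r <= norm2 (x - c).
Proof. by have [_ h _] := touching_ball oW Wc tz; exact: h. Qed.

Let mD : (@hausdorff R m.+1 m).-cara.-measurable D.
Proof. by apply: closed_cara_measurable; exact: closed_boundary. Qed.

(** Every ray from [c] leaves the bounded domain, so the boundary projects onto the
    inscribed sphere, and the projection does not increase area. *)
Lemma sphere_le_boundary : (hm S <= hm D)%E.
Proof.
change (hausdorff m.+1 m S <= hausdorff m.+1 m D)%E.
have proj := @le_hausdorff_radial_proj R m.+1 m c _ S D r0 (@far); apply: proj => q Sq.
have qc : q - c != 0 by rewrite -norm2_gt0 (Sq : norm2 (q - c) = r).
have [t t0 bt] := exit_ray oW bW Wc qc.
by exists (c + t *: (q - c)) => //; rewrite radial_proj_ray// addrC subrK.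
Qed.

Let Sfin : (hm S < +oo)%E.
Proof. exact: le_lt_trans sphere_le_boundary Dfin. Qed.

Definition excess (eta : R) : set E := D `&` [set x | r + eta <= norm2 (x - c)].

Lemma measurable_excess eta : (@hausdorff R m.+1 m).-cara.-measurable (excess eta).
Proof.
apply: measurableI => //; apply: closed_cara_measurable.
apply: (closed_comp (f := fun x : E => norm2 (x - c)) (D := [set t | r + eta <= t])) => [y _|]; last exact: closed_ge.
exact: continuous_norm2B.
Qed.

(** Take the Poisson kernel with an exterior pole tending to [z]. Near [z],
    [near_estimate] bounds its integral; away from [z] its positive part tends to
    zero; on [excess eta] it stays below a negative constant. Its integral over the
    whole boundary is known, which bounds the area of the excess. *)
Lemma excess_estimate eta : 0 < eta -> exists2 A : R, 0 < A &
  forall zeta, 0 < zeta -> r ^+ 2 * r ^- m.+1 * fine (hm D) <=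
    (1 + zeta) * fine (hm S) * (r ^+ 2 * r ^- m.+1) + zeta -
    ((r + eta) ^+ 2 - r ^+ 2) * (A * fine (hm (excess eta))).
Proof.
move=> eta0; have [K K0 WK] := bounded_norm2 bW.
have [_ _ ballW] := touching_ball oW Wc tz; have Dz : D z by case: tz.
have [rB [L [lam [psi [a lg]]]]] := local_graph_ex oW r0 erefl Dz ballW flat.
pose K' := K + norm2 c + (r + 1).
have K'0 : 0 < K' by rewrite addr_gt0 ?ltr_wpDr// norm2_ge0.
have A0 : 0 < K' ^- m.+1 by rewrite invr_gt0 exprn_gt0.
exists (K' ^- m.+1) => // zeta zeta0.
have [d [d0 dr near]] := near_estimate m0 r0 erefl (lg_rB lg) (lg_lam lg) (lg_L lg)
  (lg_head lg) (lg_last lg) (lg_psi lg) (lg_lip lg) (lg_flat lg) (lg_ray lg) zeta0 Sfin.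
have [rho rho0 rhoG] := lg_near lg d0 dr; have [t1 t10 pole_out] := lg_pole lg.
have GD := lg_graph lg dr.
have mG := measurable_graph (lg_L lg) (lg_lip lg) dr.
have rho2 : 0 < rho / 2 by rewrite divr_gt0.
pose t := Num.min (Num.min 1 t1) (Num.min eta (rho / 2)).
have t0 : 0 < t by rewrite !lt_min ltr01 t10 eta0.
apply: (limit_at_radius (M := (rho / 2) ^- m.+1 * fine (hm D)) r0 t0) => b /andP[rb].
rewrite -ltrBlDl !lt_min => /andP[/andP[b1 bt1] /andP[beta brho]].
have b0 := lt_trans r0 rb; have pc := pole_center r0 erefl b0.
have pz := pole_dist r0 erefl rb.
set p := pole c z r b in pc pz.
have Wp : ~ closure W p by apply: pole_out; rewrite rb -ltrBlDl.
have [hE _] := pseudosphere_poisson m0 oW Wc Dfin ps Wp; rewrite pc in hE.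
set h := (X in Rintegral hm D X = _) in hE.
have rb1 : r < b < r + 1 by rewrite rb -ltrBlDl.
have [ki kle] := near b rb1; rewrite -/p in ki kle.
have p_far x : boundary W x -> 0 < norm2 (x - p).
  move=> [Wx _]; rewrite norm2_gt0; apply/eqP => /subr0_eq xp; by apply: Wp; rewrite -xp.
have [e e0 ep] : exists2 e, 0 < e & forall x, closure W x -> e <= norm2 (x - p).
  have : nbhs p (~` closure W).
    by apply: open_nbhs_nbhs; split => //; apply: closed_openC; exact: closed_closure.
  move=> /nbhs_norm2[e e0 eP]; exists e => // x Wx; rewrite leNgt; apply/negP => /eP; exact.
have br2 : 0 <= b ^+ 2 - r ^+ 2 by rewrite subr_ge0 lerXn2r ?nnegrE ?ltW.
have k0 x : 0 <= norm2 (x - p) ^- m.+1 by rewrite invr_ge0 exprn_ge0// norm2_ge0.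
have inv_le (s u : R) : 0 < s -> s <= u -> u ^- m.+1 <= s ^- m.+1.
  move=> s0 su; rewrite lef_pV2 ?posrE ?exprn_gt0 ?(lt_le_trans s0)//.
  by rewrite lerXn2r ?nnegrE ?(ltW s0) ?(le_trans (ltW s0)).
have mh : measurable_fun (D : set (caratheodory_type (@hausdorff R m.+1 m))) h.
  apply: continuous_cara_measurable_fun => // x Dx; apply: continuousM.
    apply: continuousB; first exact: cst_continuous.
    by apply: continuousM; exact: continuous_norm2B.
  apply: (continuous_comp (f := fun x : E => x - p) (g := fun x : E => norm2 x ^- m.+1)).
    by apply: continuousB; [move=> B; exact|exact: cst_continuous].
  by apply: continuous_norm2V; rewrite -norm2_gt0 p_far.
have cK x : closure W x -> norm2 (x - c) <= K + norm2 c.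
  by move=> Wx; rewrite (le_trans (norm2D _ _))// norm2N lerD2r WK.
have hi : hm.-integrable D (EFin \o h).
  apply: (bounded_integrable mD Dfin mh (M := (b ^+ 2 + (K + norm2 c) ^+ 2) * e ^- m.+1)) => x Dx.
  have Wx : closure W x by case: Dx.
  rewrite /h normrM (ger0_norm (k0 x)); apply: ler_pM => //; last exact: inv_le e0 (ep x Wx).
  have := cK x Wx; have := norm2_ge0 (x - c); move: (norm2 (x - c)) (K + norm2 c) => s u s0 su.
  have su2 : s ^+ 2 <= u ^+ 2 by rewrite lerXn2r ?nnegrE// (le_trans s0).
  by rewrite ler_norml; have := sqr_ge0 b; have := sqr_ge0 s; lra.
have kiG : hm.-integrable (graph z psi d)
    (EFin \o (fun x => (b ^+ 2 - r ^+ 2) * norm2 (x - p) ^- m.+1)).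
  exact: integrable_scaleR.
have h_near x : graph z psi d x -> h x <= (b ^+ 2 - r ^+ 2) * norm2 (x - p) ^- m.+1.
  move=> /GD /far xr; apply: ler_wpM2r => //; rewrite lerD2l lerN2.
  by rewrite lerXn2r ?nnegrE ?norm2_ge0.
have h_far x : D x -> ~ graph z psi d x -> h x <= (b ^+ 2 - r ^+ 2) * (rho / 2) ^- m.+1.
  move=> Dx nG; apply: (@le_trans _ _ ((b ^+ 2 - r ^+ 2) * norm2 (x - p) ^- m.+1)).
    by apply: ler_wpM2r => //; rewrite lerD2l lerN2 lerXn2r ?nnegrE ?norm2_ge0 ?far.
  apply: ler_wpM2l => //; apply: inv_le => //.
  have : rho <= norm2 (x - z) by rewrite leNgt; apply/negP => /(rhoG _ Dx).
  by have := norm2_triangle x p z; rewrite pz; move: brho; lra.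
have h_excess x : excess eta x -> h x <= - (((r + eta) ^+ 2 - b ^+ 2) * K' ^- m.+1).
  move=> [Dx /= xe]; have Wx : closure W x by case: Dx.
  have re0 : 0 <= r + eta by rewrite addr_ge0 ?(ltW r0) ?(ltW eta0).
  have be : b <= r + eta by rewrite -lerBlDl ltW.
  have n1 : (r + eta) ^+ 2 <= norm2 (x - c) ^+ 2 by rewrite lerXn2r ?nnegrE ?norm2_ge0.
  have n2 : 0 <= (r + eta) ^+ 2 - b ^+ 2 by rewrite subr_ge0 lerXn2r ?nnegrE ?(ltW b0).
  have xK : norm2 (x - p) <= K'.
    have := norm2_triangle x c p; rewrite [norm2 (c - p)]norm2_distC pc.
    by have := cK x Wx; rewrite /K'; move: b1; lra.
  rewrite -mulNr opprB; apply: (@le_trans _ _ ((b ^+ 2 - (r + eta) ^+ 2) * norm2 (x - p) ^- m.+1)).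
    by apply: ler_wpM2r => //; rewrite lerD2l lerN2.
  by apply: ler_wnM2l; [rewrite -oppr_ge0 opprB|apply: inv_le => //; exact: p_far].
have M0 : 0 <= (b ^+ 2 - r ^+ 2) * (rho / 2) ^- m.+1.
  by rewrite mulr_ge0// invr_ge0 exprn_ge0// ltW.
have := Rintegral_three_parts mD mG (measurable_excess eta) Dfin GD
  (fun x h => h.1) hi kiG (fun x _ => mulr_ge0 br2 (k0 x)) h_near M0 h_far h_excess.
rewrite hE (RintegralZl _ mG ki) => main; apply: le_trans main _.
rewrite -!mulrA lerD2r lerD2r; apply: le_trans kle _.
by rewrite (mulrC (fine _)) -!mulrA.
Qed.

(** By [sphere_le_boundary] the area of the boundary is at least that of the sphere,
    which leaves no room for the excess term. *)
Lemma boundary_on_sphere_ae :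
  0 < fine (hm S) /\ forall eta, 0 < eta -> hm (excess eta) = 0%E.
Proof.
have Dpos : 0 < fine (hm D).
  have [_ _ ballW] := touching_ball oW Wc tz; have Dz : D z by case: tz.
  have [rB [L [lam [psi [a lg]]]]] := local_graph_ex oW r0 erefl Dz ballW flat.
  have [t t0 tP] := lg_pole lg.
  have Wp : ~ closure W (pole c z r (r + t / 2)) by apply: tP; lra.
  by have [] := pseudosphere_poisson m0 oW Wc Dfin ps Wp.
have SD : fine (hm S) <= fine (hm D).
  by rewrite fine_le ?ge0_fin_numE ?measure_ge0// sphere_le_boundary.
have kap0 : 0 < r ^+ 2 * r ^- m.+1 by rewrite mulr_gt0 ?invr_gt0 ?exprn_gt0.
have est eta : 0 < eta -> exists2 A, 0 < A &
    r ^+ 2 * r ^- m.+1 * fine (hm D) <= r ^+ 2 * r ^- m.+1 * fine (hm S) - A * fine (hm (excess eta)).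
  move=> eta0; have [A A0 h] := excess_estimate eta0.
  exists (((r + eta) ^+ 2 - r ^+ 2) * A).
    rewrite mulr_gt0// subr_gt0 ltrXn2r ?nnegrE ?(ltW r0) ?addr_ge0 ?(ltW eta0)//.
    by rewrite ltrDl eta0.
  move: h (fine_ge0 S); move: (r ^+ 2 * r ^- m.+1) kap0 (fine (hm D)) (fine (hm S)) (fine _).
  move: (_ - _) => B k k0 d s y h s0; apply/ler_addgt0Pr => e e0.
  have q0 : 0 < s * k + 1 by rewrite ltr_wpDl// mulr_ge0// ltW.
  have := h _ (divr_gt0 e0 q0).
  have -> : (1 + e / (s * k + 1)) * s * k + e / (s * k + 1) = k * s + e.
    by field; rewrite gt_eqF.
  by rewrite mulrA; lra.
split.
  have [A A0 h] := est 1 ltr01.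
  have : 0 < r ^+ 2 * r ^- m.+1 * fine (hm S).
    apply: (@lt_le_trans _ _ (r ^+ 2 * r ^- m.+1 * fine (hm D))); first exact: mulr_gt0.
    by apply: le_trans h _; rewrite lerBlDr lerDl mulr_ge0// ltW.
  by rewrite pmulr_rgt0.
move=> eta eta0; have [A A0 h] := est eta eta0.
have Yfin : hm (excess eta) \is a fin_num.
  rewrite ge0_fin_numE ?measure_ge0//; apply: le_lt_trans Dfin.
  by apply: le_hm => x [].
have : A * fine (hm (excess eta)) <= 0.
  have := ler_wpM2l (ltW kap0) SD; move: h.
  by move: (_ * _) (_ * fine (hm D)) (A * _) => *; lra.
rewrite pmulr_rle0// => Y0.
by rewrite -(fineK Yfin); congr (_%:E); apply/eqP; rewrite eq_le Y0 fine_ge0.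
Qed.

(** Near a point [p] of the domain outside of the closed ball, all rays from [c]
    leave the domain at distance more than [|p - c|]: the excess would project onto
    a cap of the sphere, which is not null. *)
Lemma domain_in_closed_ball p : W p -> norm2 (p - c) <= r.
Proof.
move=> Wp; rewrite leNgt; apply/negP => pr; have [Spos null] := boundary_on_sphere_ae.
have pc0 := lt_trans r0 pr.
have /nbhs_norm2[rho rho0 rhoW] : nbhs p W by exact: open_nbhs_nbhs.
have eta0 : 0 < norm2 (p - c) - r by rewrite subr_gt0.
pose q0 := radial_proj c r p; have q0r : norm2 (q0 - c) = r by exact: radial_proj_sphere.
pose d := rho * (r / norm2 (p - c)); have d0 : 0 < d by rewrite mulr_gt0// divr_gt0.
apply: (sphere_cap_not_null m0 r0 d0 Sfin Spos q0r); apply/eqP.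
rewrite eq_le measure_ge0 andbT -(null _ eta0).
change (hausdorff m.+1 m (S `&` ball2 q0 d) <= hausdorff m.+1 m (excess (norm2 (p - c) - r)))%E.
have Yr y : excess (norm2 (p - c) - r) y -> r <= norm2 (y - c) by move=> [/far].
have proj := @le_hausdorff_radial_proj R m.+1 m c _ (S `&` ball2 q0 d) _ r0 Yr.
apply: proj => q [Sq qd]; pose k := norm2 (p - c) / r.
have k0 : 0 < k by rewrite divr_gt0.
have qr : norm2 (q - c) = r by [].
have Wpq : W (c + k *: (q - c)).
  apply: rhoW; have -> : c + k *: (q - c) - p = k *: (q - q0).
    have -> : q - q0 = (q - c) - (r / norm2 (p - c)) *: (p - c) by rewrite /q0 opprD addrA.
    have k1 : k * (r / norm2 (p - c)) = 1 by rewrite /k; field; rewrite !gt_eqF.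
    by rewrite (scalerBr k (q - c)) scalerA k1 scale1r opprB [c + _]addrC -addrA.
  rewrite norm2Z gtr0_norm//; apply: (@lt_le_trans _ _ (k * d)); first by rewrite ltr_pM2l.
  by rewrite /k /d le_eqVlt; apply/orP; left; apply/eqP; field; rewrite !gt_eqF.
have qc : q - c != 0 by rewrite -norm2_gt0 qr.
have [t t0] := exit_ray oW bW Wpq qc; rewrite -addrA -scalerDl => bt.
have kt : 0 < k + t by rewrite addr_gt0.
exists (c + (k + t) *: (q - c)); last by rewrite radial_proj_ray// addrC subrK.
split=> //=; rewrite [c + _ - c]addrC addKr norm2Z gtr0_norm// qr mulrDl /k divfK ?gt_eqF//.
by rewrite addrC subrK lerDl mulr_ge0 ?ltW.
Qed.

Lemma domain_is_ball : W = ball2 c r.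
Proof.
have [_ _ ballW] := touching_ball oW Wc tz.
apply/seteqP; split=> // p Wp; rewrite /ball2/= lt_neqAle domain_in_closed_ball// andbT.
apply/eqP => pr; have pc0 : 0 < norm2 (p - c) by rewrite pr.
have /nbhs_norm2[rho rho0 rhoW] : nbhs p W by exact: open_nbhs_nbhs.
pose t := rho / 2 / norm2 (p - c); have t0 : 0 < t by rewrite !divr_gt0.
have : W (p + t *: (p - c)).
  apply: rhoW; rewrite addrC addKr norm2Z gtr0_norm// divfK ?gt_eqF//; lra.
move=> /domain_in_closed_ball; rewrite addrAC -[p - c in X in X + _]scale1r -scalerDl.
rewrite norm2Z gtr0_norm ?addr_gt0// pr; apply/negP; rewrite -ltNge.
by rewrite ltr_pMl// ltrDl.
Qed.

End Rigidity.

Theorem corollary1p10 (R : realType) (m : nat) (n_ge2 : (2 <= m.+1)%N)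
  (W : set 'rV[R]_m.+1) (x0 z : 'rV[R]_m.+1)
  (W_bounded : bounded_set W) (W_open : open W)
  (W_bd_finite : (hausdorff_measure m.+1 m (boundary W) < +oo)%E)
  (W_x0 : W x0)
  (W_pseudosphere : harmonic_pseudosphere W x0)
  (z_touching : touching_set W x0 z)
  (W_flat : lipschitz_flat W z) :
  boundary W = boundary (ball2 x0 (norm2 (x0 - z))).
Proof.
rewrite norm2_distC; congr boundary.
exact: (domain_is_ball n_ge2 W_open W_bounded W_x0 W_bd_finite W_pseudosphere z_touching W_flat).
Qed.
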